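(* Let $P\subset\mathbb R^n$ be an $n$-dimensional convex polytope with the generating property. Then $P$ is strongly monotypic.
   Context: For a polytope $P\subset\mathbb R^n$, $N(P)$ denotes the (finite) set of outward unit normal vectors of the facets of $P$. A polytope $P$ has the generating property if the intersection of every family of translates of $P$ is either empty or a Minkowski summand of $P$ (i.e. a set $A$ for which there is a set $B$ with $A+B=\{a+b:a\in A,b\in B\}=P$). $P$ is strongly monotypic if every polytope $Q$ with $N(Q)=N(P)$ has the property that the arrangement of the hyperplanes spanned by the facets of $Q$ is combinatorially equivalent to the arrangement of the hyperplanes spanned by the facets of $P$. *)

(* Defs.v *)
From mathcomp Require Import all_boot all_order all_algebra.
From mathcomp Require Import all_classical all_reals topology normedtype.

Set Implicit Arguments.
Unset Strict Implicit.
Unset Printing Implicit Defensive.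

Import Order.TTheory GRing.Theory Num.Theory.
Import numFieldNormedType.Exports.

Local Open Scope classical_set_scope.
Local Open Scope ring_scope.

(* Euclidean inner product; the library norm `|u| on matrices is the sup norm,
   so unit vectors are expressed by [dotp u u = 1]. *)
Definition dotp {R : realType} {n : nat} (u v : 'rV[R]_n) : R :=
  \sum_(i < n) u 0 i * v 0 i.

Definition translate {R : realType} {n : nat} (t : 'rV[R]_n)
    (A : set 'rV[R]_n) : set 'rV[R]_n :=
  [set t + a | a in A].

Definition minkowski_sum {R : realType} {n : nat} (A B : set 'rV[R]_n) :
    set 'rV[R]_n :=
  [set a + b | a in A & b in B].

Definition polytope {R : realType} {n : nat} (P : set 'rV[R]_n) : Prop :=
  exists k (v : 'I_k -> 'rV[R]_n),
    P = [set x | exists l : 'I_k -> R,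
           [/\ forall i, 0 <= l i, \sum_(i < k) l i = 1
             & x = \sum_(i < k) l i *: v i]].

Definition affine_hull {R : realType} {n : nat} (A : set 'rV[R]_n) :
    set 'rV[R]_n :=
  [set x | exists k (v : 'I_k -> 'rV[R]_n) (l : 'I_k -> R),
     [/\ forall i, A (v i), \sum_(i < k) l i = 1
       & x = \sum_(i < k) l i *: v i]].

(* The empty set has no dimension in this sense. *)
Definition has_dim {R : realType} {n : nat} (A : set 'rV[R]_n) (d : nat) :
    Prop :=
  exists (p : 'rV[R]_n) (W : {vspace 'rV[R]_n}),
    \dim W = d /\ affine_hull A = [set x | x - p \in W].

(* The set of points of P at which the linear functional <u, -> is maximal. *)
Definition support_face {R : realType} {n : nat} (P : set 'rV[R]_n)
    (u : 'rV[R]_n) : set 'rV[R]_n :=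
  [set x | P x /\ forall y, P y -> dotp u y <= dotp u x].

(* u = 0 only yields F = P, which the dimension condition excludes. *)
Definition facet {R : realType} {n : nat} (P F : set 'rV[R]_n) : Prop :=
  (exists u, F = support_face P u) /\
  (exists d, has_dim P d.+1 /\ has_dim F d).

(* A polytope Q of dimension < n has either no facet (dimension 0) or infinitely
   many unit outward normals in this sense.  Hence facet_normals Q =
   facet_normals P with P n-dimensional and n > 0 forces Q to be
   n-dimensional. *)
Definition facet_normals {R : realType} {n : nat} (P : set 'rV[R]_n) :
    set 'rV[R]_n :=
  [set u | dotp u u = 1 /\ facet P (support_face P u)].

(* A family of translates is given by its (nonempty) set of translation
   vectors: the intersection of the empty family is the whole space. *)
Definition generating_property {R : realType} {n : nat}
    (P : set 'rV[R]_n) : Prop :=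
  forall T : set 'rV[R]_n, T !=set0 ->
    let I := \bigcap_(t in T) translate t P in
    I = set0 \/ exists B : set 'rV[R]_n, minkowski_sum I B = P.

Definition hyperplane {R : realType} {n : nat} (u : 'rV[R]_n) (c : R) :
    set 'rV[R]_n :=
  [set x | dotp u x = c].

Definition facet_arrangement {R : realType} {n : nat} (P : set 'rV[R]_n) :
    set (set 'rV[R]_n) :=
  [set affine_hull F | F in facet P].

(* The relatively open face of the arrangement H containing x: all the points
   lying on the same side as x of (or with x on) each hyperplane of H.  An
   equation (u, c) of a hyperplane is unique up to a nonzero factor, so the
   condition does not depend on its choice. *)
Definition arrangement_cell {R : realType} {n : nat}
    (H : set (set 'rV[R]_n)) (x : 'rV[R]_n) : set 'rV[R]_n :=
  [set y | forall (u : 'rV[R]_n) (c : R), u != 0 -> H (hyperplane u c) ->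
     Num.sg (dotp u y - c) = Num.sg (dotp u x - c)].

Definition arrangement_faces {R : realType} {n : nat}
    (H : set (set 'rV[R]_n)) : set (set 'rV[R]_n) :=
  range (arrangement_cell H).

(* Isomorphism of face posets, where a relatively open face C is a face of D
   when it is contained in the closure of D. *)
Definition combinatorially_equivalent {R : realType} {n : nat}
    (H K : set (set 'rV[R]_n)) : Prop :=
  exists f : set 'rV[R]_n -> set 'rV[R]_n,
    set_bij (arrangement_faces H) (arrangement_faces K) f /\
    forall C D, arrangement_faces H C -> arrangement_faces H D ->
      (C `<=` closure D <-> f C `<=` closure (f D)).

Definition strongly_monotypic {R : realType} {n : nat}
    (P : set 'rV[R]_n) : Prop :=
  forall Q : set 'rV[R]_n, polytope Q -> facet_normals Q = facet_normals P ->
    combinatorially_equivalent (facet_arrangement Q) (facet_arrangement P).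

(* Main.v *)
(** Describe [P] by its facet inequalities [<u_i, x> <= h_i].  Both sides of the
    theorem are related through the circuits of the [u_i], i.e. the minimal
    linear dependencies: call a circuit bad if it has at least two positive and
    at least two negative coefficients.

    If there is no bad circuit, the sign of [sum_i c_i h_i] on a circuit [c] only
    depends on the signs of [c]: it is positive if at most one coefficient is
    negative, by irredundancy of the inequality of that coefficient.  By Farkas'
    lemma these signs decide which sign vectors are realized by the arrangement.

    Conversely let [P] be generating.  For every [psi] the polyhedron
    [{x | <u_i, x> <= eps psi_i}], [eps] small, is an intersection of translates
    of [P], so that [P] is simple and independent sets of normals whose cone
    contains no other normal are the normals of faces.  As facets of [P] are
    generating, by induction they have no bad circuit.  Take a bad circuit with
    as few normals as possible in its cone, say with positive part [a1, a2, ...]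
    and negative part [b1, b2, ...].  The cones of both parts cannot both be
    normal cones, so their common ray is spanned by a normal [e]; induction leaves
    [e = a1 + a2 = b1 + b2] up to scaling.  Since the facet of [e] has no bad
    circuit, exchanging [a1] with [a2] and [b1] with [b2] at a vertex yields four
    vertices forming a parallelogram; lowered slightly from the facet of [e], they
    give two translates of [P] whose intersection is not a summand of [P]. *)

Require Import Defs.
From mathcomp Require Import all_classical all_reals topology normedtype.
From mathcomp Require Import all_boot all_order all_algebra.
From mathcomp Require Import ring lra.

Set Implicit Arguments.
Unset Strict Implicit.
Unset Printing Implicit Defensive.

Import Order.TTheory GRing.Theory Num.Theory.
Import numFieldNormedType.Exports.

Local Open Scope ring_scope.

(** * Inner product and Weyl's theorem *)

(** The induction on facets dictates the setting. A facet is replaced by an unbounded cylinder, so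
    everything is stated for polyhedra given by a system [(J, u, h)]: [I] and the ambient space stay
    fixed, only [J] shrinks, and the induction is on [#|J|]. Such a polyhedron may contain lines.
    Hence optima come from Farkas' lemma instead of compactness, vertices are replaced by points
    with a maximal tight set, and the parallelogram closes only up to a vector orthogonal to all
    normals. Faces are represented by the sets of their tight indices; for a generating polyhedron
    these are exactly the primitive sets, which turns questions about faces into questions about the
    normals contained in a cone. In a minimal bad circuit a third normal of one sign is impossible
    because projecting it away leaves a bad circuit of its facet. In the facet of [e] the
    projections of [a1] and [a2] are opposite, as are those of [b1] and [b2]; a flip passes from a
    normal to its opposite, and the absence of bad circuits there makes two flips move different
    normals. *)

Section Dot.
Context {R : realType} {n : nat}.
Implicit Types u v w x y : 'rV[R]_n.

Lemma dotpC u v : dotp u v = dotp v u.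
Proof. by apply: eq_bigr => i _; rewrite mulrC. Qed.

Lemma dotpDr u x y : dotp u (x + y) = dotp u x + dotp u y.
Proof. by rewrite -big_split; apply: eq_bigr => i _; rewrite mxE mulrDr. Qed.

Lemma dotpZr a u x : dotp u (a *: x) = a * dotp u x.
Proof. by rewrite mulr_sumr; apply: eq_bigr => i _; rewrite mxE mulrCA. Qed.

Lemma dotpNr u x : dotp u (- x) = - dotp u x.
Proof. by rewrite -scaleN1r dotpZr mulN1r. Qed.

Lemma dotpBr u x y : dotp u (x - y) = dotp u x - dotp u y.
Proof. by rewrite dotpDr dotpNr. Qed.

Lemma dotp0r u : dotp u 0 = 0.
Proof. by rewrite -(scale0r u) dotpZr mul0r. Qed.

Lemma dotpDl u v x : dotp (u + v) x = dotp u x + dotp v x.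
Proof. by rewrite !(dotpC _ x) dotpDr. Qed.

Lemma dotpZl a u x : dotp (a *: u) x = a * dotp u x.
Proof. by rewrite !(dotpC _ x) dotpZr. Qed.

Lemma dotpNl u x : dotp (- u) x = - dotp u x.
Proof. by rewrite !(dotpC _ x) dotpNr. Qed.

Lemma dotpBl u v x : dotp (u - v) x = dotp u x - dotp v x.
Proof. by rewrite !(dotpC _ x) dotpBr. Qed.

Lemma dotp0l x : dotp 0 x = 0.
Proof. by rewrite dotpC dotp0r. Qed.

Lemma dotp_suml (I : Type) (r : seq I) (Q : pred I) (F : I -> 'rV[R]_n) x :
  dotp (\sum_(i <- r | Q i) F i) x = \sum_(i <- r | Q i) dotp (F i) x.
Proof.
by apply: (big_morph (dotp^~ x)) => [u v|]; [rewrite dotpDl | rewrite dotp0l].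
Qed.

Lemma dotp_sumr (I : Type) (r : seq I) (Q : pred I) (F : I -> 'rV[R]_n) x :
  dotp x (\sum_(i <- r | Q i) F i) = \sum_(i <- r | Q i) dotp x (F i).
Proof. by rewrite dotpC dotp_suml; apply: eq_bigr => i _; rewrite dotpC. Qed.

Lemma dotp_ge0 u : 0 <= dotp u u.
Proof. by apply: sumr_ge0 => i _; rewrite -expr2 sqr_ge0. Qed.

Lemma dotp_eq0 u : dotp u u = 0 -> u = 0.
Proof.
move=> /eqP; rewrite psumr_eq0 => [/allP u0|i _]; last by rewrite -expr2 sqr_ge0.
apply/rowP => i; rewrite mxE; apply/eqP.
by have := u0 i (mem_index_enum _); rewrite mulf_eq0 orbb.
Qed.

Lemma dotp_gt0 u : u != 0 -> 0 < dotp u u.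
Proof.
by move=> u0; rewrite lt_neqAle dotp_ge0 andbT eq_sym; apply: contra u0 => /eqP/dotp_eq0->.
Qed.

Lemma dotp_delta x i : dotp (delta_mx 0 i) x = x 0 i.
Proof.
rewrite /dotp (bigD1 i) //= big1 ?addr0 => [|j ji]; first by rewrite mxE !eqxx mul1r.
by rewrite mxE (negbTE ji) andbF mul0r.
Qed.

End Dot.

Definition dotE := (@dotpDl, @dotpDr, @dotpNl, @dotpNr, @dotpZl, @dotpZr, @dotp0l, @dotp0r).

Lemma dotp_row_mx (R : realType) m n (a c : 'rV[R]_m) (b d : 'rV[R]_n) :
  dotp (row_mx a b) (row_mx c d) = dotp a c + dotp b d.
Proof.
rewrite /dotp big_split_ord; congr (_ + _); apply: eq_bigr => i _.
  by rewrite !row_mxEl.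
by rewrite !row_mxEr.
Qed.

Section Weyl.
Context {R : realType} {n : nat}.

(** The cone generated by a list, unfolded one generator at a time to fit the elimination. *)
Fixpoint seq_cone (s : seq 'rV[R]_n) (x : 'rV[R]_n) : Prop :=
  if s is v :: s' then exists2 a : R, 0 <= a & seq_cone s' (x - a *: v) else x = 0.

(** The one-variable case of elimination: finitely many lower and upper bounds are compatible as
    soon as they are so in pairs. *)
Lemma between_seqs (lo up : seq R) :
  (forall a b, a \in lo -> b \in up -> a <= b) ->
  exists c, (forall a, a \in lo -> a <= c) /\ (forall b, b \in up -> c <= b).
Proof.
elim: lo up => [|a lo IH] up ab.
  elim: up {ab} => [|b up [c [_ cup]]]; first by exists 0.
  exists (Num.min b c); split=> // b'; rewrite inE => /orP[/eqP->|/cup cb].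
    by rewrite ge_min lexx.
  by rewrite ge_min cb orbT.
have [a' b' a'lo b'up|c [clo cup]] := IH up; first by rewrite ab // inE a'lo orbT.
exists (Num.max a c); split=> [a'|b bup].
  rewrite inE => /orP[/eqP->|/clo ac]; first by rewrite le_max lexx.
  by rewrite le_max ac orbT.
by rewrite ge_max cup // ab // inE eqxx.
Qed.

(* Fourier-Motzkin elimination of the coefficient of one generator at a time. *)
Lemma weyl (s : seq 'rV[R]_n) :
  exists U : seq 'rV[R]_n, forall x, seq_cone s x <-> (forall u, u \in U -> dotp u x <= 0).
Proof.
elim: s => [|v s [U HU]].
  exists ([seq delta_mx 0 i | i <- enum 'I_n] ++ [seq - delta_mx 0 i | i <- enum 'I_n]).
  move=> x; split=> [-> u _|H]; first by rewrite dotp0r.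
  apply/rowP => i; rewrite mxE; apply/eqP; rewrite eq_le.
  have Hi u : u = delta_mx 0 i \/ u = - delta_mx 0 i -> dotp u x <= 0.
    case=> ->; apply: H; rewrite mem_cat; apply/orP; [left|right];
      by apply/mapP; exists i; rewrite ?mem_enum.
  have := Hi _ (or_introl erefl); rewrite dotp_delta => -> /=.
  by have := Hi _ (or_intror erefl); rewrite dotpNl dotp_delta oppr_le0.
(* For [p] positive and [q] negative on [v], this is the positive combination of [p] and [q] that is
   orthogonal to [v]. *)
pose comb (p q : 'rV[R]_n) := dotp p v *: q - dotp q v *: p.
exists ([seq u <- U | dotp u v <= 0] ++
        [seq comb p q | p <- [seq u <- U | 0 < dotp u v], q <- [seq u <- U | dotp u v < 0]]).
move=> x; split=> [[a a0 /HU H] u|H].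
  rewrite mem_cat => /orP[|/allpairsP[[p q] /= [+ + ->]]].
    rewrite mem_filter => /andP[uv uU]; have := H u uU.
    by rewrite dotpBr dotpZr subr_le0 => /le_trans; apply; rewrite mulr_ge0_le0.
  rewrite !mem_filter => /andP[pv pU] /andP[qv qU].
  have := H p pU; have := H q qU; rewrite !dotE.
  move: (dotp p v) pv (dotp q v) qv (dotp p x) (dotp q x) => P P0 Q Q0 X Y; nra.
(* These are the bounds on the coefficient [a] of [v]; the extra lower bound 0 makes it
   nonnegative. *)
have [|a [alo aup]] := @between_seqs
    (0 :: [seq dotp p x / dotp p v | p <- [seq u <- U | 0 < dotp u v]])
    [seq dotp q x / dotp q v | q <- [seq u <- U | dotp u v < 0]].
  move=> a b; rewrite inE => /orP[/eqP->|/mapP[p + ->]] /mapP[q + ->].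
    rewrite mem_filter => /andP[qv qU].
    rewrite -mulrNN -invrN mulr_ge0 //; last by rewrite invr_ge0; lra.
    by rewrite oppr_ge0 H // mem_cat mem_filter qU (ltW qv).
  rewrite !mem_filter => /andP[pv pU] /andP[qv qU].
  rewrite ler_pdivrMr // mulrAC ler_ndivlMr //.
  have : dotp (comb p q) x <= 0.
    apply: H; rewrite mem_cat; apply/orP; right.
    by apply: allpairs_f; rewrite mem_filter ?pv ?qv.
  by rewrite /comb !dotE; lra.
exists a; first by rewrite alo // inE eqxx.
apply/HU => u uU; rewrite dotpBr dotpZr subr_le0.
case: (ltgtP 0 (dotp u v)) => uv.
- rewrite -ler_pdivrMr // alo // inE; apply/orP; right.
  by apply/mapP; exists u => //; rewrite mem_filter uv.
- rewrite -ler_ndivlMr // aup //.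
  by apply/mapP; exists u => //; rewrite mem_filter uv.
- by rewrite -uv mulr0 H // mem_cat mem_filter uU -uv lexx.
Qed.

End Weyl.

(** * Linear combinations, cones and Farkas' lemma *)

Lemma eps_exists (R : realType) (I : finType) (A : pred I) (a b : I -> R) :
  (forall i, A i -> 0 < a i) ->
  exists2 e : R, 0 < e & forall t, 0 < t <= e -> forall i, A i -> t * b i < a i.
Proof.
move=> a0.
suff [e e0 He] : exists2 e : R, 0 < e &
    forall t, 0 < t <= e -> forall i, i \in enum I -> A i -> t * b i < a i.
  by exists e => // t te i; apply: He => //; rewrite mem_enum.
elim: (enum I) => [|i s [e e0 He]]; first by exists 1; rewrite ?ltr01.
exists (Num.min e (if A i then a i / (`|b i| + 1) else 1)).
  rewrite lt_min e0 /=; case: ifP => [/a0 ai|_]; last exact: ltr01.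
  by rewrite divr_gt0 // ltr_wpDl.
move=> t; rewrite le_min => /and3P[t0 te ti] j; rewrite inE => /orP[/eqP->|js] Aj; last first.
  by apply: He; rewrite ?t0.
move: ti; rewrite Aj ler_pdivlMr ?ltr_wpDl // => ti.
by apply: lt_le_trans ti; rewrite mulrDr mulr1; have := ler_norm (b i); nra.
Qed.

Section Lin.
Context {R : realType} {n : nat} {I : finType}.
Implicit Types (u : I -> 'rV[R]_n) (b c : I -> R) (S : {set I}) (d w x : 'rV[R]_n).

Definition lin u c : 'rV[R]_n := \sum_i c i *: u i.

(** Coefficient vectors live on all of [I] and vanish off the index set, so that combinations over
    different sets can be added. *)
Definition supported S c := forall i, i \notin S -> c i = 0.

Definition kron (j : I) (i : I) : R := (i == j)%:R.

Lemma eq_lin u c b : c =1 b -> lin u c = lin u b.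
Proof. by move=> cd; apply: eq_bigr => i _; rewrite cd. Qed.

Lemma lin_dot u c x : dotp (lin u c) x = \sum_i c i * dotp (u i) x.
Proof. by rewrite dotp_suml; apply: eq_bigr => i _; rewrite dotpZl. Qed.

Lemma linD u c b : lin u (fun i => c i + b i) = lin u c + lin u b.
Proof. by rewrite -big_split; apply: eq_bigr => i _; rewrite scalerDl. Qed.

Lemma linZ u a c : lin u (fun i => a * c i) = a *: lin u c.
Proof. by rewrite scaler_sumr; apply: eq_bigr => i _; rewrite scalerA. Qed.

Lemma linN u c : lin u (fun i => - c i) = - lin u c.
Proof. by rewrite -sumrN; apply: eq_bigr => i _; rewrite scaleNr. Qed.

Lemma linB u c b : lin u (fun i => c i - b i) = lin u c - lin u b.
Proof. by rewrite linD linN. Qed.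

Lemma lin0 u : lin u (fun=> 0) = 0.
Proof. by apply: big1 => i _; rewrite scale0r. Qed.

Lemma lin_kron u j : lin u (kron j) = u j.
Proof.
rewrite /lin (bigD1 j) //= /kron eqxx scale1r big1 ?addr0 // => i ij.
by rewrite (negbTE ij) scale0r.
Qed.

Lemma kronE j : kron j j = 1. Proof. by rewrite /kron eqxx. Qed.
Lemma kronN i j : i != j -> kron j i = 0. Proof. by rewrite /kron => /negbTE->. Qed.
Lemma kron_ge0 i j : 0 <= kron j i. Proof. by rewrite /kron ler0n. Qed.

Definition cone S u w := exists c, [/\ forall i, 0 <= c i, supported S c & w = lin u c].

Definition indep S u := forall c, supported S c -> lin u c = 0 -> forall i, c i = 0.

Lemma cone_mem S u j : j \in S -> cone S u (u j).
Proof.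
move=> jS; exists (kron j); split; rewrite ?lin_kron // => i iS.
by apply: kronN; apply: contraNneq iS => ->.
Qed.

Lemma seq_coneP u (s : seq I) w : uniq s ->
  seq_cone [seq u i | i <- s] w <-> cone [set i in s] u w.
Proof.
elim: s w => [|j s IH] w /=.
  move=> _; split=> [->|[c [c0 cS ->]]].
    by exists (fun=> 0); split=> //; rewrite lin0.
  by rewrite -(lin0 u); apply: eq_lin => i; rewrite cS // !inE.
move=> /andP[js us]; split.
  move=> [a a0 /(IH _ us)[c [c0 cS wE]]]; exists (fun i => a * kron j i + c i); split.
  - by move=> i; rewrite addr_ge0 // mulr_ge0 // kron_ge0.
  - move=> i; rewrite !inE negb_or => /andP[ij iss].
    by rewrite kronN // mulr0 cS ?addr0 // inE.
  - by rewrite linD linZ lin_kron -wE addrC subrK.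
move=> [c [c0 cS ->]]; exists (c j) => //; apply/(IH _ us).
exists (fun i => c i - c j * kron j i); split.
- move=> i; have [->|ij] := eqVneq i j; first by rewrite kronE mulr1 subrr.
  by rewrite kronN // mulr0 subr0.
- move=> i; rewrite inE => iss; have [->|ij] := eqVneq i j; first by rewrite kronE mulr1 subrr.
  by rewrite kronN // mulr0 subr0 cS // !inE negb_or ij.
- by rewrite linB linZ lin_kron.
Qed.

(** By [weyl] the cone is cut out by finitely many half-spaces, whose normals are admissible test
    vectors [d] because the generators lie in the cone. *)
Lemma cone_dual S u w :
  cone S u w <-> forall d, (forall i, i \in S -> dotp (u i) d <= 0) -> dotp w d <= 0.
Proof.
split=> [[c [c0 cS ->]] d Hd|H].
  rewrite lin_dot; apply: sumr_le0 => i _; have [iS|/cS->] := boolP (i \in S).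
    by rewrite mulr_ge0_le0 // Hd.
  by rewrite mul0r.
have SE : [set i in enum S] = S by apply/setP => i; rewrite inE mem_enum.
have E x : seq_cone [seq u i | i <- enum S] x <-> cone S u x.
  by rewrite -{2}SE; apply: seq_coneP; apply: enum_uniq.
have [U HU] := weyl [seq u i | i <- enum S].
apply/E/HU => d dU; rewrite dotpC; apply: H => i iS; rewrite dotpC.
by have /E/HU := cone_mem u iS; exact.
Qed.

Lemma farkas S u w : ~ cone S u w ->
  exists2 d, forall i, i \in S -> dotp (u i) d <= 0 & 0 < dotp w d.
Proof.
move=> /cone_dual/existsNP[d /not_implyP[Hd /negP]]; rewrite -ltNge => wd.
by exists d.
Qed.

Lemma cone_comb S u c : (forall i, 0 <= c i) ->
  (forall i, 0 < c i -> cone S u (u i)) -> cone S u (lin u c).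
Proof.
move=> c0 H; apply/cone_dual => d Hd; rewrite lin_dot; apply: sumr_le0 => i _.
have := c0 i; rewrite le_eqVlt => /orP[/eqP<-|ci]; first by rewrite mul0r.
by rewrite mulr_ge0_le0 //; move/cone_dual: (H i ci); apply.
Qed.

End Lin.

(* One generator of the strict part at a time: a strict solution is the sum of
   the solutions obtained by making a single inequality strict. *)
Lemma motzkin (R : realType) (m : nat) (K : finType) (W : K -> 'rV[R]_m) (A B : {set K}) :
  (forall k, k \in B -> k \notin A) ->
  (exists X, (forall k, k \in A -> dotp (W k) X < 0) /\
             (forall k, k \in B -> dotp (W k) X = 0)) \/
  (exists c, [/\ lin W c = 0, supported (A :|: B) c, forall k, k \in A -> 0 <= c k
     & exists2 k, k \in A & 0 < c k]).
Proof.
move=> BA; have [[c Hc]|NC] := pselect (exists c, [/\ lin W c = 0, supported (A :|: B) c,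
  forall k, k \in A -> 0 <= c k & exists2 k, k \in A & 0 < c k]).
  by right; exists c.
(* Equations are doubled into opposite inequalities: the flag [true] negates a generator and is
   allowed on [B] only. *)
left; pose W' (p : K * bool) := (if p.2 then -1 else 1) *: W p.1.
pose S : {set K * bool} := [set p | ((p.1 \in A) && ~~ p.2) || (p.1 \in B)].
have H k0 : k0 \in A -> exists X, [/\ dotp (W k0) X < 0,
    forall k, k \in A -> dotp (W k) X <= 0 & forall k, k \in B -> dotp (W k) X = 0].
  move=> k0A; have [[c [c0 cS cE]]|/farkas[d dS dk]] := pselect (cone S W' (- W k0)).
    case: NC; exists (fun k => kron k0 k + (c (k, false) - c (k, true))); split.
    - rewrite linD lin_kron; apply/eqP; rewrite addr_eq0 -[W k0]opprK cE eqr_opp; apply/eqP.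
      rewrite /lin (eq_bigr (fun p => c (p.1, p.2) *: W' (p.1, p.2))); last by case.
      rewrite -(pair_bigA _ (fun k b => c (k, b) *: W' (k, b))); apply: eq_bigr => k _.
      by rewrite big_bool /W' /= scaleN1r scale1r scalerN scalerBl addrC.
    - move=> k; rewrite inE negb_or => /andP[kA kB].
      rewrite kronN ?cS ?inE /= ?(negbTE kA) ?(negbTE kB) ?subrr ?addr0 //.
      by apply: contraNneq kA => ->.
    - move=> k kA; rewrite (cS (k, true)) ?subr0 ?addr_ge0 ?kron_ge0 //.
      by rewrite inE /= andbF; apply: contraTN kA => /BA.
    - exists k0 => //; rewrite kronE (cS (k0, true)) ?subr0 ?ltr_wpDr //.
      by rewrite inE /= andbF; apply: contraTN k0A => /BA.
  exists d; split; first by move: dk; rewrite dotpNl oppr_gt0.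
    by move=> k kA; have := dS (k, false); rewrite inE kA /W' /= scale1r => ->.
  move=> k kB; apply/eqP; rewrite eq_le.
  have := dS (k, false); rewrite inE kB orbT /W' /= scale1r => -> //=.
  by have := dS (k, true); rewrite inE kB orbT /W' /= scaleN1r dotpNl oppr_le0 => ->.
pose X k := if pselect (k \in A) is left kA then projT1 (cid (H k kA)) else 0.
have HX k : k \in A -> [/\ dotp (W k) (X k) < 0,
    forall j, j \in A -> dotp (W j) (X k) <= 0 & forall j, j \in B -> dotp (W j) (X k) = 0].
  by rewrite /X; case: pselect => // kA _; case: cid.
exists (\sum_(k in A) X k); split=> k kA; rewrite dotp_sumr.
  rewrite (bigD1 k) //=; have [Xk _ _] := HX k kA.
  rewrite ltr_wnDr //; apply: sumr_le0 => j /andP[jA _].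
  by have [_ + _] := HX j jA; exact.
by rewrite big1 // => j jA; have [_ _] := HX j jA; exact.
Qed.

(** Homogenization: with the right-hand side as an additional coordinate, the system is infeasible
    exactly when (0, -1) lies in the cone of the vectors (u_i, h_i). A separating vector has a
    negative last coordinate; dividing by its opposite yields a solution. *)
Lemma affine_farkas (R : realType) (n : nat) (I : finType) (A : {set I})
    (u : I -> 'rV[R]_n) (h : I -> R) :
  (exists x, forall i, i \in A -> dotp (u i) x <= h i) \/
  (exists c, [/\ forall i, 0 <= c i, supported A c, lin u c = 0 & \sum_i c i * h i < 0]).
Proof.
pose W i : 'rV[R]_(n + 1) := row_mx (u i) (\row_(_ < 1) h i).
have scE (a b : R) : dotp (\row_(_ < 1) a) (\row_(_ < 1) b) = a * b.
  by rewrite /dotp big_ord1 !mxE.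
have [[c [c0 cA cE]]|/farkas[d dA]] :=
    pselect (cone A W (row_mx 0 (\row_(_ < 1) (-1)))).
  right; exists c; have linE : lin W c = row_mx (lin u c) (\row_(_ < 1) (\sum_i c i * h i)).
    apply/rowP => k; rewrite summxE; case: (split_ordP k) => j ->.
      by rewrite row_mxEl summxE; apply: eq_bigr => i _; rewrite mxE row_mxEl mxE.
    by rewrite row_mxEr mxE; apply: eq_bigr => i _; rewrite mxE row_mxEr mxE.
  move: cE; rewrite linE => /eq_row_mx[uE hE]; split=> //.
  by have /rowP/(_ ord0) := hE; rewrite !mxE => <-; rewrite oppr_lt0 ltr01.
rewrite -[d]hsubmxK.
have -> : rsubmx d = \row_(_ < 1) (rsubmx d 0 0).
  by apply/rowP => j; rewrite !mxE !ord1.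
rewrite dotp_row_mx scE dotp0l add0r mulN1r oppr_gt0 => d0; left.
set t := rsubmx d 0 0 in d0 *; exists ((- t)^-1 *: lsubmx d) => i iA.
have := dA i iA; rewrite -{1}[d]hsubmxK.
have -> : rsubmx d = \row_(_ < 1) t by apply/rowP => j; rewrite mxE ord1.
rewrite dotp_row_mx scE dotpZr [_^-1 * _]mulrC ler_pdivrMr ?oppr_gt0 //; lra.
Qed.

(** * Faces of a generating polyhedron *)

Lemma big_option (V : nmodType) (I : finType) (F : option I -> V) :
  \sum_o F o = F None + \sum_i F (Some i).
Proof.
rewrite (bigD1 None) //=; congr (_ + _).
rewrite (reindex_omap Some id) /=; last by case.
by apply: eq_bigl => i; rewrite eqxx.
Qed.

Section System.
Context {R : realType} {n : nat} {I : finType}.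
Implicit Types (u : I -> 'rV[R]_n) (h c psi : I -> R) (J S K : {set I}).

Definition poly J u h : set 'rV[R]_n :=
  [set x | forall i, i \in J -> dotp (u i) x <= h i]%classic.

(** All of [S] and nothing else is tight at some point, which is then a relative interior point of
    the geometric face. The empty [S] stands for the whole polyhedron and asks for a point with
    strict inequalities. *)
Definition face J u h S := S \subset J /\
  exists x, (forall i, i \in S -> dotp (u i) x = h i) /\
            (forall i, i \in J -> i \notin S -> dotp (u i) x < h i).

(** A full-dimensional polyhedron with exactly one inequality per facet. *)
Definition irredundant J u h := face J u h set0 /\ forall i, i \in J -> face J u h [set i].

Definition tight_set J u h x : {set I} := [set i in J | dotp (u i) x == h i].

Lemma face_tight_set J u h x : poly J u h x -> face J u h (tight_set J u h x).
Proof.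
move=> Px; split; first by apply/subsetP => i; rewrite inE => /andP[].
exists x; split=> i; first by rewrite inE => /andP[_ /eqP].
by move=> iJ; rewrite inE iJ /= => ne; rewrite lt_neqAle ne Px.
Qed.

Lemma face_point J u h S : face J u h S -> exists x, [/\ poly J u h x,
  forall i, i \in S -> dotp (u i) x = h i &
  forall i, i \in J -> i \notin S -> dotp (u i) x < h i].
Proof.
move=> [SJ [x [xS xN]]]; exists x; split=> // i iJ.
by have [/xS->|/(xN i iJ)/ltW] := boolP (i \in S).
Qed.

(** The constraint that [w] reaches its supremum is added to the system as [None]. A certificate of
    infeasibility using it would bound [w] strictly below the supremum; one not using it would
    contradict nonemptiness. *)
Lemma poly_attain J u h w : poly J u h !=set0%classic ->
  (exists M, forall x, poly J u h x -> dotp w x <= M) ->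
  exists2 x, poly J u h x & forall y, poly J u h y -> dotp w y <= dotp w x.
Proof.
move=> [x0 Px0] [M HM].
pose E := [set dotp w x | x in poly J u h]%classic.
have E0 : E !=set0%classic by exists (dotp w x0); exists x0.
have HE : has_sup E by split=> //; exists M => _ [x Px <-]; exact: HM.
pose u' o := if o is Some i then u i else - w.
pose h' o := if o is Some i then h i else - sup E.
pose J' : {set option I} := [set o | if o is Some i then i \in J else true].
have [[x Hx]|[c [c0 cJ /eqP]]] := affine_farkas J' u' h'.
  exists x; first by move=> i iJ; apply: (Hx (Some i)); rewrite inE.
  move=> y Py; have := Hx None; rewrite inE dotpNl lerN2 => /(_ isT).
  by apply: le_trans; apply: sup_upper_bound => //; exists y.
rewrite /lin big_option scalerN addrC subr_eq0 => /eqP uE.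
rewrite big_option mulrN addrC subr_lt0 => hE.
have le x : poly J u h x -> c None * dotp w x <= \sum_i c (Some i) * h i.
  move=> Px; rewrite -dotpZl -uE -[\sum__ _]/(lin u (c \o Some)) lin_dot.
  apply: ler_sum => i _ /=; have [iJ|iJ] := boolP (i \in J); first by rewrite ler_wpM2l ?Px.
  by rewrite cJ ?mul0r // inE.
have := c0 None; rewrite le_eqVlt => /orP[/eqP c00|cp].
  by have := le _ Px0; rewrite -c00 mul0r leNgt; move: hE; rewrite -c00 mul0r => ->.
have : sup E <= (\sum_i c (Some i) * h i) / c None.
  by apply: ge_sup => // _ [x Px <-]; rewrite ler_pdivlMr // mulrC le.
by rewrite ler_pdivlMr // mulrC leNgt hE.
Qed.

Lemma poly_move J u h x d :
  poly J u h x -> (forall i, i \in J -> dotp (u i) x = h i -> dotp (u i) d <= 0) ->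
  exists2 e : R, 0 < e & forall t, 0 < t <= e -> poly J u h (x + t *: d) /\
     (forall i, i \in J -> dotp (u i) x < h i -> dotp (u i) (x + t *: d) < h i).
Proof.
move=> Px Hd.
have [i|e e0 He] := @eps_exists R I [pred i | (i \in J) && (dotp (u i) x < h i)]
    (fun i => h i - dotp (u i) x) (fun i => dotp (u i) d).
  by move=> /andP[_]; rewrite subr_gt0.
exists e => // t te.
have H i : i \in J -> dotp (u i) x < h i -> dotp (u i) (x + t *: d) < h i.
  by move=> iJ ix; have := He t te i; rewrite !dotE inE iJ ix => /(_ isT); lra.
split=> // i iJ; have := Px i iJ; rewrite le_eqVlt => /orP[/eqP ix|/(H i iJ)/ltW //].
by rewrite !dotE ix; have := Hd i iJ ix; case/andP: te => t0 _; nra.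
Qed.

(** A direction raising no tight constraint can be followed for a while inside the polyhedron, so
    [w] does not increase along it; this is membership in the cone by duality. *)
Lemma lp_dual J u h w x : poly J u h x ->
  (forall y, poly J u h y -> dotp w y <= dotp w x) -> cone (tight_set J u h x) u w.
Proof.
move=> Px xmax; apply/cone_dual => d Hd.
have [i iJ ix|e e0 /(_ e)[]] := @poly_move J u h x d Px.
- by apply: Hd; rewrite inE iJ ix eqxx.
- by rewrite e0 lexx.
move=> /xmax; rewrite !dotE; nra.
Qed.

Section Generating.
Variables (J : {set I}) (u : I -> 'rV[R]_n) (h : I -> R).
Hypothesis irr : irredundant J u h.
Hypothesis gen : generating_property (poly J u h).

Let P := poly J u h.

Lemma normal_neq0 i : i \in J -> u i != 0.
Proof.
move=> iJ; apply/eqP => ui0; have [_ [x [_ xN]]] := irr.1.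
have [_ [y [yi _]]] := irr.2 i iJ; have := xN i iJ.
by rewrite -yi ?inE // ui0 !dotp0l ltxx => /(_ isT).
Qed.

(* Every right-hand side, however wild, becomes after scaling the intersection
   of the translates of [P] by the opposite of [K = {x | u x <= h - eps psi}]:
   facets persist under small perturbations. *)
Lemma small_summand psi : (exists x, forall i, i \in J -> dotp (u i) x <= psi i) ->
  exists e B, 0 < e /\ minkowski_sum (poly J u (fun i => e * psi i)) B = P.
Proof.
move=> [x0 Hx0].
have /choice[p Hp] i : exists p, i \in J -> dotp (u i) p = h i /\
    forall j, j \in J -> j != i -> dotp (u j) p < h j.
  have [iJ|_] := boolP (i \in J); last by exists 0.
  have [_ [p [pi pj]]] := irr.2 i iJ; exists p => _; split; first by apply: pi; rewrite inE.
  by move=> j jJ ji; apply: pj; rewrite ?inE.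
(* The point [p i + e *: d i] is on the [i]-th facet of [K], so that the translate belonging to it
   bounds [u i] by [e * psi i] on the intersection. *)
have [d Hd] : exists d, forall i, i \in J -> dotp (u i) (d i) = - psi i.
  exists (fun i => - (psi i / dotp (u i) (u i)) *: u i) => i.
  by move=> /normal_neq0/dotp_gt0/lt0r_neq0 ui; rewrite dotpZr mulNr divfK.
have [[i j]|e e0 He] := @eps_exists R (I * I)%type
    [pred ij | [&& ij.1 \in J, ij.2 \in J & ij.2 != ij.1]]
    (fun ij => h ij.2 - dotp (u ij.2) (p ij.1)) (fun ij => dotp (u ij.2) (d ij.1) + psi ij.2).
  by move=> /and3P[/= iJ jJ ji]; rewrite subr_gt0; apply: (Hp i iJ).2.
have {}He i j : i \in J -> j \in J -> j != i ->
    e * (dotp (u j) (d i) + psi j) < h j - dotp (u j) (p i).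
  by move=> iJ jJ ji; apply: (He e _ (i, j)); rewrite ?e0 ?lexx //= iJ jJ.
pose K := poly J u (fun i => h i - e * psi i).
have Kp i : i \in J -> K (p i + e *: d i).
  move=> iJ j jJ; rewrite !dotE; have [->|ji] := eqVneq j i.
    by rewrite Hd // (Hp i iJ).1 mulrN.
  by have := He i j iJ jJ ji; lra.
have K0 : K !=set0%classic.
  have [J0|[i iJ]] := set_0Vmem J; last by exists (p i + e *: d i); exact: Kp.
  by exists 0 => i; rewrite J0 inE.
have IE : (\bigcap_(t in [set - k | k in K]) translate t P = poly J u (fun i => e * psi i))%classic.
  apply/seteqP; split=> x Hx.
    move=> i iJ; have [|a Pa xE] := Hx (- (p i + e *: d i)).
      by exists (p i + e *: d i) => //; exact: Kp.
    have := Pa i iJ; rewrite -xE !dotE (Hp i iJ).1 Hd //; lra.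
  move=> _ [k Kk <-]; exists (k + x); last by rewrite addKr.
  by move=> i iJ; have := Kk i iJ; have := Hx i iJ; rewrite dotpDr; lra.
have [|I0|[B BE]] := gen (T := [set - k | k in K]%classic).
- by case: K0 => k Kk; exists (- k); exists k.
- suff : (\bigcap_(t in [set - k | k in K]) translate t P)%classic (e *: x0) by rewrite I0.
  by rewrite IE => i iJ; rewrite dotpZr ler_wpM2l ?(ltW e0) ?Hx0.
- by exists e, B; split=> //; rewrite -IE.
Qed.

Definition primitive S := [/\ S \subset J, indep S u & forall j, j \in J -> cone S u (u j) -> j \in S].

(** With [psi] the indicator of the complement of [S], the small summand coincides near 0 with the
    polar of the cone of [S]. Split a maximizer of the sum [w] of the normals of [S] as [a + b]. The
    summand translated by [b] lies in [P], so a normal tight at [b] is in the cone of [S], hence in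
    [S]. Conversely [b] maximizes [w] as well, so [w] is a combination of normals tight at [b], and
    independence forces all of [S] to occur. *)
Lemma primitive_face S : primitive S -> face J u h S.
Proof.
move=> [SJ indS primS].
pose w := lin u (fun i => (i \in S)%:R).
have wE x : dotp w x = \sum_(i in S) dotp (u i) x.
  by rewrite lin_dot [RHS]big_mkcond; apply: eq_bigr => i _; case: ifP; rewrite ?mul1r ?mul0r.
have [x0 Px0] : P !=set0%classic by have [x [Px _ _]] := face_point irr.1; exists x.
have [|y Py ymax] := @poly_attain J u h w (ex_intro _ x0 Px0).
  exists (\sum_(i in S) h i) => x Px; rewrite wE; apply: ler_sum => i iS.
  by apply: Px; move/subsetP: SJ; apply.
have [|e [B [e0 BE]]] := @small_summand (fun i => (i \notin S)%:R).
  by exists 0 => i _; rewrite dotp0r.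
have : P y by []; rewrite -{1}BE => -[a Pa [b Bb yE]].
have P0 x : poly J u (fun i => e * (i \notin S)%:R) x -> P (x + b).
  by move=> Px; rewrite -BE; exists x => //; exists b.
have Pb : P b.
  rewrite -[b]add0r; apply: P0 => i _; rewrite dotp0r.
  by rewrite mulr_ge0 // ltW.
have bmax z : P z -> dotp w z <= dotp w b.
  move=> /ymax/le_trans; apply; rewrite -yE dotpDr gerDr wE.
  apply: sumr_le0 => i iS; have := Pa i (subsetP SJ i iS).
  by rewrite iS mulr0.
have tS : tight_set J u h b \subset S.
  apply/subsetP => j; rewrite inE => /andP[jJ /eqP jb]; apply: primS => //.
  apply/cone_dual => d Hd.
  have [i iJ|i iJ|e' e'0 /(_ e')[]] := @poly_move J u (fun i => e * (i \notin S)%:R) 0 d.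
  - by rewrite dotp0r mulr_ge0 // ltW.
  - rewrite dotp0r => /esym/eqP.
    rewrite mulf_eq0 gt_eqF //= pnatr_eq0 eqb0 negbK; exact: Hd.
  - by rewrite e'0 lexx.
  - rewrite add0r => /P0/(_ j jJ); rewrite dotpDr jb dotpZr => + _; nra.
have ST : tight_set J u h b = S.
  apply/eqP; rewrite eqEsubset tS; apply/subsetP => s sS.
  have [c [c0 cT wE']] := lp_dual Pb bmax.
  apply: contraT => /cT cs.
  suff : (s \in S)%:R - c s = 0 :> R by rewrite sS cs subr0 => /eqP; rewrite oner_eq0.
  apply: (indS (fun i => (i \in S)%:R - c i)); last by rewrite linB -wE' subrr.
  move=> i iS; rewrite (negbTE iS) cT ?subr0 //; apply: contra iS; exact: (subsetP tS).
by rewrite -ST; exact: face_tight_set.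
Qed.

(** Compare [x] with a point [y] of the facet [j]: the constraints of [S] hold at [y] and are tight
    at [x], so the combination [u j] is at least as large at [x] as at [y]. *)
Lemma cone_face S x j : face J u h S -> poly J u h x -> j \in J ->
  (forall i, i \in S -> dotp (u i) x = h i) -> cone S u (u j) -> dotp (u j) x = h j.
Proof.
move=> [SJ _] Px jJ xS [c [c0 cS jE]].
apply/eqP; rewrite eq_le Px //=.
have [_ [y [yj yN]]] := irr.2 j jJ.
rewrite -yj ?inE // jE !lin_dot; apply: ler_sum => i _.
have [iS|/cS->] := boolP (i \in S); last by rewrite !mul0r.
rewrite ler_wpM2l // xS //; have [->|ij] := eqVneq i j; first by rewrite yj ?inE.
by rewrite ltW // yN ?inE //; exact: (subsetP SJ).
Qed.

Lemma face_primitive S j : face J u h S -> j \in J -> cone S u (u j) -> j \in S.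
Proof.
move=> fS jJ jc; have [x [Px xS xN]] := face_point fS.
apply: contraT => /(xN j jJ); rewrite (cone_face fS Px jJ xS jc) ltxx //.
Qed.

Lemma normal_inj i j a : i \in J -> j \in J -> 0 <= a -> u i = a *: u j -> i = j.
Proof.
move=> iJ jJ a0 ij; apply/eqP; rewrite -in_set1.
apply: (face_primitive (irr.2 j jJ) iJ); exists (fun k => a * kron j k); split.
- by move=> k; rewrite mulr_ge0 // kron_ge0.
- by move=> k; rewrite inE => kj; rewrite kronN // mulr0.
- by rewrite linZ lin_kron.
Qed.

End Generating.
End System.

(** The ratio test of the simplex method: [c] is subtracted from [b] until the first coordinate,
    [j], vanishes. *)
Lemma ratio_min (R : realType) (I : finType) (b c : I -> R) :
  (forall i, 0 <= b i) -> (exists i, 0 < c i) ->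
  exists2 j, 0 < c j & forall i, 0 <= b i - b j / c j * c i.
Proof.
move=> b0 [i0 ci0]; exists [arg min_(i < i0 | 0 < c i) (b i / c i)]%O; case: arg_minP => // j cj jmin.
move=> i; rewrite subr_ge0; have [ci|ci] := ltP 0 (c i).
  by rewrite -ler_pdivlMr // jmin.
by apply: le_trans (b0 i); rewrite mulr_ge0_le0 // divr_ge0 // ltW.
Qed.

Section Cones.
Context {R : realType} {n : nat} {I : finType}.
Implicit Types (u : I -> 'rV[R]_n) (c : I -> R) (S K : {set I}).

Lemma cone_trans S K u w : (forall i, i \in S -> cone K u (u i)) -> cone S u w -> cone K u w.
Proof.
move=> SK [c [c0 cS ->]]; apply: cone_comb => // i ci; apply: SK.
by apply: contraT => /cS ci0; rewrite ci0 ltxx in ci.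
Qed.

Lemma cone_sub S K u w : S \subset K -> cone S u w -> cone K u w.
Proof. by move=> /subsetP SK; apply: cone_trans => i /SK; exact: cone_mem. Qed.

(** A dual basis is built one vector at a time: [motzkin] with the single strict inequality [s]
    yields either a vector orthogonal to all of [S] but [s], or a forbidden dependency. *)
Lemma indep_dual S u c : indep S u -> exists d, forall i, i \in S -> dotp (u i) d = c i.
Proof.
move=> indS.
have /choice[d Hd] s : exists d, s \in S -> forall i, i \in S -> dotp (u i) d = kron s i.
  have [sS|_] := boolP (s \in S); last by exists 0.
  have [|[X [Xs X0]]|[c' [cE cS _ [k]]]] := @motzkin R n I u [set s] (S :\ s).
  - by move=> k; rewrite !inE => /andP[].
  - have us : dotp (u s) X != 0 by rewrite lt_eqF // Xs ?inE.
    exists ((dotp (u s) X)^-1 *: X) => _ i iS; rewrite dotpZr.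
    have [->|si] := eqVneq i s; first by rewrite kronE mulVf.
    by rewrite (X0 i) ?inE ?si // mulr0 kronN.
  - rewrite (indS c') ?ltxx // => i iS; apply: cS; rewrite !inE negb_or negb_and iS orbT andbT.
    by apply: contraNneq iS => ->.
exists (\sum_(s in S) c s *: d s) => i iS; rewrite dotp_sumr (bigD1 i) //=.
rewrite dotpZr Hd // kronE mulr1 big1 ?addr0 // => s /andP[sS si].
by rewrite dotpZr Hd // kronN ?mulr0 // eq_sym.
Qed.

End Cones.

(** * Triangulation of cones of normals, and simplicity *)

Section Generating2.
Context {R : realType} {n : nat} {I : finType}.
Variables (J : {set I}) (u : I -> 'rV[R]_n) (h : I -> R).
Hypothesis irr : irredundant J u h.

(** Among the sets representing [w] with positive coefficients inside the cone of [K], take one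
    whose cone contains fewest normals, and then one with fewest elements. A dependency could be
    subtracted until a coefficient vanishes, as in Carathéodory's theorem; a further normal [u j] in
    the cone could be exchanged for some [u k], which would then leave the cone. *)
Lemma triangulate (K : {set I}) w : K \subset J -> cone K u w ->
  exists (S : {set I}) (c : I -> R), [/\ primitive J u S, supported S c, forall i, i \in S -> 0 < c i,
    w = lin u c & forall v, cone S u v -> cone K u v].
Proof.
move=> KJ [c0 [c00 c0K wE]].
pose Q (S : {set I}) := `[< S \subset J /\ exists c, [/\ supported S c, forall i, i \in S -> 0 < c i,
    w = lin u c & forall v, cone S u v -> cone K u v] >].
pose N (S : {set I}) := #|[set i in J | `[< cone S u (u i) >]]|.
have Q0 : Q [set i | 0 < c0 i].
  have S0K : [set i | 0 < c0 i] \subset K.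
    by apply/subsetP => i; rewrite inE => ci; apply: contraT => /c0K ci0; rewrite ci0 ltxx in ci.
  apply/asboolP; split; first exact: subset_trans KJ.
  exists c0; split=> // [i|i|v]; rewrite ?inE //; last exact: cone_sub.
  by rewrite -leNgt => ci; apply: le_anti; rewrite ci c00.
(* The weight is lexicographic, since [#|S|] is less than [#|I|.+1]. *)
case: (arg_minnP (fun S => N S * #|I|.+1 + #|S|)%N Q0) => S /asboolP[SJ [c [cS cpos {}wE SK]]] Smin.
have c_ge0 i : 0 <= c i by have [/cpos/ltW|/cS->] := boolP (i \in S).
have Nmono (S' : {set I}) : (forall i, i \in S' -> cone S u (u i)) -> (N S' <= N S)%N.
  move=> S'S; apply: subset_leq_card; apply/subsetP => i; rewrite !inE.
  by move=> /andP[-> /asboolP iS']; apply/asboolP; exact: cone_trans iS'.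
have QS c' : (forall i, 0 <= c' i) -> w = lin u c' ->
    (forall i, 0 < c' i -> i \in J /\ cone S u (u i)) -> Q [set i | 0 < c' i].
  move=> c'0 wE' c'S; apply/asboolP; split; first by apply/subsetP => i; rewrite inE => /c'S[].
  exists c'; split=> // [i|i|v]; rewrite ?inE //.
    by rewrite -leNgt => ci; apply: le_anti; rewrite ci c'0.
  by move=> vS'; apply: SK; apply: cone_trans vS' => i; rewrite inE => /c'S[].
have indS : indep S u.
  move=> b bS bE.
  have H b' : supported S b' -> lin u b' = 0 -> forall i, b' i <= 0.
    move=> b'S b'E i; rewrite leNgt; apply/negP => bi.
    have [k bk kmin] := ratio_min c_ge0 (ex_intro _ i bi).
    have kS : k \in S by apply: contraT => /b'S b'k; rewrite b'k ltxx in bk.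
    pose c' i := c i - c k / b' k * b' i.
    have c'S j : 0 < c' j -> j \in S.
      by move=> c'j; apply: contraT => jS; rewrite /c' (cS j) // (b'S j) // mulr0 subrr ltxx in c'j.
    have Q' : Q [set i | 0 < c' i].
      apply: QS => // [|j /c'S jS]; first by rewrite linB linZ b'E scaler0 subr0.
      by split; [exact: (subsetP SJ) | exact: cone_mem].
    have := Smin _ Q'; rewrite leqNgt => /negP; apply.
    rewrite -addnS; apply: leq_add.
      by rewrite leq_mul2r Nmono ?orbT // => j; rewrite inE => /c'S; exact: cone_mem.
    apply: proper_card; apply/properP; split; first by apply/subsetP => j; rewrite inE => /c'S.
    by exists k => //; rewrite inE /c' divfK ?gt_eqF // subrr ltxx.
  move=> i; apply: le_anti; rewrite H //= -oppr_le0 (H (fun i => - b i)) //.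
    by move=> j jS; rewrite bS ?oppr0.
  by rewrite linN bE oppr0.
exists S, c; split=> //; split=> // j jJ [m [m0 mS jE]].
apply: contraT => jS.
have [i mi] : exists i, 0 < m i.
  apply/not_existsP => H; have /eqP[] := normal_neq0 irr jJ.
  rewrite jE -(lin0 u); apply: eq_lin => i; apply: le_anti; rewrite m0 andbT leNgt.
  exact/negP.
have [k mk kmin] := ratio_min c_ge0 (ex_intro _ i mi).
have kS : k \in S by apply: contraT => /mS m'k; rewrite m'k ltxx in mk.
(* The pivot: [th] times the relation [u j = lin u m] is added, with [th] chosen to cancel the
   coefficient of [k]. *)
pose th := c k / m k; pose c' i := c i - th * m i + th * kron j i.
have th0 : 0 < th by rewrite divr_gt0 ?cpos.
have c'S a : 0 < c' a -> a = j \/ a \in S :\ k.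
  have [->|aj] := eqVneq a j; first by left.
  rewrite /c' kronN // mulr0 addr0 => c'a; right; rewrite !inE.
  apply/andP; split; apply: contraTT c'a; rewrite -leNgt.
    by rewrite negbK => /eqP->; rewrite /th divfK ?gt_eqF // subrr.
  by move=> aS; rewrite (cS a) // (mS a) // mulr0 subrr.
have c'cone a : 0 < c' a -> a \in J /\ cone S u (u a).
  move=> /c'S[->|]; first by split=> //; exists m.
  by rewrite !inE => /andP[_ aS]; split; [exact: (subsetP SJ)|exact: cone_mem].
have Q' : Q [set i | 0 < c' i].
  apply: QS => // [a|]; first by rewrite addr_ge0 ?kmin // mulr_ge0 ?kron_ge0 ?ltW.
  by rewrite linD linB !linZ lin_kron -jE subrK.
have := Smin _ Q'; rewrite leqNgt => /negP[]; apply: leq_trans (leq_addr _ _).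
pose S' := [set i | 0 < c' i]; rewrite -/S'; suff NN : (N S' < N S)%N.
  apply: leq_trans (leq_mul NN (leqnn _)); rewrite mulSn [X in (_ < X)%N]addnC.
  by rewrite ltn_add2l ltnS max_card.
apply: proper_card; apply/properP; split.
  apply/subsetP => a; rewrite !inE => /andP[-> /asboolP aS']; apply/asboolP.
  by apply: cone_trans aS' => b; rewrite inE => /c'cone[].
exists k; rewrite !inE (subsetP SJ k kS) /=; first by apply/asboolP; exact: cone_mem.
(* If [u k] were still in the cone, eliminating [u j] would give a dependency over [S]. Its
   coefficients vanish, and being sums of nonnegative terms away from [k] they make [u j] a multiple
   of [u k]. *)
apply/asboolP => -[g [g0 gS' kE]].
have jk : j != k by apply: contraNneq jS => ->.
have gk : g k = 0.
  apply: gS'; rewrite inE; apply/negP => /c'S[kj|]; last by rewrite !inE eqxx.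
  by rewrite kj eqxx in jk.
pose b i := g i - g j * kron j i + g j * m i - kron k i.
have b0 : forall i, b i = 0.
  apply: indS; last by rewrite linB linD linB !linZ !lin_kron -jE -kE subrK subrr.
  move=> a aS; rewrite /b (mS a) // mulr0 addr0 (@kronN _ _ a k) ?subr0; last by apply: contraNneq aS => ->.
  have [->|aj] := eqVneq a j; first by rewrite kronE mulr1 subrr.
  rewrite kronN // mulr0 subr0 gS' // inE; apply/negP => /c'S[/eqP|]; first by rewrite (negbTE aj).
  by rewrite inE (negbTE aS) andbF.
have gjm : g j * m k = 1.
  by have := b0 k; rewrite /b gk kronN 1?eq_sym // mulr0 subrr add0r kronE => /eqP; rewrite subr_eq0 => /eqP.
have gj : 0 < g j by rewrite lt_neqAle g0 andbT; apply: contra_eqN gjm => /eqP<-; rewrite mul0r eq_sym oner_eq0.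
suff : j = k by move/eqP; rewrite (negbTE jk).
apply: (normal_inj irr jJ (subsetP SJ k kS) (m0 k)).
rewrite jE -lin_kron -linZ; apply: eq_lin => a.
have [->|ak] := eqVneq a k; first by rewrite kronE mulr1.
rewrite kronN // mulr0; have := b0 a; rewrite /b (kronN ak) subr0.
have : 0 <= g a - g j * kron j a.
  have [->|aj] := eqVneq a j; first by rewrite kronE mulr1 subrr.
  by rewrite kronN // mulr0 subr0.
have := m0 a; nra.
Qed.

Hypothesis gen : generating_property (poly J u h).

(** Triangulate the cone of [S] at the sum of its normals. The primitive set [T] obtained is
    contained in [S] and is a face. The sum takes the same value at a point [y] of this face as at
    [x], being a combination of normals of [T]; an element of [S] outside [T] would make it strictly
    smaller at [y]. *)
Lemma face_indep (S : {set I}) : face J u h S -> indep S u.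
Proof.
move=> fS; have SJ := fS.1; have [x [Px xS xN]] := face_point fS.
pose d i : R := (i \in S)%:R.
have dS : cone S u (lin u d).
  exists d; split=> // i; rewrite /d ?ler0n // => /negbTE-> //.
have [T [c [primT cT cpos dE TS]]] := triangulate SJ dS.
have [_ indT _] := primT.
have sTS : T \subset S.
  apply/subsetP => t tT; apply: (face_primitive irr fS); last exact/TS/cone_mem.
  by case: primT => /subsetP + _ _; exact.
suff <- : T = S by [].
apply/eqP; rewrite eqEsubset sTS; apply/subsetP => s sS.
have [y [Py yT yN]] := face_point (primitive_face irr gen primT).
apply: contraT => sT; have := yN s (subsetP SJ s sS) sT.
have : dotp (lin u d) y = dotp (lin u d) x.
  rewrite dE !lin_dot; apply: eq_bigr => i _.
  have [iT|/cT->] := boolP (i \in T); last by rewrite !mul0r.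
  by rewrite yT // xS // (subsetP sTS).
rewrite !lin_dot (bigD1 s) // [RHS](bigD1 s) //= /d sS !mul1r xS // => H ys.
have : \sum_(i | i != s) (i \in S)%:R * dotp (u i) y <=
       \sum_(i | i != s) (i \in S)%:R * dotp (u i) x.
  apply: ler_sum => i _; have [iS|_] := boolP (i \in S); last by rewrite !mul0r.
  by rewrite xS // ler_wpM2l // Py // (subsetP SJ).
lra.
Qed.

(** Independence lets one tight constraint be relaxed while the others stay tight. All small depths
    [t] are provided so that several faces can be lowered by the same amount. *)
Lemma face_lower (S : {set I}) e : face J u h S -> e \in S ->
  exists2 t0 : R, 0 < t0 & forall t, 0 < t <= t0 -> exists y, [/\ poly J u h y,
    forall i, i \in S -> i != e -> dotp (u i) y = h i & dotp (u e) y = h e - t].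
Proof.
move=> fS eS; have [x [Px xS xN]] := face_point fS.
have [d Hd] := indep_dual (fun i => - kron e i) (face_indep fS).
have [i iJ xi|t0 t00 Ht] := @poly_move R n I J u h x d Px.
  have [/Hd->|iS] := boolP (i \in S); first by rewrite oppr_le0 kron_ge0.
  by have := xN i iJ iS; rewrite xi ltxx.
exists t0 => // t /Ht[Pt _]; exists (x + t *: d); split=> // [i iS ie|].
  by rewrite !dotE Hd // kronN // oppr0 mulr0 addr0 xS.
by rewrite !dotE Hd // kronE xS // mulrN1.
Qed.

Lemma face_sub (S S' : {set I}) : face J u h S -> S' \subset S -> face J u h S'.
Proof.
move=> fS S'S; have [x [Px xS xN]] := face_point fS.
have [d Hd] := indep_dual (fun i => - (i \notin S')%:R) (face_indep fS).
have [i iJ xi|t0 t00 /(_ t0)[]] := @poly_move R n I J u h x d Px.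
- have [/Hd->|iS] := boolP (i \in S); first by rewrite oppr_le0 ler0n.
  by have := xN i iJ iS; rewrite xi ltxx.
- by rewrite t00 lexx.
move=> Pt Ht; split; first exact: subset_trans fS.1.
exists (x + t0 *: d); split=> i iS'.
  by rewrite !dotE Hd ?(subsetP S'S) // iS' oppr0 mulr0 addr0 xS // (subsetP S'S).
move=> iN; have [iS|/(xN i iS')/(Ht i iS') //] := boolP (i \in S).
by rewrite !dotE xS // Hd // iN mulrN1 gtrBl.
Qed.

End Generating2.

(** * Facets *)

(* The facet with normal [u e] is represented by the cylinder over it, so that
   the ambient space does not change. *)
Section Facet.
Context {R : realType} {n : nat} {I : finType}.
Variables (J : {set I}) (u : I -> 'rV[R]_n) (h : I -> R) (e : I).

Definition link : {set I} := [set i in J | (i != e) && `[< face J u h [set e; i] >]].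

Definition proj (v : 'rV[R]_n) := v - (dotp v (u e) / dotp (u e) (u e)) *: u e.

Definition facet_normal i := proj (u i).

Definition facet_height i := h i - dotp (u i) (u e) / dotp (u e) (u e) * h e.

(** Orthogonal projection onto the hyperplane of the facet; the cylinder is the preimage of the
    facet. *)
Let pi (x : 'rV[R]_n) := proj x + (h e / dotp (u e) (u e)) *: u e.

Lemma projD v w : proj (v + w) = proj v + proj w.
Proof. by rewrite /proj dotpDl mulrDl scalerDl opprD addrACA. Qed.

Lemma projZ a v : proj (a *: v) = a *: proj v.
Proof. by rewrite /proj dotpZl -mulrA -scalerA scalerBr. Qed.

Lemma projN v : proj (- v) = - proj v.
Proof. by rewrite -scaleN1r projZ scaleN1r. Qed.

Lemma lin_proj c : lin facet_normal c = proj (lin u c).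
Proof.
rewrite /lin (big_morph proj projD (id1 := 0)); last first.
  by rewrite -[0 in LHS](scale0r 0) projZ scale0r.
by apply: eq_bigr => i _; rewrite projZ.
Qed.

Lemma proj0 v : proj v = 0 -> exists a, v = a *: u e.
Proof.
by move=> /eqP; rewrite subr_eq0 => /eqP vE; exists (dotp v (u e) / dotp (u e) (u e)).
Qed.

Hypothesis irr : irredundant J u h.
Hypothesis eJ : e \in J.

Let ee : dotp (u e) (u e) != 0.
Proof. by rewrite gt_eqF // dotp_gt0 // (normal_neq0 irr). Qed.

Lemma proj_id v : dotp (u e) v = 0 -> proj v = v.
Proof. by rewrite /proj dotpC => ->; rewrite mul0r scale0r subr0. Qed.

Lemma dotp_proj v : dotp (u e) (proj v) = 0.
Proof. by rewrite /proj !dotE (dotpC (u e) v) divfK // subrr. Qed.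

Lemma proj_e a : proj (a *: u e) = 0.
Proof. by rewrite projZ /proj divff // scale1r subrr scaler0. Qed.

Let pi_e x : dotp (u e) (pi x) = h e.
Proof. by rewrite /pi dotpDr dotp_proj add0r dotpZr divfK. Qed.

Let pi_id x : dotp (u e) x = h e -> pi x = x.
Proof. by move=> xe; rewrite /pi /proj dotpC xe subrK. Qed.

Let piD x v : pi (x + v) = pi x + proj v.
Proof. by rewrite /pi projD addrAC. Qed.

Let facet_dotp i x : dotp (facet_normal i) x - facet_height i = dotp (u i) (pi x) - h i.
Proof.
rewrite /facet_normal /facet_height /pi /proj !dotE (dotpC x).
by field.
Qed.

Let facet_le i x : (dotp (facet_normal i) x <= facet_height i) = (dotp (u i) (pi x) <= h i).
Proof. by rewrite -subr_le0 facet_dotp subr_le0. Qed.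

Let facet_lt i x : (dotp (facet_normal i) x < facet_height i) = (dotp (u i) (pi x) < h i).
Proof. by rewrite -subr_lt0 facet_dotp subr_lt0. Qed.

Let facet_eq i x : (dotp (facet_normal i) x == facet_height i) = (dotp (u i) (pi x) == h i).
Proof. by rewrite -subr_eq0 facet_dotp subr_eq0. Qed.

Hypothesis gen : generating_property (poly J u h).

Lemma in_link i : (i \in link) = (i \in J) && (i != e) && `[< face J u h [set e; i] >].
Proof. by rewrite inE andbA. Qed.

Lemma e_notin_link : e \notin link.
Proof. by rewrite in_link eqxx andbF. Qed.

Lemma link_sub : link \subset J.
Proof. by apply/subsetP => i; rewrite in_link => /andP[/andP[]]. Qed.

Lemma tight_link x i : poly J u h x -> dotp (u e) x = h e -> i \in J -> i != e ->
  dotp (u i) x = h i -> i \in link.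
Proof.
move=> Px xe iJ ie xi; rewrite in_link iJ ie; apply/asboolP.
apply: (face_sub irr gen (face_tight_set Px)); apply/subsetP => k.
by rewrite !inE => /orP[/eqP->|/eqP->]; rewrite ?eJ ?iJ ?xe ?xi eqxx.
Qed.

(* A constraint of [P] cutting the cylinder would be met, on the way from a
   relative interior point of the facet, before any constraint of the link. *)
Lemma facet_poly x : poly link facet_normal facet_height x <-> poly J u h (pi x).
Proof.
split=> [Hx|Px i iL]; last by rewrite facet_le Px // (subsetP link_sub).
have [_ [z [ze zN]]] := irr.2 e eJ; have {}ze : dotp (u e) z = h e by apply: ze; rewrite inE.
move=> i iJ; rewrite leNgt; apply/negP => iq.
pose c i := if i \in J then dotp (u i) (pi x - z) else 0.
pose b i := if (i \in J) && (i != e) then h i - dotp (u i) z else 1.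
have bpos k : k \in J -> k != e -> 0 < h k - dotp (u k) z.
  by move=> kJ ke; rewrite subr_gt0 zN // inE.
have ie : i != e by apply: contraTneq iq => ->; rewrite pi_e ltxx.
have [k||k ck kmin] := @ratio_min R I b c.
- by rewrite /b; case: ifP => // /andP[kJ ke]; rewrite ltW // bpos.
- by exists i; rewrite /c iJ dotpBr; have := bpos i iJ ie; lra.
have kJ : k \in J by move: ck; rewrite /c; case: ifP => //; rewrite ltxx.
have ke : k != e by apply: contraTneq ck => ->; rewrite /c eJ dotpBr pi_e ze subrr ltxx.
set t := b k / c k in kmin.
have t0 : 0 < t by rewrite divr_gt0 // /b kJ ke bpos.
pose q := z + t *: (pi x - z).
have qe : dotp (u e) q = h e by rewrite /q dotpDr dotpZr dotpBr pi_e ze subrr mulr0 addr0.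
have Pq : poly J u h q.
  move=> j jJ; have [->|je] := eqVneq j e; first by rewrite qe.
  by rewrite /q dotpDr dotpZr; have := kmin j; rewrite /b /c jJ je /=; lra.
have qk : dotp (u k) q = h k.
  have : t * c k = b k by rewrite divfK // gt_eqF.
  by rewrite /q dotpDr dotpZr /c /b kJ ke /= => ->; rewrite addrC subrK.
have kL := tight_link Pq qe kJ ke qk.
have t1 : t < 1.
  have := kmin i; rewrite /b /c iJ ie /= dotpBr => ti.
  have := bpos i iJ ie; nra.
have := Hx k kL; rewrite facet_le.
have := bpos k kJ ke; move: qk; rewrite /q dotpDr dotpZr dotpBr; nra.
Qed.

Lemma facet_face (S : {set I}) : S \subset link ->
  (face link facet_normal facet_height S <-> face J u h (e |: S)).
Proof.
move=> SL; split.
  move=> /face_point[x [/facet_poly Px xS xN]].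
  split; first by rewrite subUset sub1set eJ (subset_trans SL link_sub).
  exists (pi x); split=> i.
    by rewrite !inE => /orP[/eqP->|/xS/eqP]; [rewrite pi_e | rewrite facet_eq => /eqP].
  move=> iJ; rewrite !inE negb_or => /andP[ie iS].
  have [iL|iL] := boolP (i \in link); first by have := xN i iL iS; rewrite facet_lt.
  rewrite lt_neqAle Px // andbT; apply: contra iL => /eqP; exact: tight_link.
move=> [_ [x [xS xN]]]; have xe : dotp (u e) x = h e by apply: xS; rewrite !inE eqxx.
split=> //; exists x; split=> i.
  by move=> iS; apply/eqP; rewrite facet_eq pi_id // xS // !inE iS orbT.
move=> iL iS; rewrite facet_lt pi_id // xN ?(subsetP link_sub) // !inE negb_or iS andbT.
by apply: contraTneq iL => ->; rewrite e_notin_link.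
Qed.

Lemma facet_irredundant : irredundant link facet_normal facet_height.
Proof.
split; first by apply/facet_face; rewrite ?sub0set // setU0; exact: irr.2.
move=> i iL; apply/facet_face; first by rewrite sub1set.
by move: iL; rewrite in_link => /andP[_ /asboolP].
Qed.

(** Translations along [u e] do not move the cylinder, so those of [T] may be projected and applied
    to [P]. If [B] is the complementary summand of [P], a decomposition [i + b] of a point of the
    facet has [b] orthogonal to [u e]: [i] is at most at level [h e], and adding [b] to a point of
    the intersection at that level stays in [P]. *)
Lemma facet_generating : generating_property (poly link facet_normal facet_height).
Proof.
move=> T [t1 Tt1] /=; set I' := (\bigcap_(t in T) _)%classic.
have [[x0 Ix0]|] := pselect (I' !=set0)%classic; last first.
  by move=> H; left; apply/eqP/negbNE/negP => /set0P.
right; pose II := (\bigcap_(t in [set proj t | t in T]) translate t (poly J u h))%classic.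
have IE x : I' x <-> II (pi x).
  split=> H.
    move=> _ [t Tt <-]; have [y /facet_poly Py <-] := H t Tt.
    by exists (pi y) => //; rewrite addrC -piD addrC.
  move=> t Tt; have [|y Py yE] := H (proj t); first by exists t.
  exists (x - t); last by rewrite addrC subrK.
  by apply/facet_poly; rewrite piD projN -yE addrC addKr.
have IIle y : II y -> dotp (u e) y <= h e.
  move=> /(_ (proj t1))[|p Pp <-]; first by exists t1.
  by rewrite dotpDr dotp_proj add0r Pp.
have [|II0|[B BE]] := gen (T := [set proj t | t in T]%classic).
- by exists (proj t1), t1.
- by move/IE: Ix0; rewrite /II II0.
exists [set z | B (proj z)]%classic; apply/seteqP; split=> y.
  move=> [x /IE Ix [z Bz <-]]; apply/facet_poly; rewrite piD -BE.
  by exists (pi x) => //; exists (proj z).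
move=> /facet_poly; rewrite -BE => -[i Ii [b Bb ib]].
have ib' : dotp (u e) i + dotp (u e) b = h e by rewrite -dotpDr ib pi_e.
have : poly J u h (pi x0 + b) by rewrite -BE; exists (pi x0); [exact/IE | exists b].
move=> /(_ e eJ); rewrite dotpDr pi_e => x0b.
have {x0b ib'} be : dotp (u e) b = 0 by have := IIle i Ii; lra.
exists (y - b); last by exists b; rewrite ?subrK //= proj_id.
by apply/IE; rewrite piD projN proj_id // -ib addrK.
Qed.

End Facet.

(** * Bad circuits *)

Section Circuits.
Context {R : realType} {n : nat} {I : finType}.
Implicit Types (u : I -> 'rV[R]_n) (c b : I -> R) (S K J : {set I}).

Definition supp c : {set I} := [set i | c i != 0].

(** Minimality of the support, in the form of uniqueness up to a factor. The zero vector qualifies,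
    so nonzero coefficients are requested separately where they matter. *)
Definition circuit u c := lin u c = 0 /\ forall b, lin u b = 0 ->
  (forall i, c i = 0 -> b i = 0) -> exists t, forall i, b i = t * c i.

Definition two_pos c := exists i j, [/\ i != j, 0 < c i & 0 < c j].

Definition bad_circuit J u c :=
  [/\ supported J c, circuit u c, two_pos c & two_pos (fun i => - c i)].

Definition good J u := forall c, ~ bad_circuit J u c.

Lemma in_supp c i : (i \in supp c) = (c i != 0). Proof. by rewrite inE. Qed.

Lemma suppN c : supp (fun i => - c i) = supp c.
Proof. by apply/setP => i; rewrite !in_supp oppr_eq0. Qed.

Lemma circuitN u c : circuit u c -> circuit u (fun i => - c i).
Proof.
move=> [cE H]; split=> [|b bE bc]; first by rewrite linN cE oppr0.
have [i ci0|t Ht] := H b bE; first by apply: bc; rewrite ci0 oppr0.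
by exists (- t) => i; rewrite mulrNN.
Qed.

Lemma two_pos_eq b c : b =1 c -> two_pos b -> two_pos c.
Proof. by move=> bc [i [j]]; rewrite !bc => H; exists i, j. Qed.

Lemma bad_circuitN J u c : bad_circuit J u c -> bad_circuit J u (fun i => - c i).
Proof.
move=> [cJ cc pc nc]; split=> //; first by move=> i /cJ->; rewrite oppr0.
  exact: circuitN.
by apply: two_pos_eq pc => i; rewrite opprK.
Qed.

(** Expanding [u j] over an independent set gives a circuit in which [j] itself is the second
    negative index. *)
Lemma good_expand J u S j c i1 i2 i3 : good J u -> S \subset J -> indep S u -> j \in J ->
  supported S c -> u j = lin u c -> i1 != i2 -> 0 < c i1 -> 0 < c i2 -> c i3 < 0 -> False.
Proof.
move=> gd SJ indS jJ cS jE i12 c1 c2 c3.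
have jS : j \notin S.
  apply/negP => jS; have H : forall i, c i - kron j i = 0.
    apply: indS; last by rewrite linB lin_kron -jE subrr.
    by move=> i iS; rewrite cS // kronN ?subr0 //; apply: contraNneq iS => ->.
  by have := H i3; have := @kron_ge0 R I i3 j; lra.
have cj : c j = 0 by exact: cS.
have dlj i : 0 != c i -> kron j i = 0 :> R.
  by move=> ci; rewrite kronN //; apply: contraNneq ci => ->; rewrite cj.
apply: (gd (fun i => c i - kron j i)); split.
- move=> i iJ; rewrite cS ?kronN ?subr0 //; last by apply: contra iJ; exact: (subsetP SJ).
  by apply: contraNneq iJ => ->.
- split=> [|b bE bc]; first by rewrite linB lin_kron -jE subrr.
  exists (- b j) => i; apply/eqP; rewrite -subr_eq0 mulNr opprK; apply/eqP.
  move: i; apply: indS; last by rewrite linD linZ linB lin_kron bE -jE subrr scaler0 addr0.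
  move=> i iS; rewrite cS // sub0r; have [->|ij] := eqVneq i j; first by rewrite kronE mulrN1 subrr.
  by rewrite kronN // oppr0 mulr0 addr0 bc // cS // kronN // subr0.
- by exists i1, i2; split; rewrite // dlj ?subr0 // lt_eqF.
- exists i3, j; split; first by apply: contraTneq c3 => ->; rewrite cj ltxx.
    by rewrite dlj ?subr0 ?oppr_gt0 // gt_eqF.
  by rewrite kronE cj sub0r opprK.
Qed.

Lemma indep_replace u S f g z d : indep S u -> f \in S -> z != 0 -> supported (S :\ f) d ->
  u g = z *: u f + lin u d -> g \notin S :\ f /\ indep (g |: S :\ f) u.
Proof.
move=> indS fS z0 dS gE.
have dN i : i \notin S -> d i = 0 by move=> iS; rewrite dS // !inE negb_and iS orbT.
have df : d f = 0 by rewrite dS // !inE eqxx.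
have gS : g \notin S :\ f.
  apply/negP; rewrite !inE => /andP[gf gS].
  have H : forall i, z * kron f i + d i - kron g i = 0.
    apply: indS; last by rewrite linB linD linZ !lin_kron gE subrr.
    move=> i iS; have ii j : j \in S -> i != j by move=> jS; apply: contraNneq iS => ->.
    by rewrite !kronN ?ii // dN // mulr0 addr0 subrr.
  have fg : f != g by rewrite eq_sym.
  by have /eqP := H f; rewrite kronE df kronN // mulr1 addr0 subr0 (negbTE z0).
split=> // c cS cE; have H : forall i, c i - c g * kron g i + c g * (z * kron f i + d i) = 0.
  apply: indS; last by rewrite linD linB !linZ linD linZ !lin_kron -gE cE sub0r addNr.
  move=> i iS; have fi : i != f by apply: contraNneq iS => ->.
  have [ig|ig] := eqVneq i g.
    by rewrite -ig kronE kronN // dN // mulr0 addr0 mulr0 mulr1 subrr addr0.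
  by rewrite !kronN // dN // cS ?inE ?negb_or ?negb_and ?ig ?iS ?orbT // !mulr0 addr0 mulr0 subr0 addr0.
have cg : c g = 0.
  have [gf|gf] := eqVneq g f.
    have := H g; rewrite gf !kronE df mulr1 addr0 mulr1 subrr add0r => /eqP.
    by rewrite mulf_eq0 (negbTE z0) orbF => /eqP.
  have fg : f != g by rewrite eq_sym.
  have := H f; rewrite kronE df (kronN fg) cS; last by rewrite !inE eqxx /= orbF.
  by rewrite mulr0 subr0 add0r mulr1 addr0 => /eqP; rewrite mulf_eq0 (negbTE z0) orbF => /eqP.
by move=> i; have := H i; rewrite cg !mul0r subr0 addr0.
Qed.

End Circuits.

(** * Shrinking the cone of a bad circuit *)

Section Exchange.
Context {R : realType} {n : nat} {I : finType}.
Variables (J : {set I}) (u : I -> 'rV[R]_n) (h : I -> R).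
Hypothesis irr : irredundant J u h.
Implicit Types (c b z : I -> R).

Definition shrinks c c' := [/\ bad_circuit J u c', forall v, cone (supp c') u v -> cone (supp c) u v
  & exists2 k, k \in J & cone (supp c) u (u k) /\ ~ cone (supp c') u (u k)].

(** Add the relation [lin u z = u f] to [c], multiplied by the largest [t] that makes no negative
    coefficient positive. This cancels some [k], while [f] becomes negative and [q] stays so: the
    new circuit is bad. Its cone is smaller because it has lost [u k]. *)
Lemma exchange_core c f z : bad_circuit J u c -> f \in J -> f \notin supp c ->
  (forall i, 0 <= z i) -> supported (supp c) z -> u f = lin u z ->
  (exists2 i, c i < 0 & z i = 0) -> (exists2 i, c i < 0 & 0 < z i) ->
  exists c', shrinks c c'.
Proof.
move=> [cJ [cE cc] [p1 [p2 [p12 cp1 cp2]]] _] fJ fc z0 zc fE [q cq zq] [i ci zi].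
have [k||k zk kmin] := @ratio_min R I (fun i => if c i < 0 then - c i else 0)
    (fun i => if c i < 0 then z i else 0).
- by case: ifP => // /ltW; rewrite oppr_ge0.
- by exists i; rewrite ci.
have ck : c k < 0 by move: zk; case: ifP => //; rewrite ltxx.
rewrite ck in zk kmin; set t := - c k / z k in kmin.
have t0 : 0 < t by rewrite divr_gt0 // oppr_gt0.
have cf : c f = 0 by move: fc; rewrite in_supp negbK => /eqP.
have zf : z f = 0 by exact: zc.
have fN j : c j != 0 -> kron f j = 0 :> R.
  by move=> cj; rewrite kronN //; apply: contraNneq cj => ->; rewrite cf.
pose c' j := c j + t * z j - t * kron f j.
have c'k : c' k = 0.
  by rewrite /c' fN ?lt_eqF // mulr0 subr0 /t divfK ?gt_eqF // addrN.
have c'f : c' f = - t by rewrite /c' cf zf kronE mulr0 mulr1 !add0r.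
have c'pos j : 0 < c j -> 0 < c' j.
  move=> cj; rewrite /c' fN ?gt_eqF // mulr0 subr0.
  by rewrite ltr_wpDr // mulr_ge0 // ltW.
have c'E : lin u c' = 0 by rewrite linB linD !linZ lin_kron -fE cE add0r subrr.
have c'N j : j != f -> c j = 0 -> c' j = 0.
  by move=> jf cj; rewrite /c' cj zc ?in_supp ?cj ?eqxx // kronN // mulr0 addr0 subr0.
have kJ : k \in J by apply: contraT => /cJ ck0; rewrite ck0 ltxx in ck.
have kf : k != f by apply: contraTneq ck => ->; rewrite cf ltxx.
have qf : q != f by apply: contraTneq cq => ->; rewrite cf ltxx.
exists c'; split.
- split.
  + by move=> j jJ; rewrite c'N ?cJ //; apply: contraNneq jJ => ->.
  + split=> // b bE bc'.
    pose s := b f / c' f; pose b' j := b j - s * c' j.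
    have [||r Hr] := cc b'; first by rewrite linB linZ bE c'E scaler0 subr0.
      move=> j cj; rewrite /b'; have [->|jf] := eqVneq j f.
        by rewrite /s divfK ?subrr // c'f oppr_eq0 gt_eqF.
      by rewrite bc' ?c'N // mulr0 subr0.
    have : r * c k = 0 by rewrite -Hr /b' bc' // c'k mulr0 subr0.
    move=> /eqP; rewrite mulf_eq0 (lt_eqF ck) orbF => /eqP r0.
    by exists s => j; apply/eqP; rewrite -subr_eq0 -/(b' j) Hr r0 mul0r.
  + by exists p1, p2; split=> //; exact: c'pos.
  + exists f, q; split; rewrite ?c'f ?opprK // 1?eq_sym //.
    by rewrite /c' zq kronN // !mulr0 addr0 subr0 oppr_gt0.
- move=> v; apply: cone_trans => j; rewrite in_supp => c'j.
  have [->|jf] := eqVneq j f; first by exists z.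
  by apply: cone_mem; rewrite in_supp; apply: contraNneq c'j => /c'N->.
exists k => //; split; first by apply: cone_mem; rewrite in_supp lt_eqF.
(* Eliminating [u f] from this representation of [u k] gives a multiple [r] of [c]. It is
   nonnegative at [p1] and [q], where [c] has opposite signs, so [r] is zero and [u f] is a multiple
   of [u k]. *)
move=> [g [g0 gc' kE]].
have gN j : c' j = 0 -> g j = 0 by move=> c'j; rewrite gc' // in_supp c'j eqxx.
pose b j := g j - g f * kron f j + g f * z j - kron k j.
have [||r Hr] := cc b.
- by rewrite linB linD linB !linZ !lin_kron -fE -kE subrK subrr.
- move=> j cj; have jk : j != k by apply: contraTneq ck => <-; rewrite cj ltxx.
  rewrite /b (kronN jk) zc ?in_supp ?cj ?eqxx // mulr0 addr0 subr0.
  have [->|jf] := eqVneq j f; first by rewrite kronE mulr1 subrr.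
  by rewrite gN ?c'N // kronN // mulr0 subr0.
have bge j : j != k -> 0 <= b j.
  move=> jk; rewrite /b (kronN jk) subr0 addr_ge0 ?mulr_ge0 //.
  have [->|jf] := eqVneq j f; first by rewrite kronE mulr1 subrr.
  by rewrite kronN // mulr0 subr0.
have r0 : r = 0.
  have p1k : p1 != k by apply: contraTneq ck => <-; rewrite -leNgt ltW.
  have qk : q != k by apply: contraTneq zk => <-; rewrite zq ltxx.
  have := bge _ p1k; have := bge _ qk; rewrite !Hr => rq rp.
  by apply: le_anti; rewrite -(pmulr_lge0 _ cp1) rp andbT -(nmulr_lge0 _ cq).
have b0 j : b j = 0 by rewrite Hr r0 mul0r.
have gfz : g f * z k = 1.
  have := b0 k; rewrite /b (gN k) // kronN // kronE mulr0 subrr add0r => /eqP.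
  by rewrite subr_eq0 => /eqP.
have gf : 0 < g f.
  by rewrite lt_neqAle g0 andbT; apply: contra_eqN gfz => /eqP<-; rewrite mul0r eq_sym oner_eq0.
suff : f = k by move/eqP; rewrite eq_sym (negbTE kf).
apply: (normal_inj irr fJ kJ (z0 k)); rewrite fE -lin_kron -linZ; apply: eq_lin => j.
have [->|jk] := eqVneq j k; first by rewrite kronE mulr1.
rewrite (kronN jk) mulr0; have := b0 j; rewrite /b (kronN jk) subr0.
have : 0 <= g j - g f * kron f j.
  have [->|jf] := eqVneq j f; first by rewrite kronE mulr1 subrr.
  by rewrite kronN // mulr0 subr0.
have := z0 j; nra.
Qed.

(* Along the line [z + t c] of representations of [u f], the values of [z]
   outside the positive part of [c] can be lowered until one of them vanishes. *)
Lemma slide c z : (forall i, 0 <= z i) -> two_pos (fun i => - c i) ->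
  exists t, [/\ 0 <= t, forall i, c i < 0 -> 0 <= z i + t * c i
    & exists2 i, c i < 0 & z i + t * c i = 0].
Proof.
move=> z0 [i [_ [_ ci _]]].
have [k ck kmin] := @ratio_min R I z (fun i => - c i) z0 (ex_intro _ i ci).
exists (z k / - c k); split; first by rewrite divr_ge0 // ltW.
  by move=> j _; have := kmin j; rewrite mulrN opprK.
exists k; first by rewrite -oppr_gt0.
by rewrite invrN mulrN mulNr divfK ?subrr // -oppr_eq0 gt_eqF.
Qed.

(** Slide the representation of [u f] along [c] until it vanishes at a negative index. If it is
    still positive at another one, [exchange_core] applies; otherwise it lives on the positive part,
    and sliding along the opposite of [c] gives the same alternative there. If both fail, [u f] lies
    on the common ray of the two cones. *)
Lemma exchange c f : bad_circuit J u c -> f \in J -> f \notin supp c ->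
  cone (supp c) u (u f) -> (exists c', shrinks c c') \/
  exists2 t, 0 <= t & u f = t *: lin u (fun i => Num.max (c i) 0).
Proof.
move=> bc fJ fc [z [z0 zc fE]]; have [_ [cE _] pc nc] := bc.
have cN j : j \notin supp c -> c j = 0 by rewrite in_supp negbK => /eqP.
have [t [t0 zt [i ci zi]]] := slide z0 nc.
pose z1 j := z j + t * c j.
have z10 j : 0 <= z1 j.
  have [cj|cj] := ltP (c j) 0; first exact: zt.
  by rewrite addr_ge0 // mulr_ge0.
have z1c : supported (supp c) z1 by move=> j jc; rewrite /z1 zc // cN // mulr0 addr0.
have f1E : u f = lin u z1 by rewrite linD linZ cE scaler0 addr0.
have [[j cj zj]|H1] := pselect (exists2 j, c j < 0 & 0 < z1 j).
  by left; apply: (exchange_core bc fJ fc z10 z1c f1E); [exists i | exists j].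
have {H1} z1neg j : c j < 0 -> z1 j = 0.
  move=> cj; apply: le_anti; rewrite z10 andbT leNgt; apply/negP => zj.
  by apply: H1; exists j.
have [|s [s0 zs [k ck zk]]] := @slide (fun j => - c j) z1 z10.
  by apply: two_pos_eq pc => j; rewrite opprK.
pose z2 j := z1 j + s * - c j.
have z20 j : 0 <= z2 j.
  have [cj|cj] := ltP (- c j) 0; first exact: zs.
  by rewrite addr_ge0 // mulr_ge0.
have z2c : supported (supp (fun i => - c i)) z2.
  by move=> j; rewrite suppN => jc; rewrite /z2 z1c // cN // oppr0 mulr0 addr0.
have f2E : u f = lin u z2 by rewrite linD linZ linN cE oppr0 scaler0 addr0.
have [[j cj zj]|H2] := pselect (exists2 j, - c j < 0 & 0 < z2 j).
  have fc' : f \notin supp (fun i => - c i) by rewrite suppN.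
  left; have [||c' [bc' H1 H2]] := exchange_core (bad_circuitN bc) fJ fc' z20 z2c f2E.
  - by exists k.
  - by exists j.
  by rewrite suppN in H1 H2; exists c'.
right; exists s => //; rewrite f1E -linZ; apply: eq_lin => j.
have [cj|cj] := ltP 0 (c j); last first.
  rewrite mulr0; move: cj; rewrite le_eqVlt => /orP[/eqP cj|/z1neg//].
  by apply: z1c; rewrite in_supp cj eqxx.
have : z2 j = 0.
  apply: le_anti; rewrite z20 andbT leNgt; apply/negP => zj.
  by apply: H2; exists j; rewrite // oppr_lt0.
by rewrite /z2 mulrN => /eqP; rewrite subr_eq0 => /eqP.
Qed.

Lemma minimal_bad : ~ good J u -> exists2 c, bad_circuit J u c &
  forall f, f \in J -> cone (supp c) u (u f) ->
  f \in supp c \/ exists2 t, 0 <= t & u f = t *: lin u (fun i => Num.max (c i) 0).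
Proof.
move=> /existsNP[c0 /contrapT bc0].
pose N c := #|[set i in J | `[< cone (supp c) u (u i) >]]|.
have [|m /asboolP[c [bc Nc]] mmin] := @ex_minnP (fun m => `[< exists c, bad_circuit J u c /\ N c = m >]).
  by exists (N c0); apply/asboolP; exists c0.
exists c => // f fJ fcone; have [|fc] := boolP (f \in supp c); first by left.
have [[c' [bc' cc' [k kJ [kc kc']]]]|] := exchange bc fJ fc fcone; last by right.
have : (m <= N c')%N by apply: mmin; apply/asboolP; exists c'.
rewrite -Nc leqNgt => /negP[]; apply: proper_card; apply/properP; split.
  by apply/subsetP => i; rewrite !inE => /andP[-> /asboolP/cc' ?]; apply/asboolP.
by exists k; rewrite !inE kJ /=; apply/asboolP.
Qed.

End Exchange.

(** * The axis of a minimal bad circuit *)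

Section Star.
Context {R : realType} {n : nat} {I : finType}.
Variables (J : {set I}) (u : I -> 'rV[R]_n) (h : I -> R).
Hypothesis irr : irredundant J u h.
Hypothesis gen : generating_property (poly J u h).
Implicit Types (c : I -> R).

Definition pos c i := Num.max (c i) 0.
Definition opp c i := - c i.

Lemma pos_ge0 c i : 0 <= pos c i.
Proof. by rewrite /pos le_max lexx orbT. Qed.

Lemma pos_gt c i : 0 < c i -> pos c i = c i.
Proof. by move=> ci; rewrite /pos max_l // ltW. Qed.

Lemma pos_le c i : c i <= 0 -> pos c i = 0.
Proof. by move=> ci; rewrite /pos max_r. Qed.

Lemma pos_gt0 c i : 0 < pos c i -> 0 < c i.
Proof. by rewrite /pos lt_max ltxx orbF. Qed.

Lemma pos_opp c : lin u c = 0 -> lin u (pos (opp c)) = lin u (pos c).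
Proof.
move=> cE; apply/esym/eqP; rewrite -subr_eq0 -linB -cE; apply/eqP/eq_lin => i.
rewrite /pos /opp; case: (ltP (c i) 0); case: (ltP (- c i) 0); lra.
Qed.

(** The circuit is scaled so that its positive part, hence also its negative part, sums to [u e]. Of
    minimality only the list of normals in the cone is kept. *)
Definition star c e := [/\ bad_circuit J u c, e \in J, u e = lin u (pos c)
  & forall f, f \in J -> cone (supp c) u (u f) -> f \in supp c \/ f = e].

Lemma lin_lt d x : (forall i, 0 <= d i) -> (exists i, 0 < d i) ->
  (forall i, 0 < d i -> dotp (u i) x < h i) -> dotp (lin u d) x < \sum_i d i * h i.
Proof.
move=> d0 [k dk] Hd; rewrite lin_dot (bigD1 k) //= [ltRHS](bigD1 k) //=.
rewrite ltr_leD ?ltr_pM2l ?Hd //; apply: ler_sum => i _.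
have := d0 i; rewrite le_eqVlt => /orP[/eqP<-|di]; first by rewrite !mul0r.
by rewrite ler_pM2l // ltW // Hd.
Qed.

(** Every relation among the positive normals, or between them and one negative normal, is a
    multiple of [c]. It misses a negative index, because there are two of them, and is therefore
    zero. *)
Lemma pos_primitive c : bad_circuit J u c ->
  (forall f, f \in J -> cone (supp c) u (u f) -> f \in supp c) ->
  primitive J u [set i | 0 < c i].
Proof.
move=> [cJ [cE cc] [p1 [p2 [p12 cp1 cp2]]] [q1 [q2 [q12 cq1 cq2]]]] cmin.
rewrite !oppr_gt0 in cq1 cq2.
have sub i : c i = 0 -> i \notin [set i | 0 < c i] by rewrite inE => ->; rewrite ltxx.
have negN i : c i < 0 -> i \notin [set i | 0 < c i] by rewrite inE -leNgt => /ltW.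
split.
- by apply/subsetP => i; rewrite inE => ci; apply: contraT => /cJ ci0; rewrite ci0 ltxx in ci.
- move=> b bS bE; have [|t Ht] := cc b bE; first by move=> i /sub/bS.
  have := Ht q1; rewrite bS ?negN // => /esym/eqP; rewrite mulf_eq0 (lt_eqF cq1) orbF => /eqP t0.
  by move=> i; rewrite Ht t0 mul0r.
- move=> j jJ jc; have js : j \in supp c.
    apply: cmin => //; apply: cone_sub jc; apply/subsetP => i.
    by rewrite inE in_supp => /gt_eqF->.
  rewrite inE ltNge; apply/negP; rewrite le_eqVlt -(negbK (c j == 0)) -in_supp js /= => cj.
  have [g [g0 gS jE]] := jc.
  have [||t Ht] := cc (fun i => g i - kron j i); first by rewrite linB lin_kron jE subrr.
    move=> i ci; rewrite gS ?sub // kronN ?subr0 //.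
    by apply: contraTneq cj => <-; rewrite ci ltxx.
  have [q [qj cq]] : exists q, q != j /\ c q < 0.
    by have [qj|qj] := eqVneq q1 j; [exists q2; rewrite -qj eq_sym | exists q1].
  have := Ht q; rewrite gS ?negN // kronN // subrr => /esym/eqP.
  rewrite mulf_eq0 (lt_eqF cq) orbF => /eqP t0.
  have := Ht j; rewrite t0 mul0r gS ?negN // kronE sub0r => /eqP.
  by rewrite oppr_eq0 oner_eq0.
Qed.

(** If no normal spans the ray, both parts of [c] are primitive and hence are faces, met at [x] and
    [y]. The common sum of the two parts attains its bound from the positive heights at [x] and from
    the negative heights at [y]. Each of the two values would have to be strictly smaller than the
    other. *)
Lemma axis c : bad_circuit J u c ->
  (forall f, f \in J -> cone (supp c) u (u f) -> f \in supp c \/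
     exists2 t, 0 <= t & u f = t *: lin u (pos c)) ->
  exists e t, [/\ e \in J, 0 < t & u e = t *: lin u (pos c)].
Proof.
move=> bc cmin; have [[e [t H]]|NE] := pselect (exists e t,
  [/\ e \in J, 0 < t & u e = t *: lin u (pos c)]); first by exists e, t.
have {}cmin f : f \in J -> cone (supp c) u (u f) -> f \in supp c.
  move=> fJ /(cmin f fJ)[//|[t t0 fE]]; case: NE; exists f, t; split=> //.
  rewrite lt_neqAle t0 andbT; apply: contraNneq (normal_neq0 irr fJ) => /esym t0'.
  by rewrite fE t0' scale0r.
have [x [_ xS xN]] := face_point (primitive_face irr gen (pos_primitive bc cmin)).
have bc' : bad_circuit J u (opp c) := bad_circuitN bc.
have [|y [_ yS yN]] := face_point (primitive_face irr gen (pos_primitive bc' _)).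
  by rewrite suppN.
have [cJ [cE _] [p [_ [_ cp _]]] [q [_ [_ cq _]]]] := bc.
have cJ' i : c i != 0 -> i \in J by apply: contraR => /cJ->.
have val z d : (forall i, 0 < d i -> dotp (u i) z = h i) ->
    dotp (lin u (pos d)) z = \sum_i pos d i * h i.
  move=> dz; rewrite lin_dot; apply: eq_bigr => i _.
  by have [/dz->|/pos_le->] := ltP 0 (d i); rewrite ?mul0r.
have wx := val x c; have wy := val y (opp c).
have : dotp (lin u (pos (opp c))) x < \sum_i pos (opp c) i * h i.
  apply: lin_lt => [i||i /pos_gt0]; first exact: pos_ge0.
    by exists q; rewrite pos_gt.
  rewrite /opp oppr_gt0 => ci; apply: xN; first by rewrite cJ' // lt_eqF.
  by rewrite inE -leNgt ltW.
have : dotp (lin u (pos c)) y < \sum_i pos c i * h i.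
  apply: lin_lt => [i||i /pos_gt0 ci]; first exact: pos_ge0.
    by exists p; rewrite pos_gt.
  apply: yN; first by rewrite cJ' // gt_eqF.
  by rewrite inE -leNgt /opp oppr_le0 ltW.
rewrite -wx; last by move=> i ci; apply: xS; rewrite inE.
rewrite -wy; last by move=> i ci; apply: yS; rewrite inE.
by rewrite pos_opp // => /lt_trans H /H; rewrite ltxx.
Qed.

Lemma star_exists : ~ good J u -> exists c e, star c e.
Proof.
move=> /(minimal_bad irr)[c bc cmin]; have [e [t [eJ t0 eE]]] := axis bc cmin.
have [cJ [cE cc] pc nc] := bc.
exists (fun i => t * c i), e.
have sE : supp (fun i => t * c i) = supp c.
  by apply/setP => i; rewrite !in_supp mulf_eq0 (gt_eqF t0).
have bc' : bad_circuit J u (fun i => t * c i).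
  split.
  - by move=> i /cJ->; rewrite mulr0.
  - split=> [|b bE bc']; first by rewrite linZ cE scaler0.
    have [|s Hs] := cc b bE; first by move=> i ci; rewrite bc' // ci mulr0.
    by exists (s / t) => i; rewrite mulrA divfK ?gt_eqF.
  - by case: pc => i [j [ij ci cj]]; exists i, j; rewrite !pmulr_rgt0.
  - by case: nc => i [j [ij ci cj]]; exists i, j; rewrite -!mulrN !pmulr_rgt0.
split=> // [|f fJ]; first by rewrite eE -linZ; apply: eq_lin => i; rewrite /pos maxr_pMr ?mulr0 // ltW.
rewrite sE => /(cmin f fJ)[|[s s0 fE]]; first by left.
right; apply: (normal_inj irr fJ eJ (divr_ge0 s0 (ltW t0))).
by rewrite fE eE scalerA divfK // gt_eqF.
Qed.

Lemma star_opp c e : star c e -> star (opp c) e.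
Proof.
move=> [bc eJ eE H]; split=> //; first exact: bad_circuitN.
  by rewrite pos_opp //; case: bc => _ [].
by move=> f; rewrite suppN; exact: H.
Qed.

Lemma other_of (P : I -> Prop) i : (exists a b : I, [/\ a != b, P a & P b]) ->
  exists2 a, a != i & P a.
Proof.
move=> [a [b [ab Pa Pb]]]; have [ai|ai] := eqVneq a i; last by exists a.
by exists b => //; rewrite -ai eq_sym.
Qed.

(** Otherwise [u e = lin u (pos c)] is a relation over the support, hence a multiple of [c]; but it
    vanishes at a negative index and not at some positive one. *)
Lemma star_axis0 c e : star c e -> c e = 0.
Proof.
move=> [[cJ [cE cc] pc nc] eJ eE _].
have [p pe cp] := other_of e pc; have [q qe] := other_of e nc; rewrite oppr_gt0 => cq.
apply/eqP/negP => /negP ce.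
have [||t Ht] := cc (fun i => pos c i - kron e i); first by rewrite linB lin_kron eE subrr.
  by move=> i ci; rewrite pos_le ?ci // kronN ?subr0 //; apply: contraNneq ce => <-; rewrite ci.
have := Ht q; rewrite pos_le ?(ltW cq) // kronN // subr0 => /esym/eqP.
rewrite mulf_eq0 (lt_eqF cq) orbF => /eqP t0.
by have := Ht p; rewrite t0 mul0r pos_gt // kronN // subr0 => /eqP; rewrite gt_eqF.
Qed.

Lemma star_axis_cone c e : star c e -> cone (supp c) u (u e).
Proof.
move=> [_ _ eE _]; exists (pos c); split=> // [i|i]; first exact: pos_ge0.
by rewrite in_supp negbK => /eqP ci; rewrite pos_le // ci.
Qed.

(** The set is primitive: after elimination of [u e] a relation becomes a multiple of [c], whose
    factor is read off at the omitted indices. That [u a] and [u b] are not in the cone follows from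
    a second index of the same sign. *)
Lemma star_face c e a b : star c e -> 0 < c a -> c b < 0 ->
  face J u h (e |: (supp c :\ a :\ b)).
Proof.
move=> st ca cb; have ce := star_axis0 st; have ec := star_axis_cone st.
have [[cJ [cE cc] pc nc] eJ eE cmin] := st.
have ea : e != a by apply: contraTneq ca => <-; rewrite ce ltxx.
have be : b != e by apply: contraTneq cb => ->; rewrite ce ltxx.
have ab : a != b by apply: contraTneq ca => ->; rewrite -leNgt ltW.
set T := e |: _.
have cJ' i : c i != 0 -> i \in J by apply: contraR => /cJ->.
have aT : a \notin T by rewrite !inE eqxx /= andbF orbF eq_sym.
have bT : b \notin T by rewrite !inE eqxx /= orbF.
have outT i : c i = 0 -> i != e -> i \notin T by move=> ci ie; rewrite !inE (negbTE ie) ci eqxx !andbF.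
(* Replacing [u e] by its expression on the positive side of [c] turns a
   combination over [T] into one over [supp c]. *)
pose r (g : I -> R) i := g i - g e * kron e i + g e * pos c i.
have rE g : lin u (r g) = lin u g by rewrite linD linB !linZ lin_kron eE subrK.
have rS g i : supported T g -> c i = 0 -> r g i = 0.
  move=> gT ci; rewrite /r (@pos_le _ i) ?ci // mulr0 addr0.
  have [->|ie] := eqVneq i e; first by rewrite kronE mulr1 subrr.
  by rewrite kronN // mulr0 subr0 gT // outT.
have rN g i : i != e -> r g i = g i + g e * pos c i by move=> ie; rewrite /r kronN // mulr0 subr0.
have rb g : supported T g -> r g b = 0.
  by move=> gT; rewrite rN // gT // pos_le ?(ltW cb) // mulr0 addr0.
have ra g : supported T g -> r g a = g e * c a.
  by move=> gT; rewrite rN 1?eq_sym // gT // pos_gt // add0r.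
apply: (primitive_face irr gen); split.
- by apply/subsetP => i; rewrite !inE => /orP[/eqP->//|/and3P[_ _ /cJ']].
- move=> g gT gE; have [||t Ht] := cc (r g); first by rewrite rE.
    by move=> i; exact: rS.
  have t0 : t = 0.
    by have := Ht b; rewrite rb // => /esym/eqP; rewrite mulf_eq0 (lt_eqF cb) orbF => /eqP.
  have ge : g e = 0.
    by have := Ht a; rewrite t0 mul0r ra // => /eqP; rewrite mulf_eq0 (gt_eqF ca) orbF => /eqP.
  by move=> i; have := Ht i; rewrite t0 mul0r /r ge !mul0r subr0 addr0.
- move=> j jJ jc.
  have [js|->] : j \in supp c \/ j = e; last by rewrite !inE eqxx.
    apply: cmin => //; apply: cone_trans jc => i; rewrite !inE => /orP[/eqP->//|/and3P[_ _ ci]].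
    by apply: cone_mem; rewrite in_supp.
  have [g [g0 gT jE]] := jc.
  have [||t Ht] := cc (fun i => r g i - kron j i); first by rewrite linB lin_kron rE -jE subrr.
    move=> i ci; rewrite rS // kronN ?subr0 //.
    by move: js; rewrite in_supp; apply: contraNneq => <-; rewrite ci.
  rewrite !inE; move: js; rewrite in_supp => -> /=; rewrite andbT.
  apply/orP; right; apply/andP; split; apply/negP => /eqP jj.
    have [q qb] := other_of b nc; rewrite oppr_gt0 => cq.
    have qe : q != e by apply: contraTneq cq => ->; rewrite ce ltxx.
    have := Ht b; rewrite rb // jj kronE sub0r => tb.
    have := Ht q; rewrite rN // pos_le ?(ltW cq) // jj kronN // mulr0 addr0 subr0 => tq.
    have := g0 q; rewrite tq; nra.
  have t0 : t = 0.
    have := Ht b; rewrite rb // jj kronN 1?eq_sym // subrr => /esym/eqP.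
    by rewrite mulf_eq0 (lt_eqF cb) orbF => /eqP.
  have [p pa cp] := other_of a pc.
  have pe : p != e by apply: contraTneq cp => ->; rewrite ce ltxx.
  have := Ht a; rewrite ra // jj t0 mul0r kronE => gea.
  have := Ht p; rewrite rN // pos_gt // jj kronN // t0 mul0r subr0 => gp.
  have := g0 p; have := g0 e; nra.
Qed.

(** In the facet of a third positive normal [a3], the circuit without [a3] is again a circuit, with
    [a1] and [a2] positive and the negative part unchanged, so it is bad. The faces of [star_face]
    show that its normals belong to the link. *)
Lemma star_two_pos c e a1 a2 a3 : star c e ->
  (forall k, k \in J -> good (link J u h k) (facet_normal u k)) ->
  a1 != a2 -> 0 < c a1 -> 0 < c a2 -> 0 < c a3 -> a3 = a1 \/ a3 = a2.
Proof.
move=> st IH a12 ca1 ca2 ca3; have [[cJ [cE cc] pc nc] eJ eE cmin] := st.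
have [->|a31] := eqVneq a3 a1; first by left.
have [->|a32] := eqVneq a3 a2; first by right.
have cJ' i : c i != 0 -> i \in J by apply: contraR => /cJ->.
have a3J : a3 \in J by rewrite cJ' // gt_eqF.
case: (IH a3 a3J (fun i => c i - c a3 * kron a3 i)).
have cN i : i != a3 -> c i - c a3 * kron a3 i = c i by move=> ii; rewrite kronN // mulr0 subr0.
have c3 : c a3 - c a3 * kron a3 a3 = 0 by rewrite kronE mulr1 subrr.
have pair a b i : 0 < c a -> c b < 0 -> c i != 0 -> i != a -> i != b -> a3 != a ->
    face J u h [set a3; i].
  move=> ca cb ci ia ib a3a; apply: (face_sub irr gen (star_face st ca cb)).
  apply/subsetP => k; rewrite !inE => /orP[]/eqP->; apply/orP; right.
    by rewrite a3a gt_eqF // andbT; apply: contraTneq ca3 => ->; rewrite -leNgt ltW.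
  by rewrite ia ib.
split.
- move=> i; have [->|ia3] := eqVneq i a3; first by rewrite c3.
  rewrite cN // in_link ia3; apply: contraNeq => ci; rewrite cJ' //=; apply/asboolP.
  case: (ltgtP (c i) 0) => [ci0|ci0|ci0]; last by rewrite ci0 eqxx in ci.
    have [b bi] := other_of i nc; rewrite oppr_gt0 => cb.
    apply: (pair a1 b) => //; last by rewrite eq_sym.
    by apply: contraTneq ci0 => ->; rewrite -leNgt ltW.
  have [b [_ [_ + _]]] := nc; rewrite oppr_gt0 => cb.
  have ib : i != b by apply: contraTneq ci0 => ->; rewrite -leNgt ltW.
  have [i1|i1] := eqVneq i a1; last exact: (pair a1 b).
  by apply: (pair a2 b); rewrite // i1.
- split=> [|b]; first by rewrite lin_proj linB linZ lin_kron cE sub0r -scaleNr (proj_e irr).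
  rewrite lin_proj => /proj0[k bE] bc.
  have [||t Ht] := cc (fun i => b i - k * kron a3 i); first by rewrite linB linZ lin_kron bE subrr.
    move=> i ci; have ia3 : i != a3 by apply: contraTneq ca3 => <-; rewrite ci ltxx.
    by rewrite kronN // mulr0 subr0 bc // cN.
  exists t => i; have [->|ia3] := eqVneq i a3; first by rewrite c3 mulr0 bc.
  by rewrite cN // -Ht kronN // mulr0 subr0.
- by exists a1, a2; rewrite !cN // eq_sym.
- have [i [j [ij ci cj]]] := nc; exists i, j; split=> //.
    by rewrite cN //; apply: contraTneq ci => ->; rewrite oppr_gt0 -leNgt ltW.
  by rewrite cN //; apply: contraTneq cj => ->; rewrite oppr_gt0 -leNgt ltW.
Qed.

End Star.

(** * Flips at a vertex *)

Ltac vring := apply/rowP => ?; rewrite !mxE; ring.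

Section Flip.
Context {R : realType} {n : nat} {I : finType}.
Variables (J : {set I}) (u : I -> 'rV[R]_n) (h : I -> R).
Hypothesis irr : irredundant J u h.

(** The substitute for a vertex is a point with a tight set of maximal size: moving along a vector
    orthogonal to the tight normals but not to all normals would meet a further constraint. *)
Lemma vertex_above (S : {set I}) : face J u h S -> exists x, [/\ poly J u h x,
  S \subset tight_set J u h x & forall v, (forall i, i \in tight_set J u h x -> dotp (u i) v = 0) ->
    forall i, i \in J -> dotp (u i) v = 0].
Proof.
move=> fS; have [x0 [Px0 x0S _]] := face_point fS.
pose Q m := `[< exists x, [/\ poly J u h x, S \subset tight_set J u h x & #|tight_set J u h x| = m] >].
have [||m /asboolP[x [Px Sx xm]] mmax] := @ex_maxnP Q #|I|.
- exists #|tight_set J u h x0|; apply/asboolP; exists x0; split=> //.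
  by apply/subsetP => i iS; rewrite inE (subsetP fS.1) //= x0S.
- by move=> _ /asboolP[x [_ _ <-]]; exact: max_card.
exists x; split=> // v vx.
suff H w : (forall i, i \in tight_set J u h x -> dotp (u i) w = 0) ->
    forall i, i \in J -> dotp (u i) w <= 0.
  move=> i iJ; apply: le_anti; rewrite H //= -oppr_le0 -dotpNr H // => k kx.
  by rewrite dotpNr vx ?oppr0.
move=> {v}vx i iJ; rewrite leNgt; apply/negP => iv.
pose b k := if k \in J then h k - dotp (u k) x else 1.
pose c k := if k \in J then dotp (u k) w else 0.
have [k||k ck kmin] := @ratio_min R I b c.
- by rewrite /b; case: ifP => // kJ; rewrite subr_ge0 Px.
- by exists i; rewrite /c iJ.
have kJ : k \in J by move: ck; rewrite /c; case: ifP => //; rewrite ltxx.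
rewrite /c kJ in ck; set t := _ / _ in kmin.
have kt : dotp (u k) (x + t *: w) = h k.
  by rewrite !dotE /t /b /c kJ divfK ?gt_eqF // addrC subrK.
have Pt : poly J u h (x + t *: w).
  by move=> j jJ; have := kmin j; rewrite /b /c jJ !dotE; lra.
have sub : tight_set J u h x \subset tight_set J u h (x + t *: w).
  apply/subsetP => j jx; have := vx j jx; move: jx; rewrite !inE => /andP[-> /eqP jx] jw.
  by rewrite !dotE jx jw mulr0 addr0 eqxx.
have : (#|tight_set J u h (x + t *: w)| <= m)%N.
  apply: mmax; apply/asboolP; exists (x + t *: w); split=> //.
  exact: subset_trans sub.
rewrite -xm leqNgt => /negP[]; apply: proper_card; apply/properP; split=> //.
exists k; first by rewrite inE kJ kt eqxx.
by apply/negP => /vx kw; rewrite kw ltxx in ck.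
Qed.

Variables (a1 a2 : I) (kap : R).
Hypothesis kap0 : 0 < kap.
Hypothesis a2J : a2 \in J.
Hypothesis a12 : u a2 = - kap *: u a1.

Definition free2 (v w : 'rV[R]_n) := forall x y, x *: v + y *: w = 0 -> x = 0 /\ y = 0.

(* [g] is the normal closest to [a2] in the half-plane of [f] bounded by the
   line through [a1] and [a2]. *)
Definition flip f g := g \in J /\ exists z x, [/\ 0 < z, 0 <= x,
  u g = z *: (u f + x *: u a2) &
  forall g' z' x', g' \in J -> 0 < z' -> 0 <= x' -> u g' = z' *: (u f + x' *: u a2) -> x' <= x].

Lemma flip_uniq f z x z' x' : free2 (u f) (u a2) -> 0 < z ->
  z *: (u f + x *: u a2) = z' *: (u f + x' *: u a2) -> x = x'.
Proof.
move=> fr z0 /eqP; rewrite -subr_eq0 !scalerDr !scalerA opprD addrACA -!scalerBl => /eqP/fr[].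
move=> /eqP; rewrite subr_eq0 => /eqP <- /eqP; rewrite subr_eq0 => /eqP.
by apply: mulfI; rewrite gt_eqF.
Qed.

Lemma flip_exists f : f \in J -> free2 (u f) (u a2) -> exists g, flip f g.
Proof.
move=> fJ fr.
pose Q g x := exists2 z, 0 < z & [/\ g \in J, 0 <= x & u g = z *: (u f + x *: u a2)].
pose val g := xget 0 (fun x : R => Q g x).
have valE g x : Q g x -> val g = x.
  move=> Qx; have [z z0 [_ _ gE]] := Qx.
  rewrite /val; case: xgetP => [y _ [z' z'0 [_ _ gE']]|/(_ x)//].
  by apply: (flip_uniq fr z'0 (z' := z)); rewrite -gE -gE'.
have Qf : Q f 0 by exists 1; rewrite ?ltr01 // scale0r addr0 scale1r.
pose B g := `[< exists x, Q g x >].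
have Bf : B f by apply/asboolP; exists 0.
case: (arg_maxP val Bf) => g /asboolP[x Qx] gmax.
have [z z0 [gJ x0 gE]] := Qx; exists g; split=> //; exists z, x; split=> // g' z' x' g'J z'0 x'0 g'E.
have Q' : Q g' x' by exists z'.
rewrite -(valE g x Qx) -(valE g' x' Q'); apply: gmax; apply/asboolP; by exists x'.
Qed.

Hypothesis gen : generating_property (poly J u h).

Lemma indep_free (S : {set I}) f k : indep S u -> f \in S -> k \in S -> f != k ->
  free2 (u f) (u k).
Proof.
move=> indS fS kS fk x y xy.
have H : forall i, x * kron f i + y * kron k i = 0.
  apply: indS; last by rewrite linD !linZ !lin_kron.
  move=> i iS; rewrite !kronN ?mulr0 ?addr0 //; by apply: contraNneq iS => ->.
have kf : k != f by rewrite eq_sym.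
have := H f; have := H k; rewrite !kronE (kronN kf) (kronN fk) !mulr0 !mulr1 add0r addr0.
by [].
Qed.

Lemma free2_opp f : free2 (u f) (u a1) -> free2 (u f) (u a2).
Proof.
move=> fr x y; rewrite a12 scalerA => /fr[-> /eqP].
by rewrite mulf_eq0 oppr_eq0 (gt_eqF kap0) orbF => /eqP.
Qed.

Lemma flip_neq f g : free2 (u f) (u a2) -> flip f g -> g != a2.
Proof.
move=> fr [gJ [z [x [z0 x0 gE _]]]]; apply/eqP => ga.
have [|z00 _] := fr z (z * x - 1); last by rewrite z00 ltxx in z0.
by rewrite scalerBl scale1r addrA -scalerA -scalerDr -gE ga subrr.
Qed.

(** The cone of the face contains no third normal, so no normal lies strictly between [f] and
    [a2]. *)
Lemma flip_fixed f g : face J u h [set f; a2] -> f != a2 -> flip f g -> g = f.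
Proof.
move=> ff fa fl; have indf := face_indep irr gen ff.
have fr : free2 (u f) (u a2) by apply: (indep_free indf); rewrite ?inE ?eqxx ?orbT.
have [gJ [z [x [z0 x0 gE _]]]] := fl.
have : g \in [set f; a2].
  apply: (face_primitive irr ff gJ); rewrite gE; apply/cone_dual => d Hd.
  have fd : dotp (u f) d <= 0 by apply: Hd; rewrite !inE eqxx.
  have a2d : x * dotp (u a2) d <= 0 by rewrite mulr_ge0_le0 // Hd // !inE eqxx orbT.
  by rewrite !dotE pmulr_rle0 //; lra.
by rewrite !inE (negbTE (flip_neq fr fl)) orbF => /eqP.
Qed.

Hypothesis gd : good J u.

(** The new set is primitive. A normal [u j] in its cone expands over [S] with a nonpositive
    coefficient at [a1]. If two other coefficients are positive, then [j] yields a bad circuit, or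
    lies in the cone of [S] and contradicts independence. If only that of [f] is, then [j] is in the
    half-plane of [f] and the extremality of the flip makes it [g f]. If none is, it is [a2]. *)
Lemma flip_face (S : {set I}) (g : I -> I) : face J u h S -> a1 \in S ->
  (forall f, f \in S -> f != a1 -> flip f (g f)) ->
  face J u h (a2 |: g @: (S :\ a1)).
Proof.
move=> fS a1S Hg; have indS := face_indep irr gen fS; have SJ := fS.1.
have fr f : f \in S -> f != a1 -> free2 (u f) (u a2).
  by move=> fS' fa; apply/free2_opp/(indep_free indS).
have /choice[zx Hzx] f : exists zx : R * R, f \in S -> f != a1 -> [/\ 0 < zx.1, 0 <= zx.2,
    u (g f) = zx.1 *: (u f + zx.2 *: u a2) &
    forall g' z' x', g' \in J -> 0 < z' -> 0 <= x' -> u g' = z' *: (u f + x' *: u a2) -> x' <= zx.2].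
  have [/andP[fS' fa]|H] := boolP ((f \in S) && (f != a1)).
    by have [_ [z [x H]]] := Hg f fS' fa; exists (z, x).
  by exists (0, 0) => fS' fa; rewrite fS' fa in H.
pose z f := (zx f).1; pose x f := (zx f).2.
have ginj : {in S :\ a1 &, injective g}.
  move=> f f'; rewrite !inE => /andP[fa fS'] /andP[fa' fS''] gg.
  have [z0 x0 gE _] := Hzx f fS' fa; have [z0' x0' gE' _] := Hzx f' fS'' fa'.
  apply/eqP/negPn/negP => ff.
  have H : forall i, z f * kron f i - z f' * kron f' i - kap * (z f * x f - z f' * x f') * kron a1 i = 0.
    apply: indS => [i iS|]; first by rewrite !kronN ?mulr0 ?subr0 //; apply: contraNneq iS => ->.
    rewrite !linB !linZ !lin_kron.
    have <- : z f *: (u f + x f *: u a2) - z f' *: (u f' + x f' *: u a2) = 0.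
      by rewrite -gE -gE' gg subrr.
    by rewrite a12; vring.
  have := H f; rewrite kronE (kronN ff) (kronN fa) !mulr0 !subr0 mulr1 => zf0.
  by move: z0; rewrite -/(z f) zf0 ltxx.
have a2g : a2 \notin g @: (S :\ a1).
  apply/imsetP => -[f]; rewrite !inE => /andP[fa fS'] ga.
  by have := flip_neq (fr f fS' fa) (Hg f fS' fa); rewrite -ga eqxx.
pose T := a2 |: g @: (S :\ a1).
(* A combination over the new set is rewritten with the old normals and [a2]: [D d] holds the
   coefficients of the former, [X d] the total one of [a2]. *)
pose D (d : I -> R) f := if f \in S :\ a1 then d (g f) * z f else 0.
pose X (d : I -> R) := d a2 + \sum_(f in S :\ a1) d (g f) * z f * x f.
have linE d : supported T d -> lin u d = lin u (D d) + X d *: u a2.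
  move=> dT; transitivity (\sum_(i in T) d i *: u i).
    rewrite [RHS]big_mkcond; apply: eq_bigr => i _.
    by case: ifP => // /negbT/dT->; rewrite scale0r.
  rewrite big_setU1 //= big_imset //= scalerDl addrCA; congr (_ + _).
  rewrite scaler_suml /lin [X in _ = X + _](_ : _ = \sum_(f in S :\ a1) (d (g f) * z f) *: u f).
    rewrite -big_split; apply: eq_bigr => f; rewrite !inE => /andP[fa fS'] /=.
    have [_ _ -> _] := Hzx f fS' fa; rewrite -/(z f) -/(x f); vring.
  rewrite [RHS]big_mkcond; apply: eq_bigr => f _.
  by rewrite /D; case: ifP; rewrite ?scale0r.
have DS d : supported S (D d).
  by move=> f fS'; rewrite /D !inE (negbTE fS') andbF.
have Da d : D d a1 = 0 by rewrite /D !inE eqxx.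
(* Over [S], the coefficient of [a1] is a negative multiple of [X d]. *)
have linS d : supported T d -> lin u d = lin u (fun i => D d i - kap * X d * kron a1 i).
  move=> dT; rewrite linE // linB linZ lin_kron a12; vring.
have DXS d : supported S (fun i => D d i - kap * X d * kron a1 i).
  move=> i iS; rewrite DS // kronN ?mulr0 ?subr0 //; by apply: contraNneq iS => ->.
have zpos f : f \in S -> f != a1 -> 0 < z f by move=> fS' fa; have [] := Hzx f fS' fa.
have xge f : f \in S -> f != a1 -> 0 <= x f by move=> fS' fa; have [] := Hzx f fS' fa.
have gJ f : f \in S -> f != a1 -> g f \in J by move=> fS' fa; have [] := Hg f fS' fa.
apply: (primitive_face irr gen); split.
- rewrite subUset sub1set a2J; apply/subsetP => _ /imsetP[f + ->].
  by rewrite !inE => /andP[fa fS']; exact: gJ.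
- move=> d dT dE.
  have H : forall i, D d i - kap * X d * kron a1 i = 0 by apply: indS => //; rewrite -linS.
  have X0 : X d = 0.
    have /eqP := H a1; rewrite Da kronE mulr1 sub0r oppr_eq0 mulf_eq0 (gt_eqF kap0).
    by move/eqP.
  have dg f : f \in S :\ a1 -> d (g f) = 0.
    move=> fS1; have /eqP := H f; rewrite X0 mulr0 mul0r subr0 /D fS1 mulf_eq0.
    move: fS1; rewrite !inE => /andP[fa fS'].
    by rewrite (gt_eqF (zpos f fS' fa)) orbF => /eqP.
  have da : d a2 = 0.
    by rewrite -X0 /X big1 ?addr0 // => f /dg->; rewrite !mul0r.
  move=> i; have [|/dT//] := boolP (i \in T).
  by rewrite /T in_setU1 => /orP[/eqP->//|/imsetP[f /dg + ->]].
move=> j jJ [d [d0 dT jE]].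
have D0 f : 0 <= D d f.
  rewrite /D; case: ifP => //; rewrite !inE => /andP[fa fS'].
  by rewrite mulr_ge0 // ltW // zpos.
have Xsum : 0 <= \sum_(f in S :\ a1) d (g f) * z f * x f.
  apply: sumr_ge0 => f; rewrite !inE => /andP[fa fS'].
  by rewrite mulr_ge0 ?xge // mulr_ge0 // ltW // zpos.
have DS1 f : 0 < D d f -> f \in S /\ f != a1.
  by rewrite /D; case: ifP; rewrite ?ltxx // !inE => /andP[-> ->].
have [[f Df]|ND] := pselect (exists f, 0 < D d f); last first.
  have D00 : forall f, D d f = 0.
    by move=> f; apply: le_anti; rewrite D0 andbT leNgt; apply/negP => Df; apply: ND; exists f.
  have jX : u j = X d *: u a2 by rewrite jE linE // (eq_lin _ D00) lin0 add0r.
  by rewrite (normal_inj irr jJ a2J _ jX) ?in_setU1 ?eqxx // addr_ge0.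
have [fS' fa] := DS1 f Df.
have [[f' [ff Df']]|NF] := pselect (exists f', f' != f /\ 0 < D d f').
  have [f'S f'a] := DS1 f' Df'; exfalso.
  have : 0 <= X d by rewrite addr_ge0.
  rewrite le_eqVlt => /orP[/eqP X0|Xp].
    have jD : u j = lin u (D d) by rewrite jE linE // -X0 scale0r addr0.
    have jS : j \in S by apply: (face_primitive irr fS jJ); exists (D d).
    have H : forall i, D d i - kron j i = 0.
      apply: indS; last by rewrite linB lin_kron jD subrr.
      move=> i iS; rewrite DS // kronN ?subr0 //; by apply: contraNneq iS => ->.
    have jf k : 0 < D d k -> k = j.
      move=> Dk; apply/eqP/negPn/negP => kj; have := H k.
      by rewrite kronN // subr0 => Dk0; rewrite Dk0 ltxx in Dk.
    by move: ff; rewrite (jf f Df) (jf f' Df') eqxx.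
  apply: (good_expand gd SJ indS jJ (DXS d) (i1 := f') (i2 := f) (i3 := a1)) => //.
  - by rewrite jE linS.
  - by rewrite kronN // mulr0 subr0.
  - by rewrite kronN // mulr0 subr0.
  - by rewrite Da kronE mulr1 sub0r oppr_lt0 mulr_gt0.
have other k : k != f -> D d k = 0.
  move=> kf; apply: le_anti; rewrite D0 andbT leNgt; apply/negP => Dk.
  by apply: NF; exists k.
have lD : lin u (D d) = D d f *: u f.
  rewrite -lin_kron -linZ; apply: eq_lin => k.
  have [->|kf] := eqVneq k f; first by rewrite kronE mulr1.
  by rewrite other // kronN // mulr0.
have fS1 : f \in S :\ a1 by rewrite !inE fa.
have Xf : X d = d a2 + D d f * x f.
  rewrite /X (bigD1 f) //= [X in _ + (_ + X)]big1 ?addr0 => [|k /andP[kS kf]].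
    by rewrite /D fS1.
  by have := other k kf; rewrite /D kS => ->; rewrite mul0r.
have [_ _ gE gmax] := Hzx f fS' fa; rewrite -/(z f) -/(x f) in gE gmax.
have jE1 : u j = D d f *: (u f + (X d / D d f) *: u a2).
  by rewrite scalerDr scalerA mulrCA divff ?mulr1 ?gt_eqF // -lD -linE.
have da2 : d a2 = 0.
  apply: le_anti; rewrite d0 andbT.
  have : X d / D d f <= x f.
    by apply: (gmax j (D d f)); rewrite // divr_ge0 // addr_ge0.
  by rewrite ler_pdivrMr // Xf mulrC; lra.
have jg : u j = (D d f / z f) *: u (g f).
  rewrite jE1 gE scalerA divfK ?gt_eqF ?zpos // Xf da2 add0r.
  by rewrite mulrAC divff ?mul1r ?gt_eqF.
rewrite (normal_inj irr jJ (gJ f fS' fa) _ jg) ?divr_ge0 ?(ltW (zpos f _ _)) //.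
by rewrite in_setU1 imset_f ?orbT.
Qed.

End Flip.

Section TwoFlips.
Context {R : realType} {n : nat} {I : finType}.
Variables (J : {set I}) (u : I -> 'rV[R]_n) (h : I -> R).
Hypothesis irr : irredundant J u h.
Hypothesis gen : generating_property (poly J u h).
Hypothesis gd : good J u.
Variables (a1 a2 b1 b2 : I) (ka kb : R).
Hypotheses (ka0 : 0 < ka) (kb0 : 0 < kb).
Hypotheses (a12 : u a2 = - ka *: u a1) (b12 : u b2 = - kb *: u b1).
Hypotheses (fb1a2 : face J u h [set b1; a2]) (fa1b2 : face J u h [set a1; b2])
  (fa2b2 : face J u h [set a2; b2]).

(* Each normal at the vertex changes under at most one of the two flips. *)
Lemma two_flips (S : {set I}) : face J u h S -> a1 \in S -> b1 \in S -> a1 != b1 ->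
  exists S21 S12 S22 : {set I},
    [/\ face J u h S21, face J u h S12 & face J u h S22] /\
    [/\ a2 \in S21 /\ b1 \in S21, a1 \in S12 /\ b2 \in S12, a2 \in S22 /\ b2 \in S22 &
    forall f, f \in S -> f != a1 -> f != b1 ->
      (exists g z x, [/\ z != 0, u g = z *: (u f + x *: u b2), f \in S21, g \in S12 & g \in S22]) \/
      (exists g z x, [/\ z != 0, u g = z *: (u f + x *: u a2), f \in S12, g \in S21 & g \in S22])].
Proof.
move=> fS a1S b1S ab; have indS := face_indep irr gen fS; have SJ := fS.1.
have ba : b1 != a1 by rewrite eq_sym.
have SJ' i : i \in S -> i \in J by exact: (subsetP SJ).
have a2J : a2 \in J by rewrite (subsetP fb1a2.1) // !inE eqxx orbT.
have b2J : b2 \in J by rewrite (subsetP fa1b2.1) // !inE eqxx orbT.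
have frA f : f \in S -> f != a1 -> free2 (u f) (u a2).
  by move=> fS' fa; apply/(free2_opp ka0 a12)/(indep_free indS).
have frB f : f \in S -> f != b1 -> free2 (u f) (u b2).
  by move=> fS' fb; apply/(free2_opp kb0 b12)/(indep_free indS).
have fr_neq f k : free2 (u f) (u k) -> f != k.
  move=> fr; apply/eqP => fk; have [|o _] := fr 1 (-1).
    by rewrite fk scaleN1r scale1r subrr.
  by move/eqP: o; rewrite oner_eq0.
have b1a2 := fr_neq _ _ (frA b1 b1S ba).
have a1b2 := fr_neq _ _ (frB a1 a1S ab).
have /choice[gA HA] f : exists g, f \in J -> free2 (u f) (u a2) -> flip J u a2 f g.
  have [[fJ fr]|H] := pselect (f \in J /\ free2 (u f) (u a2)); last first.
    by exists f => fJ fr; case: H.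
  by have [g Hg] := flip_exists fJ fr; exists g.
have /choice[gB HB] f : exists g, f \in J -> free2 (u f) (u b2) -> flip J u b2 f g.
  have [[fJ fr]|H] := pselect (f \in J /\ free2 (u f) (u b2)); last first.
    by exists f => fJ fr; case: H.
  by have [g Hg] := flip_exists fJ fr; exists g.
have HA' f : f \in S -> f != a1 -> flip J u a2 f (gA f).
  by move=> fS' fa; apply: HA; [exact: SJ' | exact: frA].
have HB' f : f \in S -> f != b1 -> flip J u b2 f (gB f).
  by move=> fS' fb; apply: HB; [exact: SJ' | exact: frB].
have f21 := flip_face irr ka0 a2J a12 gen gd fS a1S HA'.
have f12 := flip_face irr kb0 b2J b12 gen gd fS b1S HB'.
set S21 := a2 |: _ in f21; set S12 := b2 |: _ in f12.
have in21 f : f \in S -> f != a1 -> gA f \in S21.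
  by move=> fS' fa; rewrite in_setU1 imset_f ?orbT // in_setD1 fa.
have in12 f : f \in S -> f != b1 -> gB f \in S12.
  by move=> fS' fa; rewrite in_setU1 imset_f ?orbT // in_setD1 fa.
(* The first flip keeps [b1], so the second can be carried out after it. *)
have gAb1 : gA b1 = b1 by apply: (flip_fixed irr gen fb1a2) => //; exact: HA'.
have gBa1 : gB a1 = a1 by apply: (flip_fixed irr gen fa1b2) => //; exact: HB'.
have a2S21 : a2 \in S21 by rewrite in_setU1 eqxx.
have b1S21 : b1 \in S21 by rewrite -gAb1 in21.
have ind21 := face_indep irr gen f21.
have fr21 f : f \in S21 -> f != b1 -> free2 (u f) (u b2).
  by move=> fS' fb; apply/(free2_opp kb0 b12)/(indep_free ind21).
have HB21 f : f \in S21 -> f != b1 -> flip J u b2 f (gB f).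
  by move=> fS' fb; apply: HB; [exact: (subsetP f21.1) | exact: fr21].
have f22 := flip_face irr kb0 b2J b12 gen gd f21 b1S21 HB21.
set S22 := b2 |: _ in f22.
have in22 f : f \in S21 -> f != b1 -> gB f \in S22.
  by move=> fS' fa; rewrite in_setU1 imset_f ?orbT // in_setD1 fa.
have a2b1 : a2 != b1 by rewrite eq_sym.
have a2b2 := fr_neq _ _ (fr21 a2 a2S21 a2b1).
have gBa2 : gB a2 = a2 by apply: (flip_fixed irr gen fa2b2) => //; exact: HB21.
exists S21, S12, S22; split=> //; split=> //.
- by rewrite -{1}gBa1 in12 // in_setU1 eqxx.
- by rewrite -{1}gBa2 in22 // in_setU1 eqxx.
move=> f fS' fa fb.
have [gJ [z [x [z0 x0 gE _]]]] := HA' f fS' fa.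
have [gJ' [z' [x' [z0' x0' gE' _]]]] := HB' f fS' fb.
have still g k y : g \in J -> 0 < y -> u g = y *: (u f + 0 *: u k) -> g = f.
  move=> gJ0 y0; rewrite scale0r addr0; apply: (normal_inj irr) => //; [exact: SJ' | exact: ltW].
move: x0; rewrite le_eqVlt => /orP[/eqP x0|xp].
  have gf : gA f = f by rewrite -x0 in gE; exact: still gE.
  have fS21 : f \in S21 by rewrite -gf in21.
  left; exists (gB f), z', x'; split=> //; [by rewrite gt_eqF | exact: in12 | exact: in22].
pose da i := - z * x * ka * kron a1 i.
have a1f : a1 \in S :\ f by rewrite !inE eq_sym fa.
have b1f : b1 \in S :\ f by rewrite !inE eq_sym fb.
have [||gNS indg] := @indep_replace R n I u S f (gA f) z da indS fS' (lt0r_neq0 z0).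
- by move=> i iS; rewrite /da kronN ?mulr0 //; apply: contraNneq iS => ->.
- by rewrite gE linZ lin_kron a12; vring.
have ga1 : gA f != a1 by apply: contraNneq gNS => ->.
have gb1 : gA f != b1 by apply: contraNneq gNS => ->.
move: x0'; rewrite le_eqVlt => /orP[/eqP x0'|xp'].
  have gf : gB f = f by rewrite -x0' in gE'; exact: still gE'.
  have gS21 := in21 f fS' fa.
  have [gJ'' [z'' [x'' [z0'' x0'' gE'' _]]]] := HB21 (gA f) gS21 gb1.
  move: x0''; rewrite le_eqVlt => /orP[/eqP x0''|xp''].
    right; exists (gA f), z, x; split=> //; first by rewrite gt_eqF.
      by rewrite -gf in12.
    suff <- : gB (gA f) = gA f by exact: in22.
    apply: (normal_inj irr gJ'' gJ (ltW z0'')).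
    by rewrite gE'' -x0'' scale0r addr0.
  (* If the second flip moved [gA f] again, the result would expand over [S] with [a1] replaced by
     [a2], positively at [f] and [a2] and negatively at [b1]. *)
  have [|//||a2N ind2] := @indep_replace R n I u S a1 a2 (- ka) (fun=> 0) indS a1S.
  - by rewrite oppr_eq0 gt_eqF.
  - by rewrite lin0 addr0.
  exfalso; pose c i := z'' * z * kron f i + z'' * z * x * kron a2 i - z'' * x'' * kb * kron b1 i.
  have fS1 : f \in S :\ a1 by rewrite !inE fa.
  have bS1 : b1 \in S :\ a1 by rewrite !inE ba.
  have fa2 : f != a2 by apply: contraNneq a2N => <-.
  have a2f : a2 != f by rewrite eq_sym.
  have bf : b1 != f by rewrite eq_sym.
  apply: (good_expand gd _ ind2 gJ'' (c := c) (i1 := f) (i2 := a2) (i3 := b1)) => //.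
  - by rewrite subUset sub1set a2J (subset_trans (subsetDl _ _) SJ).
  - move=> i; rewrite in_setU1 negb_or => /andP[ia iS].
    rewrite /c (kronN ia) !kronN ?mulr0 ?addr0 ?subrr //.
      by apply: contraNneq iS => ->.
    by apply: contraNneq iS => ->.
  - by rewrite linB linD !linZ !lin_kron gE'' gE b12; vring.
  - by rewrite /c kronE (kronN fa2) (kronN fb) !mulr0 addr0 subr0 mulr1 mulr_gt0.
  - by rewrite /c kronE (kronN a2f) (kronN a2b1) !mulr0 add0r subr0 mulr1 !mulr_gt0.
  - by rewrite /c kronE (kronN bf) (kronN b1a2) !mulr0 !add0r mulr1 oppr_lt0 !mulr_gt0.
(* If both flips moved [f], then [gB f] would expand over [S] with [f] replaced by [gA f],
   positively at [gA f] and [a1] and negatively at [b1]. *)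
exfalso; pose c i := z' / z * kron (gA f) i + z' * x * ka * kron a1 i - z' * x' * kb * kron b1 i.
have a1g : a1 != gA f by rewrite eq_sym.
have b1g : b1 != gA f by rewrite eq_sym.
apply: (good_expand gd _ indg gJ' (c := c) (i1 := gA f) (i2 := a1) (i3 := b1)) => //.
- by rewrite subUset sub1set gJ (subset_trans (subsetDl _ _) SJ).
- move=> i; rewrite in_setU1 negb_or => /andP[ia iS].
  rewrite /c (kronN ia) !kronN ?mulr0 ?addr0 ?subrr //.
    by apply: contraNneq iS => ->.
  by apply: contraNneq iS => ->.
- rewrite linB linD !linZ !lin_kron gE' gE b12 a12 [(z' / z) *: _]scalerA divfK ?gt_eqF //; vring.
- by rewrite /c kronE (kronN ga1) (kronN gb1) !mulr0 addr0 subr0 mulr1 divr_gt0.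
- by rewrite /c kronE (kronN a1g) (kronN ab) !mulr0 add0r subr0 mulr1 !mulr_gt0.
- by rewrite /c kronE (kronN b1g) (kronN ba) !mulr0 !add0r mulr1 oppr_lt0 !mulr_gt0.
Qed.

End TwoFlips.

(** * Generating polyhedra have no bad circuit *)

Section GeneratingGood.
Context {R : realType} {n : nat} {I : finType}.

(* The intersection of [P] with its translate by [-k], [k = y21 - y11], reaches
   only level [h e - t] in direction [u e], at [y11] and [y12].  The other
   summand must therefore gain [t] in direction [u e], whereas it cannot gain
   anything in the directions [u b1] and [u b2]. *)
Lemma parallelogram_absurd (J : {set I}) (u : I -> 'rV[R]_n) (h : I -> R)
    (e a1 a2 b1 b2 : I) (al1 al2 be1 be2 t : R) (y11 y12 y21 : 'rV[R]_n) :
  generating_property (poly J u h) -> (exists2 p, poly J u h p & dotp (u e) p = h e) ->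
  [/\ e \in J, a1 \in J, a2 \in J, b1 \in J & b2 \in J] ->
  [/\ 0 < al1, 0 < al2, 0 < be1 & 0 < be2] ->
  u e = al1 *: u a1 + al2 *: u a2 -> u e = be1 *: u b1 + be2 *: u b2 -> 0 < t ->
  [/\ poly J u h y11, poly J u h y12, poly J u h y21 & poly J u h (y12 + (y21 - y11))] ->
  dotp (u e) y11 = h e - t -> dotp (u e) y12 = h e - t ->
  dotp (u a1) y11 = h a1 -> dotp (u a2) y21 = h a2 ->
  dotp (u b1) y11 = h b1 -> dotp (u b2) y12 = h b2 -> False.
Proof.
move=> gen [p Pp pe] [eJ a1J a2J b1J b2J] [al10 al20 be10 be20] eA eB t0 [P11 P12 P21 P22].
move=> e11 e12 ya1 ya2 yb1 yb2; set k := y21 - y11 in P22.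
pose T : set 'rV[R]_n := [set x | x = 0 \/ x = - k]%classic.
have inI x : poly J u h x -> poly J u h (x + k) ->
    (\bigcap_(t in T) translate t (poly J u h))%classic x.
  move=> Px Pxk _ [->|->]; first by exists x; rewrite ?add0r.
  by exists (x + k); rewrite // addrC addrK.
have I11 : (\bigcap_(t in T) translate t (poly J u h))%classic y11.
  by apply: inI => //; rewrite /k addrC subrK.
have I12 := inI y12 P12 P22.
have [|I0|[B BE]] := gen T; first by exists 0; left.
  by rewrite I0 in I11.
have : poly J u h p by []; rewrite -{1}BE => -[i Ii [b Bb ib]].
have Pi : poly J u h i by have [|x Px] := Ii 0; [left | rewrite add0r => <-].
have Pik : poly J u h (i + k).
  by have [|x Px <-] := Ii (- k); [right | rewrite addrC addNKr].
have P11b : poly J u h (y11 + b) by rewrite -BE; exists y11 => //; exists b.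
have P12b : poly J u h (y12 + b) by rewrite -BE; exists y12 => //; exists b.
have ia1 : al1 * (dotp (u a1) i - dotp (u a1) y11) <= 0.
  by rewrite pmulr_rle0 // subr_le0 ya1 Pi.
have ia2 : al2 * (dotp (u a2) i - dotp (u a2) y11) <= 0.
  by rewrite pmulr_rle0 //; have := Pik a2 a2J; rewrite /k dotpDr dotpBr ya2; lra.
have bb1 : be1 * dotp (u b1) b <= 0.
  by rewrite pmulr_rle0 //; have := P11b b1 b1J; rewrite dotpDr yb1; lra.
have bb2 : be2 * dotp (u b2) b <= 0.
  by rewrite pmulr_rle0 //; have := P12b b2 b2J; rewrite dotpDr yb2; lra.
have eb : dotp (u e) b <= 0 by rewrite eB !dotE; lra.
have ei : dotp (u e) i <= dotp (u e) y11 by rewrite eA !dotE; lra.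
by move: pe; rewrite -ib dotpDr; lra.
Qed.

Lemma good_of_links (J : {set I}) (u : I -> 'rV[R]_n) (h : I -> R) :
  irredundant J u h -> generating_property (poly J u h) ->
  (forall k, k \in J -> good (link J u h k) (facet_normal u k)) -> good J u.
Proof.
move=> irr gen IH; apply: contrapT => /(star_exists irr gen)[c [e st]].
have st' := star_opp st; have ce := star_axis0 st.
have [[cJ [cE cc] pc nc] eJ eE cmin] := st.
have [a1 [a2 [a12 ca1 ca2]]] := pc; have [b1 [b2 [b12 cb1 cb2]]] := nc.
have cJ' i : c i != 0 -> i \in J by apply: contraR => /cJ->.
have pos2 d i j : star J u d e -> i != j -> 0 < d i -> 0 < d j ->
    u e = d i *: u i + d j *: u j.
  move=> sd ij di dj; have [_ _ -> _] := sd; have ji : j != i by rewrite eq_sym.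
  rewrite -[u i]lin_kron -[u j]lin_kron -!linZ -linD; apply: eq_lin => k.
  have [dk|dk] := ltP 0 (d k).
    rewrite pos_gt //; have [->|->] := star_two_pos irr gen sd IH ij di dj dk.
      by rewrite kronE (kronN ij) mulr1 mulr0 addr0.
    by rewrite kronE (kronN ji) mulr1 mulr0 add0r.
  rewrite pos_le // !kronN ?mulr0 ?addr0 //; by apply: contraTneq dk => ->; rewrite -ltNge.
have eA := pos2 c a1 a2 st a12 ca1 ca2.
have eB := pos2 (opp c) b1 b2 st' b12 cb1 cb2.
rewrite !oppr_gt0 in cb1 cb2.
have ab a b : 0 < c a -> c b < 0 -> a != b.
  by move=> ca cb; apply: contraTneq ca => ->; rewrite -leNgt ltW.
have D a a' b b' : a' != a -> b' != b -> 0 < c a -> c b < 0 -> 0 < c a' -> c b' < 0 ->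
    face J u h (e |: [set a; b]).
  move=> aa bb ca cb ca' cb'; apply: (face_sub irr gen (star_face irr gen st ca' cb')).
  apply: setUS; apply/subsetP => i; rewrite !inE => /orP[]/eqP->.
    by rewrite (ab a b') // eq_sym aa gt_eqF.
  by rewrite eq_sym bb lt_eqF // eq_sym (ab a' b).
have a21 : a2 != a1 by rewrite eq_sym.
have b21 : b2 != b1 by rewrite eq_sym.
have D11 := D a1 a2 b1 b2 a21 b21 ca1 cb1 ca2 cb2.
have D12 := D a1 a2 b2 b1 a21 b12 ca1 cb2 ca2 cb1.
have D21 := D a2 a1 b1 b2 a12 b21 ca2 cb1 ca1 cb2.
have D22 := D a2 a1 b2 b1 a12 b12 ca2 cb2 ca1 cb1.
have lk i S : face J u h (e |: S) -> i \in S -> c i != 0 -> i \in link J u h e.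
  move=> fS iS ci; rewrite in_link cJ' //=.
  have ie : i != e by apply: contraNneq ci => ->; rewrite ce.
  rewrite ie; apply/asboolP; apply: (face_sub irr gen fS).
  by apply/subsetP => k; rewrite !inE => /orP[]/eqP->; rewrite ?eqxx // iS orbT.
have la1 : a1 \in link J u h e by rewrite (lk _ _ D11) ?gt_eqF // !inE eqxx.
have la2 : a2 \in link J u h e by rewrite (lk _ _ D21) ?gt_eqF // !inE eqxx.
have lb1 : b1 \in link J u h e by rewrite (lk _ _ D11) ?lt_eqF // !inE eqxx orbT.
have lb2 : b2 \in link J u h e by rewrite (lk _ _ D12) ?lt_eqF // !inE eqxx orbT.
pose L := link J u h e; pose v := facet_normal u e; pose k := facet_height u h e.
have irrL : irredundant L v k := facet_irredundant irr eJ gen.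
have genL : generating_property (poly L v k) := facet_generating irr eJ gen.
have pair i j : i \in L -> j \in L -> face J u h (e |: [set i; j]) -> face L v k [set i; j].
  move=> iL jL; apply: (facet_face irr eJ gen _).2.
  by apply/subsetP => ?; rewrite in_set2 => /orP[]/eqP->.
(* The projection to the facet kills [u e], so the two normals summing to it become opposite. *)
have opposite i j (x y : R) : 0 < x -> 0 < y -> u e = x *: u i + y *: u j ->
    v j = - (x / y) *: v i.
  move=> x0 y0 eij; have : x *: v i + y *: v j = 0.
    rewrite -!projZ -projD -eij -[u e]scale1r; exact: (proj_e irr).
  move=> /eqP; rewrite addrC addr_eq0 => /eqP yj.
  by apply: (scalerI (lt0r_neq0 y0)); rewrite yj scalerA mulrN mulrCA divff ?gt_eqF // mulr1 scaleNr.
have ob1 : 0 < opp c b1 by rewrite oppr_gt0.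
have ob2 : 0 < opp c b2 by rewrite oppr_gt0.
have flips := two_flips irrL genL (IH e eJ) (divr_gt0 ca1 ca2) (divr_gt0 ob1 ob2)
  (opposite _ _ _ _ ca1 ca2 eA) (opposite _ _ _ _ ob1 ob2 eB).
have [x [Px Dx xvert]] := vertex_above D11.
set S0 := tight_set J u h x in Dx xvert.
have inS0 i : i \in e |: [set a1; b1] -> i \in S0 by exact: (subsetP Dx).
have eS0 : e \in S0 by rewrite inS0 // !inE eqxx.
have tight i : i \in S0 -> dotp (u i) x = h i by rewrite inE => /andP[_ /eqP].
have SL : S0 :\ e \subset L.
  apply/subsetP => i; rewrite in_setD1 => /andP[ie iS0].
  apply: (tight_link irr eJ gen Px) => //; first exact: tight.
    by move: iS0; rewrite inE => /andP[].
  exact: tight.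
have fS : face L v k (S0 :\ e).
  by apply/(facet_face irr eJ gen SL); rewrite setD1K //; exact: face_tight_set.
have ne i : i \in L -> i != e by apply: contraTneq => ->; exact: e_notin_link.
have a1S : a1 \in S0 :\ e by rewrite in_setD1 ne // inS0 // !inE eqxx orbT.
have b1S : b1 \in S0 :\ e by rewrite in_setD1 ne // inS0 // !inE eqxx !orbT.
have [|||S21 [S12 [S22 [[f21 f12 f22] [[a2S21 b1S21] [a1S12 b2S12] [a2S22 b2S22] two]]]]] :=
  flips _ _ _ (S0 :\ e) fS a1S b1S (ab a1 b1 ca1 cb1).
- by apply: pair => //; rewrite [[set b1; a2]]setUC.
- exact: pair.
- exact: pair.
have lower S : face L v k S -> exists2 t0 : R, 0 < t0 & forall t, 0 < t <= t0 ->
    exists y, [/\ poly J u h y, forall i, i \in S -> dotp (u i) y = h i & dotp (u e) y = h e - t].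
  move=> fS'; have SL' := fS'.1.
  have /(face_lower irr gen)/(_ (setU11 _ _))[t0 t00 Ht] := (facet_face irr eJ gen SL').1 fS'.
  exists t0 => // t /Ht[y [Py yS ye]]; exists y; split=> // i iS.
  by rewrite yS ?in_setU1 ?iS ?orbT // ne // (subsetP SL').
have [t1 t10 H1] := lower _ fS; have [t2 t20 H2] := lower _ f21.
have [t3 t30 H3] := lower _ f12; have [t4 t40 H4] := lower _ f22.
(* The four points must be at the same depth below the facet, so that their differences are
   orthogonal to [u e]. *)
pose t := Num.min (Num.min t1 t2) (Num.min t3 t4).
have t0 : 0 < t by rewrite !lt_min t10 t20 t30 t40.
have /and4P[le1 le2 le3 le4] : [&& t <= t1, t <= t2, t <= t3 & t <= t4].
  by rewrite /t !ge_min !lexx !orbT.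
have [|y11 [P11 y11S e11]] := H1 t; first by rewrite t0.
have [|y21 [P21 y21S e21]] := H2 t; first by rewrite t0.
have [|y12 [P12 y12S e12]] := H3 t; first by rewrite t0.
have [|y22 [P22 y22S e22]] := H4 t; first by rewrite t0.
(* The flip relation holds between projected normals, that is, modulo [u e]. *)
have vanish w z g f q y : w != 0 -> v g = w *: (v f + z *: v q) -> dotp (u e) y = 0 ->
    dotp (u g) y = 0 -> dotp (u q) y = 0 -> dotp (u f) y = 0.
  move=> w0 gE ye yg yq; have : proj u e (u g - w *: (u f + z *: u q)) = 0.
    rewrite projD projN projZ projD projZ.
    by rewrite [proj u e (u g)](gE : _ = w *: (proj u e (u f) + z *: proj u e (u q))) subrr.
  move=> /proj0[s sE]; have : dotp (u g - w *: (u f + z *: u q)) y = 0.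
    by rewrite sE dotpZl ye mulr0.
  rewrite !dotE yg yq mulr0 addr0 sub0r => /eqP.
  by rewrite oppr_eq0 mulf_eq0 (negbTE w0) => /eqP.
have other f q y (x0 z0 : R) : x0 != 0 -> u e = x0 *: u f + z0 *: u q ->
    dotp (u e) y = 0 -> dotp (u q) y = 0 -> dotp (u f) y = 0.
  move=> x00 eE' ye yq; move: ye; rewrite eE' !dotE yq mulr0 addr0 => /eqP.
  by rewrite mulf_eq0 (negbTE x00) => /eqP.
have d2 f y z : dotp (u f) y = dotp (u f) z -> dotp (u f) (y - z) = 0.
  by move=> fyz; rewrite dotpBr fyz subrr.
(* The defect of the parallelogram. It is orthogonal to the normals tight at [x], hence to all
   normals, so subtracting it from [y22] does not leave [P]. *)
pose m := (y11 - y12) + (y22 - y21).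
have mE : m = (y11 - y21) + (y22 - y12) by rewrite /m; vring.
have m0 : forall i, i \in J -> dotp (u i) m = 0.
  apply: xvert => f fS0; have [->|fe] := eqVneq f e.
    by rewrite dotpDr !d2 ?addr0 // ?e11 ?e22.
  have fS1 : f \in S0 :\ e by rewrite in_setD1 fe.
  have [->|fa] := eqVneq f a1.
    rewrite dotpDr d2 ?y11S ?y12S // add0r.
    apply: (other _ _ _ _ _ (lt0r_neq0 ca1) eA); apply: d2; first by rewrite e22.
    by rewrite y22S // y21S.
  have [->|fb] := eqVneq f b1.
    rewrite mE dotpDr d2 ?y11S ?y21S // add0r.
    apply: (other _ _ _ _ _ (lt0r_neq0 ob1) eB); apply: d2; first by rewrite e22.
    by rewrite y22S // y12S.
  have [[g [w [z [w0 gE fS' gS gS']]]]|[g [w [z [w0 gE fS' gS gS']]]]] := two f fS1 fa fb.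
    rewrite mE dotpDr d2 ?y11S ?y21S // add0r.
    apply: (vanish _ _ _ _ _ _ w0 gE); apply: d2; first by rewrite e22.
      by rewrite y22S // y12S.
    by rewrite y22S // y12S.
  rewrite dotpDr d2 ?y11S ?y12S // add0r.
  apply: (vanish _ _ _ _ _ _ w0 gE); apply: d2; first by rewrite e22.
    by rewrite y22S // y21S.
  by rewrite y22S // y21S.
have iJ i : i \in link J u h e -> i \in J by exact: (subsetP (link_sub J u h e)).
have [p [Pp pe _]] := face_point (irr.2 e eJ).
apply: (@parallelogram_absurd J u h e a1 a2 b1 b2 (c a1) (c a2) (opp c b1) (opp c b2) t y11 y12 y21) => //.
- by exists p; rewrite ?pe ?inE.
- by split=> //; exact: iJ.
- split=> //; have -> : y12 + (y21 - y11) = y22 - m by rewrite /m; vring.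
  by move=> i iJ'; rewrite dotpBr m0 // subr0 P22.
- exact: y11S.
- exact: y21S.
- exact: y11S.
- exact: y12S.
Qed.

Theorem generating_good (J : {set I}) (u : I -> 'rV[R]_n) (h : I -> R) :
  irredundant J u h -> generating_property (poly J u h) -> good J u.
Proof.
have [m] := ubnP #|J|; elim: m J u h => // m IH J u h mJ irr gen.
apply: (good_of_links irr gen) => e eJ.
apply: (IH _ _ (facet_height u h e)); last 2 first.
- exact: facet_irredundant.
- exact: facet_generating.
apply: (@leq_trans #|J|); last by rewrite -ltnS.
apply: proper_card; apply/properP; split; first exact: link_sub.
by exists e => //; exact: e_notin_link.
Qed.

End GeneratingGood.

(** * Sign vectors *)

Section Signs.
Context {R : realType} {n : nat} {I : finType}.
Variable u : I -> 'rV[R]_n.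
Implicit Types (h : I -> R).

(** For a dependency the heights may be replaced by the slacks at any point [x]. Take [x] on the
    facet of the negative coefficient, or in the interior if there is none: every term becomes
    nonnegative and one is positive. *)
Lemma circuit_pos h (c : I -> R) : irredundant [set: I] u h -> lin u c = 0 ->
  (exists i, c i != 0) -> ~ two_pos (fun i => - c i) -> 0 < \sum_i c i * h i.
Proof.
move=> irr cE [i0 ci0] nt.
have valE x : \sum_i c i * h i = \sum_i c i * (h i - dotp (u i) x).
  have := lin_dot u c x; rewrite cE dotp0l => E.
  rewrite [RHS](eq_bigr (fun i => c i * h i - c i * dotp (u i) x)); last by move=> i _; rewrite mulrBr.
  by rewrite sumrB -E subr0.
have [[j cj]|N] := pselect (exists j, c j < 0).
  have cN i : i != j -> 0 <= c i.
    move=> ij; rewrite leNgt; apply/negP => ci; apply: nt; exists i, j.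
    by rewrite !oppr_gt0.
  have [x [Px xj xN]] := face_point (irr.2 j (in_setT j)).
  have {}xj : dotp (u j) x = h j by apply: xj; rewrite inE.
  have [k kj ck] : exists2 k, k != j & 0 < c k.
    apply/not_exists2P => H; have /eqP[] := normal_neq0 irr (in_setT j).
    apply: (scalerI (ltr0_neq0 cj)); rewrite scaler0 -cE /lin (bigD1 j) //= big1 ?addr0 // => i ij.
    have : c i = 0.
      by apply: le_anti; rewrite cN // andbT leNgt; apply/negP => ci; have [] := H i.
    by move=> ->; rewrite scale0r.
  rewrite (valE x) (bigD1 k) //= ltr_wpDr //.
    apply: sumr_ge0 => i _; have [->|ij] := eqVneq i j; first by rewrite xj subrr mulr0.
    by rewrite mulr_ge0 ?cN // subr_ge0 Px.
  by rewrite mulr_gt0 // subr_gt0 xN // inE.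
have [x [Px _ xN]] := face_point irr.1.
have c0 i : 0 <= c i by rewrite leNgt; apply/negP => ci; apply: N; exists i.
rewrite (valE x) (bigD1 i0) //= ltr_wpDr //.
  by apply: sumr_ge0 => i _; rewrite mulr_ge0 ?c0 // subr_ge0 Px.
by rewrite mulr_gt0 ?subr_gt0 ?xN ?inE // lt_neqAle eq_sym ci0 c0.
Qed.

Hypothesis gd : good [set: I] u.

(** If two coefficients are negative, at most one is positive; then [circuit_pos] for the opposite
    circuit and [h'] contradicts the assumed sign. *)
Lemma circuit_sign h h' c : irredundant [set: I] u h -> irredundant [set: I] u h' ->
  circuit u c -> (exists i, c i != 0) -> 0 <= \sum_i c i * h' i -> 0 < \sum_i c i * h i.
Proof.
move=> irr irr' cc c0 ch'; have [cE _] := cc.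
have [nc|nc] := pselect (two_pos (fun i => - c i)); last exact: circuit_pos.
have pc : ~ two_pos c.
  by move=> pc; apply: (@gd c); split=> // i; rewrite in_setT.
have : 0 < \sum_i - c i * h' i.
  apply: (circuit_pos irr'); first by rewrite linN cE oppr0.
    by have [i ci] := c0; exists i; rewrite oppr_eq0.
  by move=> nc'; apply: pc; apply: two_pos_eq nc' => i; rewrite opprK.
by under eq_bigr do rewrite mulNr; rewrite sumrN oppr_gt0 ltNge ch'.
Qed.

(* Moving along another dependency supported on a certificate [c] of minimal
   support, in the direction where [h] increases, would shrink the support. *)
Lemma conformal_circuit h (s : I -> R) : (exists c, [/\ lin u c = 0, 0 <= \sum_i c i * h i,
    forall i, 0 <= c i * s i & exists i, c i != 0]) ->
  exists c, [/\ circuit u c, 0 <= \sum_i c i * h i, forall i, 0 <= c i * s i & exists i, c i != 0].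
Proof.
pose Q c := [/\ lin u c = 0, 0 <= \sum_i c i * h i, forall i, 0 <= c i * s i & exists i, c i != 0].
move=> [c0 Qc0].
have [|m /asboolP[c [Qc Nc]] mmin] := @ex_minnP (fun m => `[< exists c, Q c /\ #|supp c| = m >]).
  by exists #|supp c0|; apply/asboolP; exists c0.
have [cE ch cs c_n0] := Qc.
exists c; split=> //; split=> // b bE bc.
have [i0 ci0] := c_n0.
pose t := b i0 / c i0; exists t; apply: contrapT => /existsNP[j bj].
pose d0 i := b i - t * c i.
have [e [dE dh dc di0 dj]] : exists d, [/\ lin u d = 0, 0 <= \sum_i d i * h i,
    forall i, c i = 0 -> d i = 0, d i0 = 0 & d j != 0].
  have d0E : lin u d0 = 0 by rewrite linB linZ bE cE scaler0 subr0.
  have d0c i : c i = 0 -> d0 i = 0 by move=> ci; rewrite /d0 ci bc // mulr0 subr0.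
  have d0i : d0 i0 = 0 by rewrite /d0 /t divfK // subrr.
  have d0j : d0 j != 0 by rewrite subr_eq0; apply/eqP.
  have [dh|dh] := leP 0 (\sum_i d0 i * h i); first by exists d0.
  exists (fun i => - d0 i); split=> //.
  - by rewrite linN d0E oppr0.
  - by under eq_bigr do rewrite mulNr; rewrite sumrN oppr_ge0 ltW.
  - by move=> i /d0c->; rewrite oppr0.
  - by rewrite d0i oppr0.
  - by rewrite oppr_eq0.
have sub c' : (forall i, c i = 0 -> c' i = 0) -> (exists2 i, c i != 0 & c' i = 0) ->
    (forall i, 0 <= c' i * c i) -> Q c' -> False.
  move=> c'c [i ci c'i] c'pos Qc'; have : (m <= #|supp c'|)%N by apply: mmin; apply/asboolP; exists c'.
  rewrite -Nc leqNgt => /negP[]; apply: proper_card; apply/properP; split.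
    by apply/subsetP => k; rewrite !in_supp; apply: contraNneq => /c'c->.
  by exists i; rewrite in_supp // c'i eqxx.
have conf c' : (forall i, c i = 0 -> c' i = 0) -> (forall i, 0 <= c' i * c i) ->
    forall i, 0 <= c' i * s i.
  move=> c'c c'pos i; have := c'pos i; have := cs i; have := c'c i.
  case: (ltgtP (c i) 0) => [ci _|ci _|-> /(_ erefl)->]; last by rewrite mul0r.
  - by rewrite nmulr_rge0 // nmulr_lge0 // => si c'i; rewrite mulr_le0.
  - by rewrite pmulr_rge0 // pmulr_lge0 // => si c'i; rewrite mulr_ge0.
have [[k dk]|N] := pselect (exists i, e i * c i < 0); last first.
  have epos i : 0 <= e i * c i by rewrite leNgt; apply/negP => ei; apply: N; exists i.
  apply: (sub e) => //; first by exists i0.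
  by split=> //; [exact: conf | exists j].
have [i||k' ek' kmin] := @ratio_min R I (fun i => `|c i|) (fun i => if e i * c i < 0 then `|e i| else 0).
- exact: normr_ge0.
- exists k; rewrite dk normr_gt0; apply: contraTneq dk => ->; by rewrite mul0r ltxx.
move: ek' kmin; case: ifP => [ek' ek0 kmin|]; last by rewrite ltxx.
set th := _ / _ in kmin; have th0 : 0 <= th by rewrite divr_ge0.
pose c' i := c i + th * e i.
have c'c i : c i = 0 -> c' i = 0 by move=> ci; rewrite /c' ci dc // mulr0 addr0.
have c'pos i : 0 <= c' i * c i.
  have := kmin i; case: ifP => [ei|/negbT]; last first.
    by rewrite -leNgt /c' => ei _; have := sqr_ge0 (c i); have := mulr_ge0 th0 ei; rewrite expr2; nra.
  rewrite /c'; case: (ltgtP (c i) 0) => [ci|ci|->]; last by rewrite mulr0.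
    have ei0 : 0 < e i by nra.
    by rewrite ltr0_norm // gtr0_norm //; nra.
  have ei0 : e i < 0 by nra.
  by rewrite gtr0_norm // ltr0_norm //; nra.
apply: (sub c') => //.
  exists k'; first by apply: contraTneq ek' => ->; rewrite mulr0 ltxx.
  rewrite /c' /th; case: (ltgtP (c k') 0) ek' => [ck|ck|->]; last by rewrite mulr0 ltxx.
    move=> ek; have ei0 : 0 < e k' by nra.
    by rewrite ltr0_norm // gtr0_norm // divfK ?gt_eqF // addrN.
  move=> ek; have ei0 : e k' < 0 by nra.
  by rewrite gtr0_norm // ltr0_norm // invrN mulrN mulNr divfK ?lt_eqF // addrN.
split.
- by rewrite linD linZ cE dE scaler0 addr0.
- have -> : \sum_i c' i * h i = \sum_i c i * h i + th * \sum_i e i * h i.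
    by rewrite mulr_sumr -big_split; apply: eq_bigr => i _; rewrite /c' /=; ring.
  by rewrite addr_ge0 // mulr_ge0.
- exact: conf.
- by exists i0; rewrite /c' di0 mulr0 addr0.
Qed.

Lemma sgr_scale (a b : R) : 0 < a -> Num.sg (a * b) = Num.sg b.
Proof. by move=> a0; rewrite sgrM gtr0_sg // mul1r. Qed.

(** If the signs of [x] were not realized for [h'], [motzkin] would give a dependency conforming to
    them with nonnegative [h']-value, and so a circuit of this kind. By [circuit_sign] its [h]-value
    is positive, whereas evaluation at [x] shows it to be nonpositive. *)
Lemma sign_transfer h h' : irredundant [set: I] u h -> irredundant [set: I] u h' ->
  forall x, exists y, forall i, Num.sg (dotp (u i) y - h' i) = Num.sg (dotp (u i) x - h i).
Proof.
move=> irr irr' x; pose s i := Num.sg (dotp (u i) x - h i).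
(* A nonzero sign is encoded as a strict inequality, a zero one as an equation. The system is
   homogenized by a last coordinate, which the row [None] makes positive. *)
pose r i : R := if s i == 0 then 1 else - s i.
pose W o : 'rV[R]_(n + 1) := if o is Some i then r i *: row_mx (u i) (\row_(_ < 1) - h' i)
  else row_mx 0 (\row_(_ < 1) (-1)).
pose A : {set option I} := [set o | if o is Some i then s i != 0 else true].
pose B : {set option I} := [set o | if o is Some i then s i == 0 else false].
have rowE (a : R) (t : 'rV[R]_1) : dotp (\row_(_ < 1) a) t = a * t 0 0.
  by rewrite /dotp big_ord1 mxE.
have WE i (a : 'rV[R]_n) (t : 'rV[R]_1) :
    dotp (W (Some i)) (row_mx a t) = r i * (dotp (u i) a - h' i * t 0 0).
  by rewrite dotpZl dotp_row_mx rowE mulNr.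
have [|[X [XA XB]]|[c [cE cS cA [k kA ck]]]] := @motzkin R (n + 1) _ W A B.
- by case=> [i|]; rewrite !inE // => ->.
- pose a := lsubmx X; pose t := rsubmx X 0 0.
  have XE o : dotp (W o) X = dotp (W o) (row_mx a (rsubmx X)) by rewrite hsubmxK.
  have t0 : 0 < t.
    have := XA None; rewrite inE XE dotp_row_mx dotp0l add0r rowE mulN1r oppr_lt0.
    exact.
  exists (t^-1 *: a) => i; rewrite -/(s i).
  rewrite -[LHS](sgr_scale _ t0) mulrBr dotpZr mulrA divff ?gt_eqF // mul1r mulrC.
  have [si|si] := eqVneq (s i) 0.
    have := XB (Some i); rewrite inE si eqxx XE WE /r si eqxx mul1r mulrC => ->//.
    by rewrite sgr0.
  have := XA (Some i); rewrite inE si XE WE /r (negbTE si) mulNr oppr_lt0 mulrC => /(_ isT).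
  rewrite /s in si *; case: sgrP si => [|_ _|_ _]; rewrite ?eqxx //.
    by rewrite mulrC mul1r [X in _ - X]mulrC => /gtr0_sg.
  by rewrite mulrC mulN1r [X in _ - X]mulrC oppr_gt0 => /ltr0_sg.
exfalso; pose g i := - (c (Some i) * r i).
have cX a (t : R) : \sum_i g i * (dotp (u i) a - h' i * t) = - (c None * t).
  have := lin_dot W c (row_mx a (\row_(_ < 1) t)).
  rewrite cE dotp0l big_option dotp_row_mx dotp0l add0r rowE mxE mulN1r mulrN.
  under eq_bigr do rewrite WE mxE mulrA.
  move=> /esym/eqP; rewrite addr_eq0 => /eqP ->; rewrite -sumrN.
  by apply: eq_bigr => i _; rewrite /g mulNr.
have gE : lin u g = 0.
  apply: dotp_eq0; rewrite lin_dot; have := cX (lin u g) 0.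
  rewrite mulr0 oppr0 => E; rewrite -[RHS]E.
  by apply: eq_bigr => i _; rewrite mulr0 subr0.
have gh : \sum_i g i * h' i = c None.
  have := cX 0 1; rewrite mulr1 => /eqP; rewrite -eqr_opp opprK => /eqP <-.
  by rewrite -sumrN; apply: eq_bigr => i _; rewrite dotp0r mulr1 sub0r mulrN opprK.
have gs i : 0 <= g i * s i.
  have [->|si] := eqVneq (s i) 0; first by rewrite mulr0.
  rewrite /g /r (negbTE si) mulrN opprK -mulrA mulr_ge0 //; first by apply: cA; rewrite inE.
  by rewrite -expr2 sqr_ge0.
have [|c' [cc' ch' cs' c'0]] := @conformal_circuit h' s.
  exists g; split=> //; first by rewrite gh; apply: cA; rewrite inE.
  apply: contrapT => ng0.
  have g0 i : g i = 0 by apply/eqP/negPn/negP => gi; apply: ng0; exists i.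
  case: k kA ck => [i|]; rewrite !inE => ki ck.
    have := g0 i; rewrite /g /r (negbTE ki) mulrN opprK => /eqP.
    by rewrite mulf_eq0 (negbTE ki) (gt_eqF ck).
  by move: ck; rewrite -gh big1 ?ltxx // => i _; rewrite g0 mul0r.
have := circuit_sign irr irr' cc' c'0 ch'; rewrite ltNge => /negP[].
have E := lin_dot u c' x; rewrite cc'.1 dotp0l in E.
rewrite (_ : \sum_i c' i * h i = \sum_i (c' i * h i - c' i * dotp (u i) x)); last first.
  by rewrite sumrB -E subr0.
apply: sumr_le0 => i _; rewrite -mulrBr.
rewrite -opprB mulrN oppr_le0; have := cs' i; rewrite /s.
case: sgrP => [-> _|d0|d0]; first by rewrite mulr0.
  by rewrite mulr1 => c'i; rewrite mulr_ge0 // ltW.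
by rewrite mulrN1 oppr_ge0 => c'i; rewrite mulr_le0 // ltW.
Qed.

End Signs.

(** * Arrangements *)

Section Arrangements.
Context {R : realType} {n : nat}.

Lemma hyperplane_eq (u w : 'rV[R]_n) (c d : R) : u != 0 -> w != 0 ->
  hyperplane u c = hyperplane w d -> exists k, [/\ k != 0, w = k *: u & d = k * c].
Proof.
move=> u0 w0 H; have uu : dotp u u != 0 by rewrite gt_eqF // dotp_gt0.
have in_iff x : dotp u x = c <-> dotp w x = d.
  by split=> Hx; [have : hyperplane u c x by [] | have : hyperplane w d x by []];
    rewrite ?H // -H.
pose x0 := (c / dotp u u) *: u; have ux0 : dotp u x0 = c by rewrite dotpZr divfK.
have wx0 := (in_iff x0).1 ux0.
pose k := dotp w u / dotp u u; pose z := w - k *: u.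
have uz : dotp u z = 0 by rewrite dotpBr dotpZr (dotpC u w) divfK // subrr.
have wz : dotp w z = 0.
  have := (in_iff (x0 + z)).1; rewrite (dotpDr u x0 z) (dotpDr w x0 z) uz addr0 wx0 => /(_ ux0)/eqP.
  by rewrite -subr_eq0 addrAC subrr add0r => /eqP.
have wE : w = k *: u.
  apply/eqP; rewrite -subr_eq0 -/z; apply/eqP/dotp_eq0.
  by rewrite {1}/z dotpBl dotpZl uz wz mulr0 subrr.
exists k; split=> //; last by rewrite -wx0 wE dotpZl ux0.
by apply: contraNneq w0 => k0; rewrite wE k0 scale0r.
Qed.

Context {I : finType}.
Variable u : I -> 'rV[R]_n.
Implicit Types (h : I -> R).
Hypothesis u0 : forall i, u i != 0.

Definition arrangement h : set (set 'rV[R]_n) := range (fun i => hyperplane (u i) (h i)).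

Definition signs h x i := Num.sg (dotp (u i) x - h i).

Lemma arrangement_cellP h x y :
  arrangement_cell (arrangement h) x y <-> signs h y =1 signs h x.
Proof.
split=> [H i|H w d w0 [i _ /(hyperplane_eq (u0 i) w0)[k [k0 -> ->]]]].
  by apply: H => //; exists i.
by rewrite !dotpZl -!mulrBr !sgrM [Num.sg (_ - _)]H.
Qed.

Lemma ball_row (x y : 'rV[R]_n) (e : R) : 0 < e -> (forall j, `|x 0 j - y 0 j| < e) -> ball x e y.
Proof. by move=> e0 H; split=> // i j; rewrite ord1; exact: H. Qed.

(** Nonzero signs are locally constant, so in the closure signs can only degenerate to zero.
    Conversely a short move from [y] towards [x] keeps the nonzero signs and gives the others the
    signs of [x]. *)
Lemma closure_cell h x y :
  topology_structure.closure (arrangement_cell (arrangement h) x) y <->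
  forall i, signs h y i = 0 \/ signs h y i = signs h x i.
Proof.
split=> [H i|H].
  have [yi|yi] := eqVneq (dotp (u i) y - h i) 0; first by left; rewrite /signs yi sgr0.
  right; pose a := dotp (u i) y - h i; pose S := \sum_j `|u i 0 j|.
  have S0 : 0 <= S by apply: sumr_ge0.
  (* Balls are those of the sup norm, so [S] is a Lipschitz constant of the inner product with
     [u i]; the summand 1 avoids a division by zero. *)
  pose e := `|a| / (S + 1).
  have e0 : 0 < e by rewrite divr_gt0 ?normr_gt0 // ltr_wpDl.
  have [z [/arrangement_cellP/(_ i) <- [_ yz]]] := H (ball y e) (nbhsx_ballx y e e0).
  have za : `|dotp (u i) z - dotp (u i) y| < `|a|.
    rewrite -dotpBr; apply: (@le_lt_trans _ _ (S * e)).
      rewrite /S mulr_suml; apply: le_trans (ler_norm_sum _ _ _) _.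
      apply: ler_sum => j _; rewrite normrM ler_wpM2l //.
      by have := yz 0 j; rewrite !mxE distrC => /ltW.
    rewrite /e mulrCA gtr_pMr ?normr_gt0 // ltr_pdivrMr ?ltr_wpDl //.
    by rewrite mul1r ltrDl ltr01.
  rewrite /signs; move: za; rewrite /a; move: (dotp (u i) z) (dotp (u i) y) yi => p q qi.
  case: (ltgtP (q - h i) 0) => [qn|qp|/eqP]; last by rewrite (negbTE qi).
    rewrite [X in _ < X]ltr0_norm // ltr_norml => /andP[_ pq].
    by rewrite !ltr0_sg //; lra.
  rewrite [X in _ < X]gtr0_norm // ltr_norml => /andP[pq _].
  by rewrite !gtr0_sg //; lra.
move=> B /nbhs_ballP[e /= e0 eB].
have [|t0 t00 Ht] := @eps_exists R 'I_n predT (fun=> e) (fun j => `|y 0 j - x 0 j|).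
  by move=> _ _.
pose t := Num.min t0 1.
have tp : 0 < t by rewrite lt_min t00 ltr01.
have t1 : t <= 1 by rewrite ge_min lexx orbT.
have tt0 : t <= t0 by rewrite ge_min lexx.
exists (y + t *: (x - y)); split; last first.
  apply: eB; apply: ball_row => // j; rewrite !mxE opprD addNKr normrN normrM gtr0_norm //.
  by rewrite distrC; apply: Ht; rewrite ?tp.
apply/arrangement_cellP => i; rewrite /signs.
have -> : dotp (u i) (y + t *: (x - y)) - h i =
    (1 - t) * (dotp (u i) y - h i) + t * (dotp (u i) x - h i) by rewrite !dotE; ring.
have := H i; rewrite /signs.
case: (sgrP (dotp (u i) y - h i)) => [->|yp|yn] H'.
- by rewrite mulr0 add0r sgr_scale.
- case: H' => /eqP; first by rewrite oner_eq0.
  rewrite eq_sym sgr_cp0 => xp; rewrite !gtr0_sg //.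
  have : 0 < t * (dotp (u i) x - h i) by rewrite mulr_gt0.
  have : 0 <= (1 - t) * (dotp (u i) y - h i) by apply: mulr_ge0; [rewrite subr_ge0 | exact: ltW].
  lra.
- case: H' => /eqP; first by rewrite oppr_eq0 oner_eq0.
  rewrite eq_sym sgr_cp0 => xn; rewrite !ltr0_sg //.
  have : t * (dotp (u i) x - h i) < 0 by rewrite pmulr_rlt0.
  have : (1 - t) * (dotp (u i) y - h i) <= 0 by apply: mulr_ge0_le0; [rewrite subr_ge0 | exact: ltW].
  lra.
Qed.

Lemma cell_closureP h x y :
  (arrangement_cell (arrangement h) x `<=` topology_structure.closure (arrangement_cell (arrangement h) y))%classic
  <-> forall i, signs h x i = 0 \/ signs h x i = signs h y i.
Proof.
split=> [H|H z /arrangement_cellP zx].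
  by apply/closure_cell; apply: H; apply/arrangement_cellP.
by apply/closure_cell => i; rewrite zx.
Qed.

Lemma arrangement_equivalent h h' : good [set: I] u ->
  irredundant [set: I] u h -> irredundant [set: I] u h' ->
  combinatorially_equivalent (arrangement h) (arrangement h').
Proof.
move=> gd irr irr'.
(* The cell of the second arrangement with the sign vector of [C], described without choosing a
   point of [C]. *)
pose f C := [set y | forall x, C x -> signs h' y =1 signs h x]%classic.
have fE x y : signs h' y =1 signs h x ->
    f (arrangement_cell (arrangement h) x) = arrangement_cell (arrangement h') y.
  move=> yx; apply/seteqP; split=> z Hz.
    apply/arrangement_cellP => i; rewrite yx; apply: Hz.
    exact/arrangement_cellP.
  move=> x' /arrangement_cellP x'x i; rewrite x'x -yx.
  by move/arrangement_cellP: Hz; apply.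
have tr x : exists y, signs h' y =1 signs h x := sign_transfer gd irr irr' x.
exists f; split; first split.
- move=> _ [x _ <-]; have [y yx] := tr x.
  by exists y => //; rewrite (fE x y yx).
- move=> C D; rewrite !in_setE => -[x _ <-] [x' _ <-].
  have [y yx] := tr x; have [y' yx'] := tr x'; rewrite (fE x y yx) (fE x' y' yx') => E.
  have yy' : signs h' y =1 signs h' y'.
    by apply/arrangement_cellP; rewrite -E; exact/arrangement_cellP.
  apply/seteqP; split=> z /arrangement_cellP zx; apply/arrangement_cellP => i;
    by rewrite zx -yx -?yx' yy' // -yx'.
- move=> _ [y _ <-]; have [x xy] := sign_transfer gd irr' irr y.
  by exists (arrangement_cell (arrangement h) x); [exists x | rewrite (fE x y) // => i; rewrite /signs xy].
move=> _ _ [x _ <-] [x' _ <-].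
have [y yx] := tr x; have [y' yx'] := tr x'; rewrite (fE x y yx) (fE x' y' yx').
split=> /cell_closureP H; apply/cell_closureP => i; have := H i; by rewrite yx yx'.
Qed.

End Arrangements.

(** * Dimension and facets of polytopes *)

Section Dimension.
Context {R : realType} {n : nat}.
Implicit Types (A F P Q : set 'rV[R]_n) (u v w x : 'rV[R]_n) (W : {vspace 'rV[R]_n}).

Lemma sub_affine_hull A x : A x -> affine_hull A x.
Proof.
move=> Ax; exists 1%N, (fun=> x), (fun=> 1).
by rewrite !big_ord1 scale1r.
Qed.

Lemma affine_hull_hyperplane A u c : (A `<=` hyperplane u c)%classic ->
  (affine_hull A `<=` hyperplane u c)%classic.
Proof.
move=> H _ [k [v [l [Av l1 ->]]]]; rewrite /hyperplane /= dotp_sumr.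
rewrite -[RHS]mul1r -l1 mulr_suml; apply: eq_bigr => i _.
by rewrite dotpZr (H _ (Av i)).
Qed.

Lemma affine_hull_neq0 A x : affine_hull A x -> A !=set0%classic.
Proof.
move=> [[|k] [v [l [Av l1 _]]]]; last by exists (v ord0).
by move: l1; rewrite big_ord0 => /esym/eqP; rewrite oner_eq0.
Qed.

Lemma has_dim_uniq A d d' : has_dim A d -> has_dim A d' -> d = d'.
Proof.
move=> [p [W [<- AE]]] [p' [W' [<- AE']]]; congr (\dim _).
have pW x : x - p \in W <-> x - p' \in W'.
  have : [set x | x - p \in W]%classic = [set x | x - p' \in W']%classic by rewrite -AE.
  by move/seteqP => [H H']; split=> [/H|/H'].
have pp : p - p' \in W' by apply/pW; rewrite subrr mem0v.
apply/vspaceP => v; apply/idP/idP => vW.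
  by rewrite -[v](addrK (p - p')) addrA memvB //; apply/pW; rewrite addrK.
have -> : v = v + p - p by rewrite addrK.
by apply/pW; rewrite -addrA memvD.
Qed.

Definition dotl u : 'Hom('rV[R]_n, 'rV[R]_1) := linfun (mulmxr u^T).

Definition orth u : {vspace 'rV[R]_n} := lker (dotl u).

Lemma mem_orth u v : (v \in orth u) = (dotp u v == 0).
Proof.
have E : v *m u^T = const_mx (dotp u v).
  by apply/rowP => j; rewrite ord1 !mxE; apply: eq_bigr => i _; rewrite mxE mulrC.
rewrite memv_ker lfunE /= E; apply/eqP/eqP => [/rowP/(_ ord0)|->]; first by rewrite !mxE.
by apply/rowP => j; rewrite !mxE.
Qed.

Lemma dim_orth u : u != 0 -> (\dim (orth u)).+1 = n.
Proof.
move=> u0; have := limg_ker_dim (dotl u) fullv.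
have -> : (fullv :&: lker (dotl u))%VS = orth u by apply/capv_idPr; exact: subvf.
rewrite dimvf /dim /= mul1n; apply: etrans; rewrite -addn1; congr (_ + _)%N.
apply/eqP; rewrite eq_sym eqn_leq lt0n dimv_eq0; apply/andP; split.
  by apply: leq_trans (dimvS (subvf _)) _; rewrite dimvf /dim /=.
apply/negP => /eqP H; have : dotl u u \in 0%VS by rewrite -H memv_img ?memvf.
rewrite memv0 -memv_ker -/(orth u) mem_orth; apply/negP.
by rewrite gt_eqF // dotp_gt0.
Qed.

Lemma has_dim_full A : has_dim A n -> affine_hull A = [set: 'rV[R]_n]%classic.
Proof.
move=> [p [W [dW AE]]]; have -> : affine_hull A = [set x | x - p \in fullv]%classic.
  rewrite AE; suff -> : W = fullv by [].
  apply/eqP; rewrite eqEdim subvf dW dimvf /dim /=; by rewrite mul1n.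
by apply/seteqP; split=> x //= _; rewrite memvf.
Qed.

End Dimension.

(** * Half-space descriptions of polytopes *)

Section Polytopes.
Context {R : realType} {n : nat}.
Implicit Types (P Q F : set 'rV[R]_n) (u v w x y z : 'rV[R]_n).

(** Weyl's theorem for the cone over [P] placed at height 1; the last coordinates of the normals
    become, up to sign, the right-hand sides. *)
Lemma polytope_halfspaces P : polytope P ->
  exists m (a : 'I_m -> 'rV[R]_n) (b : 'I_m -> R), P = poly [set: 'I_m] a b.
Proof.
move=> [k [v PE]].
pose W i : 'rV[R]_(n + 1) := row_mx (v i) (const_mx 1).
have linW (c : 'I_k -> R) : lin W c = row_mx (lin v c) (const_mx (\sum_i c i)).
  apply/rowP => j; rewrite summxE; case: (split_ordP j) => i ->.
    by rewrite row_mxEl summxE; apply: eq_bigr => l _; rewrite mxE row_mxEl mxE.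
  by rewrite row_mxEr mxE; apply: eq_bigr => l _; rewrite mxE row_mxEr mxE mulr1.
have PW x : P x <-> cone [set: 'I_k] W (row_mx x (const_mx 1)).
  rewrite PE; split=> [[l [l0 l1 ->]]|[c [c0 _]]].
    by exists l; split=> // [i|]; rewrite ?in_setT // linW l1.
  rewrite linW => /eq_row_mx[-> /rowP/(_ ord0)]; rewrite !mxE => c1.
  by exists c; split.
have [U HU] := weyl [seq W i | i <- enum 'I_k].
have EU x : P x <-> forall X : 'rV[R]_(n + 1), X \in U -> dotp X (row_mx x (const_mx 1)) <= 0.
  rewrite PW -HU seq_coneP ?enum_uniq //.
  have -> : [set i in enum 'I_k] = [set: 'I_k] by apply/setP => i; rewrite !inE mem_enum.
  by [].
pose w i := nth 0 U (nat_of_ord (i : 'I_(size U))).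
exists (size U), (fun i => lsubmx (w i)), (fun i => - rsubmx (w i) 0 0).
have wE i x : dotp (w i) (row_mx x (const_mx 1)) = dotp (lsubmx (w i)) x + rsubmx (w i) 0 0.
  by rewrite -{1}[w i]hsubmxK dotp_row_mx; congr (_ + _); rewrite /dotp big_ord1 [const_mx _ _ _]mxE mulr1.
apply/seteqP; split=> x; rewrite EU => H.
  move=> i _; have := H (w i); rewrite wE mem_nth // => /(_ isT); lra.
move=> w' /(nthP 0)[i ilt <-].
have := H (Ordinal ilt) (in_setT _); have := wE (Ordinal ilt) x; rewrite /w /= => ->; lra.
Qed.

(** In a subsystem of least size each inequality is violated by a point satisfying the others. Full
    dimension provides points where single inequalities are strict, whose average is interior; the
    segment from it to the violating point crosses the hyperplane where only that inequality is
    tight. *)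
Lemma irredundant_subsystem P m (a : 'I_m -> 'rV[R]_n) (b : 'I_m -> R) :
  P = poly [set: 'I_m] a b -> has_dim P n ->
  exists2 J : {set 'I_m}, P = poly J a b & irredundant J a b.
Proof.
move=> PE dP; pose Q (J : {set 'I_m}) := `[< P = poly J a b >].
have QT : Q [set: 'I_m] by apply/asboolP.
case: (arg_minnP (fun J : {set 'I_m} => #|J|) QT) => J /asboolP PJ Jmin.
exists J => //.
have notP j : j \in J -> exists x, (forall i, i \in J -> i != j -> dotp (a i) x <= b i) /\ b j < dotp (a j) x.
  move=> jJ; apply: contrapT => H.
  have : (#|J| <= #|J :\ j|)%N.
    apply: Jmin; apply/asboolP; rewrite PJ; apply/seteqP; split=> x Hx i.
      by rewrite !inE => /andP[_]; exact: Hx.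
    move=> iJ; have [->|ij] := eqVneq i j; last by apply: Hx; rewrite !inE ij.
    rewrite leNgt; apply/negP => xj; apply: H; exists x; split=> // k kJ kj.
    by apply: Hx; rewrite !inE kj.
  by rewrite [in X in (X <= _)%N](cardsD1 j) jJ ltnn.
have P0 : P !=set0%classic.
  have : affine_hull P 0 by rewrite has_dim_full.
  exact: affine_hull_neq0.
have /choice[p Hp] j : exists p, j \in J -> P p /\ dotp (a j) p < b j.
  have [jJ|_] := boolP (j \in J); last by exists 0.
  apply: contrapT => H; have PH : (P `<=` hyperplane (a j) (b j))%classic.
    move=> x Px; apply/eqP; rewrite eq_le; apply/andP; split.
      by move: Px; rewrite PJ; apply.
    by rewrite leNgt; apply/negP => xj; apply: H; exists x.
  have /affine_hull_hyperplane := PH; rewrite has_dim_full // => HH.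
  have [x0 _] := P0; have aj : a j = 0.
    apply: dotp_eq0; have := HH (x0 + a j) I; have := HH x0 I.
    by rewrite /hyperplane /= dotpDr => -> /eqP; rewrite addrC -subr_eq0 addrK => /eqP.
  have [x [_]] := notP j jJ; have := HH 0 I; rewrite /hyperplane /= aj !dotp0l => <-.
  by rewrite ltxx.
have [x0 Hx0] : exists x0, forall i, i \in J -> dotp (a i) x0 < b i.
  have [J0|[j jJ]] := set_0Vmem J; first by exists 0 => i; rewrite J0 inE.
  have J0 : 0 < #|J|%:R :> R by rewrite ltr0n; apply/card_gt0P; exists j.
  exists (#|J|%:R^-1 *: \sum_(k in J) p k) => i iJ.
  rewrite dotpZr mulrC ltr_pdivrMr // dotp_sumr mulr_natr -sumr_const.
  rewrite (bigD1 i) //= [ltRHS](bigD1 i) //=; apply: ltr_leD; first by case: (Hp i iJ).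
  apply: ler_sum => k /andP[kJ _]; have [Pk _] := Hp k kJ.
  by move: Pk; rewrite PJ; apply.
split; first by split; [exact: sub0set | exists x0; split=> i; [rewrite inE | move=> /Hx0]].
move=> j jJ; split; first by rewrite sub1set.
have [x [xi xj]] := notP j jJ; have := Hx0 j jJ => x0j.
pose t := (b j - dotp (a j) x0) / (dotp (a j) x - dotp (a j) x0).
have d0 : 0 < dotp (a j) x - dotp (a j) x0 by lra.
have t0 : 0 < t by rewrite divr_gt0 // subr_gt0.
have t1 : t < 1 by rewrite ltr_pdivrMr // mul1r ltrD2r.
exists (x0 + t *: (x - x0)); split=> i.
  rewrite inE => /eqP ->; rewrite dotpDr dotpZr dotpBr divfK ?gt_eqF //.
  by rewrite addrC subrK.
rewrite inE => iJ ij; rewrite !dotE; have := xi i iJ ij; have := Hx0 i iJ; nra.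
Qed.

Lemma unit_scale w : w != 0 -> exists2 a : R, 0 < a & dotp (a *: w) (a *: w) = 1.
Proof.
move=> w0; have ww := dotp_gt0 w0; exists (Num.sqrt (dotp w w))^-1.
  by rewrite invr_gt0 sqrtr_gt0.
rewrite dotpZl dotpZr mulrA -invfM -expr2 sqr_sqrtr ?ltW // mulVf //.
by rewrite gt_eqF.
Qed.

Lemma support_face_scale P w (a : R) : 0 < a -> support_face P (a *: w) = support_face P w.
Proof.
move=> a0; apply/seteqP; split=> x [Px H]; split=> // y /H; by rewrite !dotpZl ler_pM2l.
Qed.

Lemma facet_has_normal P F : facet P F -> exists2 w, facet_normals P w & F = support_face P w.
Proof.
move=> [[w FE] [d [dP dF]]]; have [w0|w0] := eqVneq w 0.
  have FP : F = P.
    rewrite FE w0; apply/seteqP; split=> x; first by case.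
    by move=> Px; split=> // y _; rewrite !dotp0l.
  by rewrite FP in dF; have /eqP := has_dim_uniq dP dF; rewrite eqn_leq ltnn.
have [a a0 aw] := unit_scale w0; exists (a *: w); last by rewrite support_face_scale.
split=> //; rewrite support_face_scale //; split; first by exists w.
by exists d; rewrite -FE.
Qed.

End Polytopes.

(** * Facets and their unit normals *)

Section FacetNormals.
Context {R : realType} {n : nat}.
Implicit Types (P Q F : set 'rV[R]_n) (v w x y z : 'rV[R]_n).

Lemma unit_system P : polytope P -> has_dim P n ->
  exists m (u : 'I_m -> 'rV[R]_n) (h : 'I_m -> R), [/\ P = poly [set: 'I_m] u h,
    irredundant [set: 'I_m] u h & forall i, dotp (u i) (u i) = 1].
Proof.
move=> polP dP; have [m [a [b PE]]] := polytope_halfspaces polP.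
have {PE} [J PE irr] := irredundant_subsystem PE dP.
have /choice[s Hs] j : exists s : R, j \in J -> 0 < s /\ dotp (s *: a j) (s *: a j) = 1.
  have [/(normal_neq0 irr)/unit_scale[s]|_] := boolP (j \in J); first by exists s.
  by exists 0.
pose k (i : 'I_#|J|) := enum_val i.
have kJ i : k i \in J by exact: enum_valP.
have s0 i : 0 < s (k i) by have [] := Hs _ (kJ i).
have kP j : j \in J -> exists i, j = k i.
  by move=> jJ; exists (enum_rank_in jJ j); rewrite /k enum_rankK_in.
exists #|J|, (fun i => s (k i) *: a (k i)), (fun i => s (k i) * b (k i)).
split; last by move=> i; have [] := Hs _ (kJ i).
  rewrite PE; apply/seteqP; split=> x Hx.
    by move=> i _; rewrite dotpZl ler_pM2l // Hx.
  by move=> j /kP[i ->]; have := Hx i (in_setT _); rewrite dotpZl ler_pM2l.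
split.
  have [_ [x [_ xN]]] := irr.1; split; first exact: sub0set.
  exists x; split=> i; first by rewrite inE.
  by rewrite dotpZl ltr_pM2l // => _ _; apply: xN; rewrite // inE.
move=> i _; have [_ [x [xi xN]]] := irr.2 _ (kJ i); split; first exact: subsetT.
exists x; split=> j.
  by rewrite inE => /eqP->; rewrite dotpZl xi // inE.
rewrite inE dotpZl ltr_pM2l // => _ ji; apply: xN => //.
by rewrite inE; apply: contra ji => /eqP/enum_val_inj->.
Qed.

Section System.
Context {I : finType}.
Variables (u : I -> 'rV[R]_n) (h : I -> R).
Hypothesis irr : irredundant [set: I] u h.
Hypothesis u1 : forall i, dotp (u i) (u i) = 1.
Let P := poly [set: I] u h.
Hypothesis dP : has_dim P n.

Let u0 i : u i != 0.
Proof. exact: (normal_neq0 irr (in_setT i)). Qed.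

Lemma support_faceE i : support_face P (u i) = [set x | P x /\ dotp (u i) x = h i]%classic.
Proof.
have [z [Pz zi _]] := face_point (irr.2 i (in_setT i)).
apply/seteqP; split=> x [Px Hx]; split=> //; last by move=> y Py; rewrite Hx Py // in_setT.
by apply: le_anti; rewrite Px ?in_setT //= -(zi i) ?inE ?Hx.
Qed.

(** A point [z] where only constraint [i] is tight can be moved a little towards any [x] of the
    hyperplane without leaving the facet, and [x] lies on the line through the two points
    obtained. *)
Lemma facet_hull i : affine_hull (support_face P (u i)) = hyperplane (u i) (h i).
Proof.
rewrite support_faceE; apply/seteqP; split; first by apply: affine_hull_hyperplane => x [].
move=> x xi; have [z [Pz zi zN]] := face_point (irr.2 i (in_setT i)).
have {}zi : dotp (u i) z = h i by rewrite zi // inE.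
have xi' : dotp (u i) x = h i := xi.
have [j _ zj|e e0 /(_ e)[]] := @poly_move R n I [set: I] u h z (x - z) Pz.
- have [->|ji] := eqVneq j i; first by rewrite dotpBr xi' zi subrr.
  by have := zN j (in_setT j); rewrite inE ji zj ltxx => /(_ isT).
- by rewrite e0 lexx.
move=> Pe _; exists 2%N.
exists (fun k : 'I_2 => if k == ord0 then z else z + e *: (x - z)).
exists (fun k : 'I_2 => if k == ord0 then 1 - e^-1 else e^-1).
rewrite !big_ord_recl !big_ord0 /= !addr0; split.
- move=> k; case: ifP => _; split=> //.
  by rewrite dotpDr dotpZr dotpBr xi' zi subrr mulr0 addr0.
- by rewrite subrK.
- rewrite scalerDr scalerA mulVf ?gt_eqF // scale1r; apply/rowP => k; rewrite !mxE; ring.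
Qed.

Lemma normal_facet i : facet_normals P (u i).
Proof.
split; first exact: u1.
split; first by exists (u i).
exists (\dim (orth (u i))); rewrite dim_orth ?u0 //; split=> //.
have [z [Pz zi _]] := face_point (irr.2 i (in_setT i)).
have {}zi : dotp (u i) z = h i by rewrite zi // inE.
exists z, (orth (u i)); split=> //; rewrite facet_hull; apply/seteqP; split=> x /=.
  by move=> xi; rewrite mem_orth dotpBr xi zi subrr.
by rewrite mem_orth dotpBr zi subr_eq0 => /eqP.
Qed.

(** By duality [w] is a nonnegative combination of normals tight at a point of its face. Each normal
    that occurs has a hyperplane containing the face, hence equal to its affine hull by dimension.
    Two of them would be parallel: equal directions contradict irredundancy, opposite ones the
    existence of an interior point. *)
Lemma facet_normalP w : facet_normals P w -> exists i, w = u i.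
Proof.
move=> [w1 [_ [d [dP' [p [W [dW FE]]]]]]]; have nd := has_dim_uniq dP dP'.
set F := support_face P w in FE.
have Fp : affine_hull F p by rewrite FE /= subrr mem0v.
have [x [Px xmax]] := affine_hull_neq0 Fp.
have [c [c0 cS wE]] := lp_dual Px xmax.
have cx i : c i * dotp (u i) x = c i * h i.
  have [|/cS->] := boolP (i \in tight_set [set: I] u h x); last by rewrite !mul0r.
  by rewrite inE => /andP[_ /eqP->].
have FH i : 0 < c i -> (F `<=` hyperplane (u i) (h i))%classic.
  move=> ci y [Py ymax]; have wxy : dotp w x = dotp w y.
    by apply: le_anti; rewrite xmax ?ymax.
  have : \sum_j c j * (h j - dotp (u j) y) = 0.
    rewrite (eq_bigr (fun j => c j * dotp (u j) x - c j * dotp (u j) y)).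
      by rewrite sumrB -!lin_dot -wE wxy subrr.
    by move=> j _; rewrite mulrBr cx.
  move/eqP; rewrite psumr_eq0 => [/allP/(_ i)|j _]; last by rewrite mulr_ge0 // subr_ge0 Py ?in_setT.
  rewrite mem_index_enum => /(_ isT); rewrite /= mulf_eq0 (gt_eqF ci) /= subr_eq0 => /eqP.
  by rewrite /hyperplane /= => ->.
have FA i : 0 < c i -> affine_hull F = hyperplane (u i) (h i).
  move=> ci; have H := affine_hull_hyperplane (FH i ci).
  have pi : dotp (u i) p = h i := H p Fp.
  have -> : affine_hull F = [set y | y - p \in orth (u i)]%classic.
    rewrite FE; suff -> : W = orth (u i) by [].
    apply/eqP; rewrite eqEdim; apply/andP; split; last first.
      by rewrite dW -ltnS dim_orth ?u0 // nd.
    apply/subvP => y yW; rewrite mem_orth; have : affine_hull F (y + p) by rewrite FE /= addrK.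
    by move=> /H; rewrite /hyperplane /= dotpDr pi => /eqP; rewrite -subr_eq0 addrK.
  apply/seteqP; split=> y /=; first by rewrite mem_orth dotpBr pi subr_eq0 => /eqP.
  by move=> yi; rewrite mem_orth dotpBr pi yi subrr.
have [i ci] : exists i, 0 < c i.
  apply: contrapT => H; have c00 i : c i = 0.
    by apply: le_anti; rewrite c0 andbT leNgt; apply/negP => ci; apply: H; exists i.
  by move/eqP: w1; rewrite wE (eq_lin _ c00) lin0 dotp0l eq_sym oner_eq0.
have other j : j != i -> c j = 0.
  move=> ji; apply: le_anti; rewrite c0 andbT leNgt; apply/negP => cj.
  have := FA i ci; rewrite (FA j cj) => /(hyperplane_eq (u0 j) (u0 i))[k [k0 iE hE]].
  have [kp|kn] := ltP 0 k.
    have := normal_inj irr (in_setT i) (in_setT j) (ltW kp) iE.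
    by move=> ij; rewrite ij eqxx in ji.
  have {}kn : k < 0 by rewrite lt_neqAle k0.
  have [y [Py _ yN]] := face_point irr.1.
  have := yN i (in_setT i); have := yN j (in_setT j).
  rewrite !inE iE hE dotpZl => /(_ isT) yj /(_ isT); nra.
exists i; have wi : w = c i *: u i.
  rewrite wE -lin_kron -linZ; apply: eq_lin => j.
  have [->|ji] := eqVneq j i; first by rewrite kronE mulr1.
  by rewrite kronN // mulr0 other.
move: w1; rewrite wi dotpZl dotpZr u1 mulr1 => c1.
by rewrite (_ : c i = 1) ?scale1r //; nra.
Qed.

Lemma facet_arrangementE : facet_arrangement P = arrangement u h.
Proof.
apply/seteqP; split=> A.
  move=> [F /facet_has_normal[w /facet_normalP[i ->] ->] <-].
  by exists i => //; rewrite facet_hull.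
move=> [i _ <-]; exists (support_face P (u i)); last exact: facet_hull.
by have [_] := normal_facet i.
Qed.

End System.

(* In lower dimension, a normal can be turned by any vector orthogonal to the
   direction space of the affine hull. *)
Lemma full_dim_of_normals Q m (u : 'I_m -> 'rV[R]_n) w : facet_normals Q w ->
  (forall v, facet_normals Q v -> exists i, v = u i) -> has_dim Q n.
Proof.
move=> [w1 [Fw [d [dQ dF]]]] fin; have [p [W [dW QE]]] := dQ.
have w0 : w != 0 by apply: contraPneq w1 => ->; rewrite dotp0l => /esym/eqP; rewrite oner_eq0.
have [WT|] := eqVneq W fullv.
  by move: dQ; rewrite -dW WT dimvf /dim /= mul1n.
move=> /eqP WT; have [y yW] : exists y, y \notin W.
  apply: contrapT => H; apply: WT; apply/vspaceP => y; rewrite memvf.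
  by apply/negPn/negP => yW; apply: H; exists y.
pose b (o : option 'I_(\dim W)) := if o is Some i then (vbasis W)`_i else y.
(* A nonzero vector orthogonal to the direction space, obtained from [motzkin] on a basis of [W] and
   a vector [y] outside it. *)
have [z [zy zW]] : exists z, dotp z y < 0 /\ forall v, v \in W -> dotp z v = 0.
  have [|[z [zA zB]]|[c [cE _ _ [k]]]] :=
      @motzkin R n _ b [set None] [set Some i | i in 'I_(\dim W)].
  - by move=> k /imsetP[i _ ->]; rewrite inE.
  - exists z; split; first by rewrite dotpC; have := zA None; rewrite inE eqxx; apply.
    move=> v /coord_vbasis ->; rewrite dotp_sumr big1 // => i _.
    by rewrite dotpZr dotpC (zB (Some i)) ?mulr0 // imset_f.
  - rewrite inE => /eqP-> ck; exfalso; move/negP: yW; apply.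
    move: cE; rewrite /lin big_option => /eqP; rewrite addr_eq0 => /eqP yE.
    rewrite -[y]scale1r -(mulVf (lt0r_neq0 ck)) -scalerA yE memvZ // memvN.
    by apply: memv_suml => i _; rewrite memvZ // vbasis_mem // mem_nth // size_tuple.
have z0 : z != 0 by apply: contraTneq zy => ->; rewrite dotp0l ltxx.
have zQ x x' : Q x -> Q x' -> dotp z x = dotp z x'.
  move=> Qx Qx'; apply/eqP; rewrite -subr_eq0 -dotpBr zW //.
  have inW v : Q v -> v - p \in W by move=> /sub_affine_hull; rewrite QE.
  have -> : x - x' = (x - p) - (x' - p) by vring.
  by rewrite memvB ?inW.
have notpar k : w <> k *: z.
  move=> wz; suff FQ : support_face Q w = Q.
    by move: dF; rewrite FQ => /(has_dim_uniq dQ)/eqP; rewrite eqn_leq ltnn.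
  apply/seteqP; split=> x; first by case.
  by move=> Qx; split=> // x' Qx'; rewrite wz !dotpZl (zQ x' x).
have turn (s : R) : support_face Q (w + s *: z) = support_face Q w.
  apply/seteqP; split=> x [Qx Hx]; split=> // x' Qx'; have := Hx x' Qx';
    by rewrite !dotpDl !dotpZl (zQ x' x) // lerD2r.
(* The [m + 1] turned vectors all support the same facet; normalized, they would be distinct members
   of a list of length [m]. *)
have /choice[ia Hia] (j : 'I_m.+1) : exists ia : 'I_m * R,
    0 < ia.2 /\ ia.2 *: (w + j%:R *: z) = u ia.1.
  have [|a a0 a1] := @unit_scale R n (w + j%:R *: z).
    apply/eqP => /eqP; rewrite addr_eq0 -scaleNr => /eqP; exact: notpar.
  have [|i iE] := fin (a *: (w + j%:R *: z)); last by exists (i, a).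
  by split=> //; rewrite support_face_scale // turn; split; [exact: Fw | exists d].
have inj : injective (fun j => (ia j).1).
  move=> j j' /= E; have [a0 aE] := Hia j; have [a0' aE'] := Hia j'.
  have : (ia j).2 *: (w + j%:R *: z) = (ia j').2 *: (w + j'%:R *: z) by rewrite aE aE' E.
  move: (ia j).2 (ia j').2 a0 {a0' aE aE'} => a a' a0 EE.
  have E1 : (a - a') *: w = (a' * j'%:R - a * j%:R) *: z.
    apply/eqP; rewrite -subr_eq0; apply/eqP.
    have : a *: (w + j%:R *: z) - a' *: (w + j'%:R *: z) = 0 by rewrite EE subrr.
    by move=> <-; vring.
  have [aa|aa] := eqVneq (a - a') 0; last first.
    case: (notpar ((a - a')^-1 * (a' * j'%:R - a * j%:R))).
    by rewrite -scalerA -E1 scalerA mulVf // scale1r.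
  move: E1; rewrite aa scale0r; move/eqP: aa; rewrite subr_eq0 => /eqP <-.
  rewrite -mulrBr => /esym/eqP; rewrite scaler_eq0 (negbTE z0) orbF mulf_eq0 (gt_eqF a0) /=.
  by rewrite subr_eq0 eqr_nat => /eqP/esym/val_inj.
by have := leq_card _ inj; rewrite !card_ord ltnn.
Qed.

End FacetNormals.

(** * Comparison of two polytopes with the same normals *)

Lemma combinatorially_equivalent_refl (R : realType) (n : nat) (H : set (set 'rV[R]_n)) :
  combinatorially_equivalent H H.
Proof.
by exists id; split=> //; split=> [//|//|C HC]; exists C.
Qed.

Lemma reindex_irredundant (R : realType) (n m m' : nat) (u : 'I_m -> 'rV[R]_n)
    (u' : 'I_m' -> 'rV[R]_n) (h' : 'I_m' -> R) (g : 'I_m -> 'I_m') :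
  injective g -> (forall i, u i = u' (g i)) -> irredundant [set: 'I_m'] u' h' ->
  irredundant [set: 'I_m] u (h' \o g).
Proof.
move=> ginj ug irr; split.
  have [_ [x [_ xN]]] := irr.1; split; first exact: sub0set.
  by exists x; split=> i; rewrite ?inE // => _ _; rewrite ug /= xN ?inE.
move=> i _; have [_ [x [xi xN]]] := irr.2 (g i) (in_setT _); split; first exact: subsetT.
exists x; split=> j; first by rewrite inE => /eqP->; rewrite ug /= xi // inE.
by move=> _; rewrite inE => ji; rewrite ug /= xN ?inE // (inj_eq ginj).
Qed.

Theorem theorem1 (R : realType) (n : nat) (P : set 'rV[R]_n) :
  polytope P -> has_dim P n -> generating_property P -> strongly_monotypic P.
Proof.
move=> polP dimP genP Q polQ NQ.
have [m [u [h [PE irr u1]]]] := unit_system polP dimP.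
rewrite {}PE in polP dimP genP NQ *.
have gd := generating_good irr genP.
have NP w : facet_normals (poly [set: 'I_m] u h) w -> exists i, w = u i.
  exact: facet_normalP.
have u0 i : u i != 0 := normal_neq0 irr (in_setT i).
(* Without facet normals neither polytope has a facet, and both arrangements are empty. *)
case: (pselect (exists w, facet_normals Q w)) => [[w Qw]|Q0]; last first.
  have NE0 A (F : set 'rV[R]_n) : facet_normals A = facet_normals Q -> ~ facet A F.
    by move=> AQ /facet_has_normal[w Aw _]; apply: Q0; exists w; rewrite -AQ.
  have E A : facet_normals A = facet_normals Q -> facet_arrangement A = classical_sets.set0.
    by move=> AQ; apply/seteqP; split=> [B [F fF _]|//]; case: (NE0 A F AQ fF).
  by rewrite !E //; exact: combinatorially_equivalent_refl.
have dimQ : has_dim Q n by apply: (full_dim_of_normals Qw) => v; rewrite NQ; exact: NP.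
have [m' [u' [h' [QE irr' u1']]]] := unit_system polQ dimQ.
rewrite QE in dimQ NQ *.
have /choice[g ug] i : exists j, u i = u' j.
  by apply: (facet_normalP irr' u1' dimQ); rewrite NQ; exact: normal_facet.
have ginj : injective g.
  move=> i j gij; apply: (normal_inj irr (in_setT i) (in_setT j) ler01).
  by rewrite scale1r !ug gij.
rewrite !facet_arrangementE //.
(* The two lists of normals agree up to the bijection [g], so [Q] is described by [u] with other
   heights. *)
have -> : arrangement u' h' = arrangement u (h' \o g).
  apply/seteqP; split=> _ [i _ <-]; last by exists (g i); rewrite ?ug.
  have [j uj] : exists j, u' i = u j.
    by apply: NP; rewrite -NQ; exact: (normal_facet irr' u1' dimQ).
  exists j => //=; rewrite -uj; congr (hyperplane _ (h' _)).
  apply: (normal_inj irr' (in_setT _) (in_setT _) ler01).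
  by rewrite scale1r -ug.
by apply: arrangement_equivalent => //; exact: reindex_irredundant irr'.
Qed.
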